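(* Let $M$ be a finite dimensional left $\Lambda$-module such that $T=M/JM$ is a direct sum of $\mathfrak t$ pairwise non-isomorphic simple modules, let $P$ be a projective cover of $T$, let $\mathfrak s$ be the number of indecomposable summands in a decomposition of $M$ into indecomposables, and let $\mathfrak m=\dim_K\mathrm{Hom}_\Lambda(P,JM)-\dim_K\mathrm{Hom}_\Lambda(M,JM)$. (1) If $M$ is a direct sum of local modules, i.e. if $\mathfrak t-\mathfrak s=0$, then $M$ has no proper layer-stable degenerations. (2) If $\mathfrak m=0$, then every minimal layer-stable degeneration of $M$ is of the form $U\oplus M/U$, where $U\subseteq M$ is a layer-stably embedded submodule. (3) On the other hand, for any positive integer $r$, there exists an indecomposable finite dimensional module $M$ with squarefree top, over a suitable finite dimensional algebra $\Lambda$, such that $M$ has a $\mathbb P^r$-family of pairwise non-isomorphic indecomposable layer-stable degenerations.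
   Context: $K$ is an algebraically closed field and $\Lambda=KQ/I$ is a basic finite dimensional $K$-algebra, $Q$ a quiver, $I$ an admissible ideal of the path algebra $KQ$; $J$ is the Jacobson radical of $\Lambda$. All modules are finite dimensional left modules. The top of $M$ is $M/JM$; it is squarefree if it is a direct sum of pairwise non-isomorphic simple modules; $M$ is local if its top is simple. Degenerations: fix algebra generators $a_1,\dots,a_r$ of $\Lambda$. The affine variety $\mathbf{Mod}^\Lambda_d$ consists of the tuples $(x_1,\dots,x_r)\in\mathrm{End}_K(K^d)^r$ satisfying all relations satisfied by the $a_i$; $\mathrm{GL}_d$ acts by simultaneous conjugation and the orbits correspond to the isomorphism classes of $d$-dimensional modules. If $M,M'$ are $d$-dimensional modules represented by points $x,x'$, then $M'$ is a degeneration of $M$, written $M\le_{\deg}M'$, if $x'$ lies in the closure of $\mathrm{GL}_d.x$. It is proper if $M'\not\cong M$, and layer-stable if $J^lM/J^{l+1}M\cong J^lM'/J^{l+1}M'$ for all $l\ge 0$. A proper layer-stable degeneration $M'$ of $M$ is minimal layer-stable if there is no layer-stable degeneration of $M$ lying strictly between $M$ and $M'$ with respect to $\le_{\deg}$. A submodule $U\subseteq M$ is layer-stably embedded in $M$ if $(J^lM)\cap U=J^lU$ for all $l\ge 1$. A $\mathbb P^r$-family of pairwise non-isomorphic modules is a family $(M_k)_{k\in\mathbb P^r}$ of $d$-dimensional modules (fixed $d$), parametrized by the points of $\mathbb P^r$ algebraically, i.e. such that $\mathbb P^r$ has an open cover on each member of which $k\mapsto M_k$ is induced by a morphism to $\mathbf{Mod}^\Lambda_d$,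 and such that $M_k\not\cong M_{k'}$ for $k\ne k'$. *)

(* Defs.v *)
From HB Require Import structures.
From mathcomp Require Import all_boot all_algebra all_field.
From mathcomp Require Import boolp classical_sets.
From mathcomp Require Import freeg mpoly.

Set Implicit Arguments.
Unset Strict Implicit.
Unset Printing Implicit Defensive.

Import GRing.Theory.
Local Open Scope ring_scope.

(* The subspace with a given membership predicate; 0 if there is none.        *)

Section SubspaceOf.
Context (K : fieldType) (V : vectType K).

Definition subspace_of (P : V -> Prop) : {vspace V} :=
  xget 0%VS [set U : {vspace V} | forall v, v \in U <-> P v]%classic.

Lemma subspace_ofP (P : V -> Prop) :
    P 0 -> (forall c u v, P u -> P v -> P (c *: u + v)) ->
  forall v, v \in subspace_of P <-> P v.
Proof.
move=> P0 Plin.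
suff: exists U : {vspace V}, forall v, v \in U <-> P v.
  by move=> /(xgetPex 0%VS); apply.
pose sub (U : {vspace V}) := forall v, v \in U -> P v.
have sub0 : sub 0%VS by move=> v; rewrite memv0 => /eqP->.
have grow (U : {vspace V}) : sub U -> forall x, P x -> sub (U + <[x]>)%VS.
  move=> sU x Px v /memv_addP[u Uu [_ /vlineP[c ->] ->]].
  by rewrite addrC; apply: Plin => //; apply: sU.
suff main n : forall U, sub U -> (dim V - \dim U <= n)%N ->
    exists U' : {vspace V}, forall v, v \in U' <-> P v.
  exact: (main (dim V) 0%VS sub0 (leq_subr _ _)).
elim: n => [|n IHn] U sU leUn.
  exists U => v; split; first exact: sU.
  have /eqP -> : U == fullv.
    by rewrite eqEdim subvf dimvf /=; move: leUn; rewrite leqn0 subn_eq0.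
  by rewrite memvf.
have [[x [Px xU]]|all_in] := pselect (exists x, P x /\ x \notin U); last first.
  exists U => v; split; first exact: sU.
  by move=> Pv; apply/negPn/negP => vU; apply: all_in; exists v.
apply: (IHn (U + <[x]>)%VS (grow U sU x Px)).
have ltU : (\dim U < \dim (U + <[x]>))%N.
  rewrite ltnNge; apply: contra xU => le.
  have /eqP -> : U == (U + <[x]>)%VS by rewrite eqEdim addvSl.
  exact: (subvP (addvSr _ _)) (memv_line x).
have : (\dim (U + <[x]>)%VS <= dim V)%N by rewrite -dimvf dimvS ?subvf.
move: leUn ltU; rewrite !leq_subLR => h1 h2 _.
by apply: leq_trans h1 _; rewrite addnS -addSn leq_add2r.
Qed.

End SubspaceOf.

Record quiver := Quiver {
  vertex : finType;
  arrow : finType;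
  src : arrow -> vertex;
  tgt : arrow -> vertex }.

Section PathAlgebra.
Context (K : fieldType) (Q : quiver).

Fixpoint chain (i : vertex Q) (w : seq (arrow Q)) : bool :=
  if w is a :: w' then (src a == i) && chain (tgt a) w' else true.

(* The path that starts at p.1 and runs through the arrows of p.2 in order.   *)
Definition qpath := {p : vertex Q * seq (arrow Q) | chain p.1 p.2}.

Definition qpath0 (i : vertex Q) : qpath := exist _ (i, [::]) isT.
Definition pstart (p : qpath) : vertex Q := (val p).1.
Definition parrows (p : qpath) : seq (arrow Q) := (val p).2.
Definition pend (p : qpath) : vertex Q :=
  last (pstart p) [seq tgt a | a <- parrows p].
Definition plength (p : qpath) : nat := size (parrows p).

(* "q, then p", if q ends where p starts; by pcompE the insub never fails.    *)
Definition pcomp (p q : qpath) : option qpath :=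
  if pend q == pstart p
  then insub (pstart q, parrows q ++ parrows p) : option qpath else None.

Lemma chain_cat i w1 w2 :
  chain i (w1 ++ w2) = chain i w1 && chain (last i [seq tgt a | a <- w1]) w2.
Proof. by elim: w1 i => //= a w1 IHw i; rewrite IHw andbA. Qed.

Lemma pcompE (p q : qpath) : pend q = pstart p ->
  omap val (pcomp p q) = Some (pstart q, parrows q ++ parrows p).
Proof.
move=> eqp; rewrite /pcomp eqp eqxx; case: insubP => [r _ /= -> //|/negP[]].
rewrite /= chain_cat -/(pend q) eqp; apply/andP; split; [exact: (valP q)|exact: (valP p)].
Qed.

Definition path_alg := {freeg qpath / K}.

Definition pa_one : path_alg := \sum_i << qpath0 i >>.

Definition pa_mul (x y : path_alg) : path_alg :=
  \sum_(p <- dom x) \sum_(q <- dom y)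
     if pcomp p q is Some pq then << coeff p x * coeff q y *g pq >> else 0.

(* The m-th power of the arrow ideal: the span of the paths of length >= m.   *)
Definition arrow_ideal_pow (m : nat) (x : path_alg) : Prop :=
  {in dom x, forall p, (m <= plength p)%N}.

Definition admissible (I : path_alg -> Prop) : Prop :=
  (exists2 m, (2 <= m)%N & forall x, arrow_ideal_pow m x -> I x) /\
  (forall x, I x -> arrow_ideal_pow 2 x).

(* An identification of A with KQ/I, as a surjective homomorphism of          *)
(* algebras KQ -> A with kernel I.                                            *)
Record presentation (A : falgType K) := Presentation {
  pres_map :> {linear path_alg -> A};
  pres1 : pres_map pa_one = 1;
  presM : forall x y, pres_map (pa_mul x y) = pres_map x * pres_map y;
  pres_surj : forall a, exists x, pres_map x = a;
  pres_adm : admissible (fun x => pres_map x = 0) }.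

End PathAlgebra.

Section Modules.
Context (K : fieldType) (A : falgType K).

Record fdmod := FdMod {
  fdmod_sort :> vectType K;
  act : A -> 'End(fdmod_sort);
  act_linear : linear act;
  act1 : act 1 = \1%VF;
  actM : forall a b, act (a * b) = (act a \o act b)%VF }.

Arguments act : clear implicits.

Lemma act_linE (M : fdmod) c a b :
  act M (c *: a + b) = c *: act M a + act M b.
Proof. exact: act_linear. Qed.

Definition is_hom (M N : fdmod) (f : 'Hom(M, N)) : Prop :=
  forall a, (f \o act M a)%VF = (act N a \o f)%VF.

Definition HomA (M N : fdmod) : {vspace 'Hom(M, N)} := subspace_of (@is_hom M N).

Lemma mem_HomA (M N : fdmod) (f : 'Hom(M, N)) : f \in HomA M N <-> is_hom f.
Proof.
apply: subspace_ofP => [a|c g h hg hh a]; first by rewrite comp_lfun0l comp_lfun0r.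
by rewrite comp_lfunDl comp_lfunDr -comp_lfunZl -comp_lfunZr hg hh.
Qed.

Definition miso (M N : fdmod) : Prop :=
  exists f : 'Hom(M, N), [/\ is_hom f, lker f = 0%VS & limg f = fullv].

Record submodule (M : fdmod) := Submodule {
  submodule_space :> {vspace M};
  submodule_stable : forall a, (act M a @: submodule_space <= submodule_space)%VS }.

Lemma mem_submodule (M : fdmod) (U : submodule M) a u :
  u \in (U : {vspace M}) -> act M a u \in (U : {vspace M}).
Proof. by move=> Uu; apply: (subvP (submodule_stable U a)); apply: memv_img. Qed.

Lemma fullm_stable (M : fdmod) a : (act M a @: fullv <= fullv)%VS.
Proof. exact: subvf. Qed.
Definition fullm (M : fdmod) : submodule M := Submodule (@fullm_stable M).

Section SubQuot.
Context (M : fdmod) (U : submodule M).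
Let sp : {vspace M} := U.

Definition sub_fun (a : A) (u : subvs_of sp) : subvs_of sp :=
  vsproj sp (act M a (vsval u)).
Lemma sub_fun_linear a : linear (sub_fun a).
Proof. by move=> c u v; rewrite /sub_fun !linearP. Qed.
HB.instance Definition _ a := GRing.isSemilinear.Build K _ _ _ (sub_fun a)
  (GRing.semilinear_linear (@sub_fun_linear a)).
Definition sub_act (a : A) : 'End(subvs_of sp) := linfun (sub_fun a).

Lemma sub_act_linear : linear sub_act.
Proof.
move=> c a b; apply/lfunP => u.
by rewrite add_lfunE scale_lfunE !lfunE /= /sub_fun act_linE
  add_lfunE scale_lfunE linearP.
Qed.
Lemma sub_act1 : sub_act 1 = \1%VF.
Proof.
apply/lfunP => u; apply/val_inj.
by rewrite !lfunE /= /sub_fun act1 id_lfunE vsvalK.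
Qed.
Lemma sub_actM a b : sub_act (a * b) = (sub_act a \o sub_act b)%VF.
Proof.
apply/lfunP => u; rewrite comp_lfunE !lfunE /= /sub_fun actM comp_lfunE.
by rewrite vsprojK // mem_submodule // subvsP.
Qed.
Definition subm : fdmod := FdMod sub_act_linear sub_act1 sub_actM.

(* M/U, carried by the complement U^C of U in M: quotm_map below, with        *)
(* kernel U, is the canonical projection.                                     *)
Definition quo_fun (v : M) : subvs_of sp^C := vsproj sp^C (daddv_pi sp^C sp v).
Lemma quo_fun_linear : linear quo_fun.
Proof. by move=> c u v; rewrite /quo_fun !linearP. Qed.
HB.instance Definition _ := GRing.isSemilinear.Build K _ _ _ quo_fun
  (GRing.semilinear_linear quo_fun_linear).
Definition quotm_map : 'Hom(M, subvs_of sp^C) := linfun quo_fun.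

Definition quo_act (a : A) : 'End(subvs_of sp^C) :=
  (quotm_map \o act M a \o linfun vsval)%VF.

Lemma capCU : (sp^C :&: sp = 0)%VS. Proof. by rewrite capvC capv_compl. Qed.

Lemma quotm_map_val (w : subvs_of sp^C) : quotm_map (vsval w) = w.
Proof.
rewrite lfunE /= /quo_fun daddv_pi_id ?subvsP ?vsvalK //; exact: capCU.
Qed.

Lemma quotm_map_vsvalB v : vsval (quotm_map v) - v \in sp.
Proof.
rewrite lfunE /= /quo_fun vsprojK ?memv_pi //.
have /(_ v) := daddv_pi_add capCU; rewrite addvC addv_complf memvf => /(_ isT).
move=> {2}<-; rewrite opprD addrA subrr add0r memvN; exact: memv_pi.
Qed.

Lemma lker_quotm_map : lker quotm_map = sp.
Proof.
apply/vspaceP => v; rewrite memv_ker; apply/eqP/idP => [h|spv].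
  by have := quotm_map_vsvalB v; rewrite h linear0 sub0r memvN.
apply: subvs_inj; rewrite linear0; apply/eqP; rewrite -memv0 -capCU memv_cap.
by rewrite subvsP -(subrK v (vsval _)) memvD ?quotm_map_vsvalB.
Qed.

Lemma limg_quotm_map : limg quotm_map = fullv.
Proof.
apply/vspaceP => w; rewrite memvf; apply/memv_imgP.
by exists (vsval w); rewrite ?memvf ?quotm_map_val.
Qed.

Lemma quo_actE a v : quo_act a (quotm_map v) = quotm_map (act M a v).
Proof.
rewrite !comp_lfunE [linfun vsval _]lfunE /=; apply/eqP; rewrite -subr_eq0.
rewrite -(linearB quotm_map) -(linearB (act M a)) -memv_ker lker_quotm_map; apply: mem_submodule; exact: quotm_map_vsvalB.
Qed.

Lemma quo_act_linear : linear quo_act.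
Proof.
move=> c a b; rewrite /quo_act act_linE.
by rewrite comp_lfunDr -comp_lfunZr comp_lfunDl -comp_lfunZl.
Qed.
Lemma quo_act1 : quo_act 1 = \1%VF.
Proof.
apply/lfunP => w; rewrite -[w]quotm_map_val quo_actE act1 !id_lfunE.
by rewrite quotm_map_val.
Qed.
Lemma quo_actM a b : quo_act (a * b) = (quo_act a \o quo_act b)%VF.
Proof.
apply/lfunP => w; rewrite -[w]quotm_map_val comp_lfunE !quo_actE actM.
by rewrite comp_lfunE.
Qed.
Definition quotm : fdmod := FdMod quo_act_linear quo_act1 quo_actM.

Lemma quotm_map_hom : @is_hom M quotm quotm_map.
Proof. by move=> a; apply/lfunP => v; rewrite [LHS]comp_lfunE [RHS]comp_lfunE -quo_actE. Qed.

End SubQuot.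

Section DirectSum.
Context (M N : fdmod).

Definition dsum_fun (a : A) (u : M * N) : M * N := (act M a u.1, act N a u.2).
Lemma dsum_fun_linear a : linear (dsum_fun a).
Proof. by move=> c u v; rewrite /dsum_fun /= !linearP. Qed.
HB.instance Definition _ a := GRing.isSemilinear.Build K _ _ _ (dsum_fun a)
  (GRing.semilinear_linear (@dsum_fun_linear a)).
Definition dsum_act (a : A) : 'End((M * N)%type) := linfun (dsum_fun a).

Lemma dsum_act_linear : linear dsum_act.
Proof.
move=> c a b; apply/lfunP => u.
by rewrite add_lfunE scale_lfunE !lfunE /= /dsum_fun /= !act_linE
  !add_lfunE !scale_lfunE.
Qed.
Lemma dsum_act1 : dsum_act 1 = \1%VF.
Proof.
by apply/lfunP => -[u v]; rewrite !lfunE /= /dsum_fun /= !act1 !id_lfunE.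
Qed.
Lemma dsum_actM a b : dsum_act (a * b) = (dsum_act a \o dsum_act b)%VF.
Proof.
by apply/lfunP => u; rewrite comp_lfunE !lfunE /= /dsum_fun /= !actM !comp_lfunE.
Qed.
Definition dsum : fdmod := FdMod dsum_act_linear dsum_act1 dsum_actM.

End DirectSum.

Definition nonzero (M : fdmod) : Prop := fullv <> 0%VS :> {vspace M}.

Definition simple (M : fdmod) : Prop :=
  nonzero M /\
  forall U : submodule M, U = 0%VS :> {vspace M} \/ U = fullv :> {vspace M}.

Definition internal_dsum (M : fdmod) n (U : 'I_n -> submodule M) : Prop :=
  (\sum_(i < n) submodule_space (U i))%VS = fullv /\
  directv (\sum_(i < n) submodule_space (U i)).

Definition indecomposable (M : fdmod) : Prop :=
  nonzero M /\
  forall U V : submodule M, (U + V)%VS = fullv -> (U :&: V)%VS = 0%VS ->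
    U = 0%VS :> {vspace M} \/ V = 0%VS :> {vspace M}.

Definition indec_decomp (s : nat) (M : fdmod) : Prop :=
  exists U : 'I_s -> submodule M,
    internal_dsum U /\ forall i, indecomposable (subm (U i)).

Definition left_ideal (I : {vspace A}) : Prop :=
  forall a x, x \in I -> a * x \in I.

(* Left ideals of A are K-subspaces, so ranging over {vspace A} is no loss. *)
Definition maximal_left_ideal (I : {vspace A}) : Prop :=
  [/\ left_ideal I, I <> fullv &
      forall L : {vspace A}, left_ideal L -> (I <= L)%VS -> L = I \/ L = fullv].

Definition jacobson : {vspace A} :=
  subspace_of (fun x => forall I, maximal_left_ideal I -> x \in I).

Lemma mem_jacobson x :
  x \in jacobson <-> forall I, maximal_left_ideal I -> x \in I.
Proof.
apply: subspace_ofP => [I _|c u v hu hv I mI]; first exact: mem0v.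
by rewrite memvD ?memvZ ?hu ?hv.
Qed.

Section RadicalAction.
Context (M : fdmod) (U : submodule M).

Definition J_space : {vspace M} :=
  (\sum_(i < \dim jacobson) act M (vbasis jacobson)`_i @: U)%VS.

Lemma mem_J_space x u :
  x \in jacobson -> u \in (U : {vspace M}) -> act M x u \in J_space.
Proof.
move=> Jx Uu; pose f y := act M y u.
have f_lin : linear f.
  by move=> c y z; rewrite /f act_linE add_lfunE scale_lfunE.
pose g := linfun (HB.pack_for {linear A -> M} f
  (GRing.isSemilinear.Build K _ _ _ f (GRing.semilinear_linear f_lin))).
have gE y : g y = act M y u by rewrite lfunE.
rewrite -gE (coord_vbasis Jx) linear_sum memv_suml // => i _.
rewrite linearZ memvZ //= gE /J_space.
apply: (subvP (sumv_sup i _ (subvv _))) => //; exact: memv_img.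
Qed.

Lemma J_space_stable a : (act M a @: J_space <= J_space)%VS.
Proof.
rewrite /J_space limg_sum; apply/subv_sumP => i _.
apply/subvP => _ /memv_imgP[_ /memv_imgP[u Uu ->] ->].
rewrite -comp_lfunE -actM; apply: mem_J_space => //.
apply/mem_jacobson => I mI; have [lI _ _] := mI; apply: lI.
by move: I mI; apply/mem_jacobson; rewrite vbasis_mem ?mem_nth ?size_tuple.
Qed.

Definition Jmul : submodule M := Submodule J_space_stable.

End RadicalAction.

Definition Jpow (l : nat) (M : fdmod) (U : submodule M) : submodule M :=
  iter l (@Jmul M) U.

Definition rad (M : fdmod) : fdmod := subm (Jmul (fullm M)).
Definition top (M : fdmod) : fdmod := quotm (Jmul (fullm M)).

(* J^l M / J^(l+1) M, as the top of J^l M. *)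
Definition layer (l : nat) (M : fdmod) : fdmod := top (subm (Jpow l (fullm M))).

Definition local (M : fdmod) : Prop := simple (top M).

Definition sum_of_locals (M : fdmod) : Prop :=
  exists n (U : 'I_n -> submodule M),
    internal_dsum U /\ forall i, local (subm (U i)).

Definition squarefree_top (t : nat) (M : fdmod) : Prop :=
  exists S : 'I_t -> submodule (top M),
    [/\ internal_dsum S, forall i, simple (subm (S i)) &
        forall i j, i != j -> ~ miso (subm (S i)) (subm (S j))].

Definition projective (P : fdmod) : Prop :=
  forall (M N : fdmod) (g : 'Hom(M, N)) (f : 'Hom(P, N)),
    is_hom g -> limg g = fullv -> is_hom f ->
    exists2 h : 'Hom(P, M), is_hom h & (g \o h)%VF = f.

Definition projective_cover (P T : fdmod) : Prop :=
  projective P /\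
  exists p : 'Hom(P, T), [/\ is_hom p, limg p = fullv &
    forall U : submodule P, (U + lker p)%VS = fullv -> U = fullv :> {vspace P}].

Definition frak_m (P M : fdmod) : int :=
  (\dim (HomA P (rad M)))%:Z - (\dim (HomA M (rad M)))%:Z.

Definition layer_stably_embedded (M : fdmod) (U : submodule M) : Prop :=
  forall l, (1 <= l)%N -> (Jpow l (fullm M) :&: U)%VS = Jpow l U :> {vspace M}.

Definition generates n (a : 'I_n -> A) : Prop := agenv <<codom a>>%VS = fullv.

Section Varieties.
Context (n : nat) (a : 'I_n -> A).

Definition mpoint (d : nat) := {ffun 'I_n -> 'M[K]_d}.

(* rho is an element of the free algebra on n letters, written in its basis   *)
(* of words.                                                                  *)
Definition mod_variety d (x : mpoint d) : Prop :=
  forall rho : {freeg (seq 'I_n) / K},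
    \sum_(w <- dom rho) coeff w rho *: \prod_(i <- w) a i = 0 ->
    \sum_(w <- dom rho) coeff w rho *: \prod_(i <- w) x i = 0.

(* x is a point of the module variety and M is K^d with the action of x.      *)
Definition represents d (x : mpoint d) (M : fdmod) : Prop :=
  mod_variety x /\
  exists f : 'Hom('cV[K]_d, M), [/\ lker f = 0%VS, limg f = fullv &
    forall i v, f (x i *m v) = act M (a i) (f v)].

Definition coordinates d (x : mpoint d)
    (k : 'I_#|{: 'I_n * 'I_d * 'I_d}|) : K :=
  let: (i, p, q) := enum_val k in x i p q.

Definition zariski_closed d (Z : mpoint d -> Prop) : Prop :=
  exists F : {mpoly K[#|{: 'I_n * 'I_d * 'I_d}|]} -> Prop,
    forall x, Z x <-> forall p, F p -> p.@[coordinates x] = 0.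

Definition zariski_closure d (S : mpoint d -> Prop) (x : mpoint d) : Prop :=
  forall Z, zariski_closed Z -> (forall y, S y -> Z y) -> Z x.

Definition orbit d (x y : mpoint d) : Prop :=
  exists2 g : 'M[K]_d, g \in unitmx & forall i, y i = g *m x i *m invmx g.

Definition degeneration (M M' : fdmod) : Prop :=
  exists d (x x' : mpoint d),
    [/\ represents x M, represents x' M' & zariski_closure (orbit x) x'].

Definition layer_stable_degeneration (M M' : fdmod) : Prop :=
  degeneration M M' /\ forall l, miso (layer l M) (layer l M').

Definition proper_layer_stable_degeneration (M M' : fdmod) : Prop :=
  layer_stable_degeneration M M' /\ ~ miso M M'.

Definition minimal_layer_stable_degeneration (M M' : fdmod) : Prop :=
  proper_layer_stable_degeneration M M' /\
  ~ exists N, [/\ proper_layer_stable_degeneration M N,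
                  degeneration N M' & ~ miso N M'].

(* Points of P^r are the lines in K^(r+1).                                    *)
Definition proj_space (r : nat) := {L : {vspace 'rV[K]_r.+1} | \dim L == 1%N}.

(* A choice of homogeneous coordinates of L.                                  *)
Definition hcoord r (L : proj_space r) (i : 'I_r.+1) : K :=
  vpick (val L) ord0 i.

Definition proj_open r (U : proj_space r -> Prop) : Prop :=
  exists F : {mpoly K[r.+1]} -> Prop,
    (forall f, F f -> exists e, f \is e.-homog) /\
    (forall L, U L <-> exists2 f, F f & f.@[hcoord L] != 0).

Definition regular_on r (U : proj_space r -> Prop) (h : proj_space r -> K) :
    Prop :=
  forall L, U L ->
    exists (V : proj_space r -> Prop) (e : nat) (f g : {mpoly K[r.+1]}),
      [/\ proj_open V, V L, f \is e.-homog, g \is e.-homog &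
          forall L', U L' -> V L' ->
            g.@[hcoord L'] != 0 /\ h L' = f.@[hcoord L'] / g.@[hcoord L']].

Definition morphism_to_mod r d (U : proj_space r -> Prop)
    (x : proj_space r -> mpoint d) : Prop :=
  (forall L, U L -> mod_variety (x L)) /\
  forall i p q, regular_on U (fun L => x L i p q).

Definition proj_family r (F : proj_space r -> fdmod) : Prop :=
  exists d, forall L,
    exists (U : proj_space r -> Prop) (x : proj_space r -> mpoint d),
      [/\ proj_open U, U L, morphism_to_mod U x &
          forall L', U L' -> represents (x L') (F L')].

End Varieties.

End Modules.

(* Main.v *)
Require Import Defs.
From HB Require Import structures.
From mathcomp Require Import all_boot all_algebra all_field.
From mathcomp Require Import boolp.
From mathcomp Require Import freeg mpoly.

(** Let [z i] be lifts to [M] of a basis of its top, sitting at pairwise distinct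
    vertices (a frame, [squarefree_frame]). Since the top is squarefree, a homomorphism
    that sends the [z i] to vectors at the same vertices is described, modulo radicals,
    by one scalar for each [i].

    (1) The numbers [t] and [s] agree exactly when all indecomposable summands are local,
    because tops are additive and summands of sums of local modules are quotients of
    local modules ([locals_iff]). For the rigidity, let [M'] be a layer-stable
    degeneration of the sum [M] of local modules, and build surjections from [M'] onto
    [M / J ^ l M] by induction on [l] ([locals_rigid]). The dimension of [Hom (-, X)] can
    only grow under degeneration ([degeneration_Hom]); by layer stability it does not grow
    for the radical of [X = M / J ^ l.+1 M]; and the projections of [M] onto its local
    summands realize all scalars in homomorphisms from [M] to [X]. So all scalars are
    realized by homomorphisms from [M'] to [X], and a homomorphism for which all of them
    are one is onto by Nakayama's lemma.

    (2) If [frak_m] vanishes, a dimension count shows that every change of the [z i] by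
    vectors of the radical at the right vertices extends to an endomorphism of [M]
    ([frak_m0_hom]). Hence, up to isomorphism, [M] is described by its coordinates in a
    basis of the form [w k *: z (j k)], and these coordinates are unique up to the action
    of a torus that rescales the [z i] ([chart_torus]). Such coordinates extend over a
    neighbourhood of a point of [M'] ([universal_chart]), so a degeneration of [M] is
    governed by the limits of the ratios of the torus parameters [th i]. If the ratio
    [th i0 / th l0] belongs to a nonzero coordinate and tends to zero, the [z k] for which
    [th l0 / th k] stays finite generate a submodule [U], and [U (+) M/U] lies between [M]
    and [M'] ([minimal_split]).

    (3) Over the algebra of paths of length at most two of an explicit quiver
    ([ex_quiver]) there is a family of modules [exM om] that share the underlying space
    and all structure maps but one, which marks the vector [om] of [K ^ r.+2]. If
    the last coordinate of [om] vanishes, the isomorphism class amounts to the line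
    spanned by [om]; otherwise it does not depend on [om] at all. So the modules whose last coordinate
    vanishes form a family over the projective space of dimension [r], all of them
    limits, along affine lines, of the module with parameter the last unit vector. The
    radical layers do not depend on [om] ([ex_layers]), and the modules are
    indecomposable for [om] nonzero because an idempotent endomorphism is zero or the
    identity ([ex_indecomposable]). *)

Import GRing.Theory.
Local Open Scope ring_scope.
Set Implicit Arguments.
Unset Strict Implicit.
Unset Printing Implicit Defensive.

(** * Linear maps and homomorphisms *)

Section LinearMaps.
Context (K : fieldType) (V W : vectType K).

(** Packs a proof of linearity that is only available locally, inside a proof. *)
Definition mklin (f : V -> W) (fl : linear f) : 'Hom(V, W) :=
  linfun (HB.pack_for {linear V -> W} f
    (GRing.isSemilinear.Build K V W _ f (GRing.semilinear_linear fl))).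

Lemma mklinE (f : V -> W) (fl : linear f) v : mklin fl v = f v.
Proof. by rewrite lfunE. Qed.

Lemma limg_full_dim (f : 'Hom(V, W)) :
  limg f = fullv -> (dim W <= dim V)%N.
Proof.
by move=> h; rewrite -!dimvf -h -(limg_ker_dim f fullv) leq_addl.
Qed.

Lemma surj_inj (f : 'Hom(V, W)) :
  limg f = fullv -> dim V = dim W -> lker f = 0%VS.
Proof.
move=> h e; apply/eqP; rewrite -dimv_eq0.
have := limg_ker_dim f fullv; rewrite capfv h !dimvf e => /eqP.
by rewrite -[X in _ == X]add0n eqn_add2r.
Qed.

Lemma inj_surj (f : 'Hom(V, W)) :
  lker f = 0%VS -> dim V = dim W -> limg f = fullv.
Proof.
move=> h e; apply/eqP; rewrite eqEdim subvf /=.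
by rewrite limg_dim_eq ?h ?capv0 // !dimvf e.
Qed.

Lemma limg_fullP (f : 'Hom(V, W)) :
  limg f = fullv <-> forall w, exists v, f v = w.
Proof.
split=> [h w|h].
  have /memv_imgP[v _ ->] : w \in limg f by rewrite h memvf.
  by exists v.
apply/vspaceP => w; rewrite memvf; have [v <-] := h w.
by rewrite memv_img ?memvf.
Qed.

Lemma lker0_inj (f : 'Hom(V, W)) : lker f = 0%VS <-> injective f.
Proof. by split=> [/eqP/lker0P|/lker0P/eqP]. Qed.

Lemma inj_dim_le (f : 'Hom(V, W)) (U : {vspace V}) (X : {vspace W}) :
  {in U, forall u, f u \in X} -> {in U, forall u, f u = 0 -> u = 0} ->
  (\dim U <= \dim X)%N.
Proof.
move=> fX f0; rewrite -(@limg_dim_eq _ _ _ f U); last first.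
  apply/eqP; rewrite -subv0; apply/subvP => u; rewrite memv_cap memv_ker memv0.
  by move=> /andP[Uu /eqP/(f0 _ Uu)->].
by apply: dimvS; apply/subvP => _ /memv_imgP[u Uu ->]; apply: fX.
Qed.

End LinearMaps.

Section Modules.
Context (K : fieldType) (A : falgType K).
Implicit Types M N X Y : fdmod A.

Lemma homE M N (f : 'Hom(M, N)) :
  is_hom f <-> forall a v, f (act M a v) = act N a (f v).
Proof.
split=> [h a v|h a]; first by rewrite -comp_lfunE h comp_lfunE.
by apply/lfunP => v; rewrite !comp_lfunE.
Qed.

Lemma actME M a b v : act M (a * b) v = act M a (act M b v).
Proof. by rewrite actM comp_lfunE. Qed.

Lemma act1E M v : act M 1 v = v.
Proof. by rewrite act1 id_lfunE. Qed.

Lemma actDE M a b v : act M (a + b) v = act M a v + act M b v.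
Proof. by rewrite -[a]scale1r act_linE add_lfunE scale_lfunE scale1r scale1r. Qed.

Lemma act0E M v : act M 0 v = 0.
Proof.
by apply: (addrI (act M 0 v)); rewrite -actDE !addr0.
Qed.

Lemma actZE M c a v : act M (c *: a) v = c *: act M a v.
Proof. by rewrite -[c *: a]addr0 act_linE add_lfunE scale_lfunE act0E addr0. Qed.

Lemma act_sumE M (I : Type) (r : seq I) (P : pred I) (F : I -> A) v :
  act M (\sum_(i <- r | P i) F i) v = \sum_(i <- r | P i) act M (F i) v.
Proof.
by apply: (big_morph (fun a => act M a v)) => [a b|]; rewrite ?actDE ?act0E.
Qed.

Lemma is_hom_id M : is_hom (\1%VF : 'Hom(M, M)).
Proof. by apply/homE => a v; rewrite !id_lfunE. Qed.

Lemma is_hom_comp M N X (g : 'Hom(N, X)) (f : 'Hom(M, N)) :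
  is_hom g -> is_hom f -> is_hom (g \o f)%VF.
Proof.
by move=> /homE hg /homE hf; apply/homE => a v; rewrite !comp_lfunE hf hg.
Qed.

Lemma is_homD M N (f g : 'Hom(M, N)) : is_hom f -> is_hom g -> is_hom (f + g).
Proof. by move=> /mem_HomA hf /mem_HomA hg; apply/mem_HomA/memvD. Qed.

Lemma is_hom_inv M N (f : 'Hom(M, N)) :
  is_hom f -> lker f = 0%VS -> limg f = fullv -> is_hom (f^-1)%VF.
Proof.
move=> /homE hf /eqP f0 ff; apply/homE => a v.
have fV w : f (f^-1%VF w) = w by rewrite limg_lfunVK // ff memvf.
by apply: (lker0P f0); rewrite fV hf fV.
Qed.

Lemma miso_sym M N : miso M N -> miso N M.
Proof.
move=> [f [hf f0 ff]]; exists (f^-1)%VF; split; first exact: is_hom_inv.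
  have fV w : f (f^-1%VF w) = w by rewrite limg_lfunVK // ff memvf.
  by apply/lker0_inj => u v /(congr1 f); rewrite !fV.
apply/limg_fullP => v; exists (f v); exact: (lker0_lfunK (introT eqP f0)).
Qed.

Lemma miso_trans M N X : miso M N -> miso N X -> miso M X.
Proof.
move=> [f [hf /lker0_inj f0 /limg_fullP ff]] [g [hg /lker0_inj g0 /limg_fullP gf]].
exists (g \o f)%VF; split; first exact: is_hom_comp.
  by apply/lker0_inj => u v; rewrite !comp_lfunE => /g0/f0.
apply/limg_fullP => w; have [v <-] := gf w; have [u <-] := ff v.
by exists u; rewrite comp_lfunE.
Qed.

Lemma miso_surj M N (f : 'Hom(M, N)) :
  is_hom f -> limg f = fullv -> dim M = dim N -> miso M N.
Proof. by move=> hf ff e; exists f; split=> //; apply: surj_inj. Qed.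

Lemma miso_inj M N (f : 'Hom(M, N)) :
  is_hom f -> lker f = 0%VS -> dim M = dim N -> miso M N.
Proof. by move=> hf ff e; exists f; split=> //; apply: inj_surj. Qed.

(** ** Submodules, quotients and direct sums *)

Lemma stableP M (U : {vspace M}) :
  (forall a u, u \in U -> act M a u \in U) -> forall a, (act M a @: U <= U)%VS.
Proof. by move=> h a; apply/subvP => _ /memv_imgP[u Uu ->]; apply: h. Qed.

Definition submod_of M (U : {vspace M}) (h : forall a u, u \in U -> act M a u \in U)
  : submodule M := Submodule (stableP h).

Definition zerom M : submodule M.
Proof.
by apply: (@submod_of M 0%VS) => a u; rewrite !memv0 => /eqP->; rewrite linear0.
Defined.

Definition imm M N (f : 'Hom(M, N)) (hf : is_hom f) (U : submodule M) : submodule N.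
Proof.
apply: (@submod_of N (f @: U)%VS) => a _ /memv_imgP[u Uu ->].
by move/homE: hf => <-; rewrite memv_img // mem_submodule.
Defined.

Definition prem M N (f : 'Hom(M, N)) (hf : is_hom f) (U : submodule N) : submodule M.
Proof.
apply: (@submod_of M (f @^-1: U)%VS) => a u; rewrite -!memv_preim.
by move/homE: hf => ->; apply: mem_submodule.
Defined.

Definition incl M (U : submodule M) : 'Hom(subm U, M) :=
  linfun (@vsval K M U).

Lemma inclE M (U : submodule M) u : incl U u = vsval u.
Proof. by rewrite lfunE. Qed.

Lemma sub_actE M (U : submodule M) a (u : subm U) :
  vsval (act (subm U) a u) = act M a (vsval u).
Proof.
by rewrite /= /sub_act lfunE /= /sub_fun vsprojK // mem_submodule // subvsP.
Qed.

Lemma incl_hom M (U : submodule M) : is_hom (incl U).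
Proof. by apply/homE => a u; rewrite !inclE sub_actE. Qed.

Lemma incl_inj M (U : submodule M) : injective (incl U).
Proof. by move=> u v; rewrite !inclE => /subvs_inj. Qed.

Lemma limg_incl M (U : submodule M) : limg (incl U) = U.
Proof.
apply/vspaceP => v; apply/memv_imgP/idP => [[u _ ->]|Uv].
  by rewrite inclE subvsP.
by exists (vsproj U v); rewrite ?memvf // inclE vsprojK.
Qed.

Lemma dim_subm M (U : submodule M) : dim (subm U) = \dim U.
Proof.
rewrite -dimvf -[in RHS]limg_incl limg_dim_eq //.
have /lker0_inj -> := @incl_inj M U; exact: capv0.
Qed.

Lemma vsproj_hom M N (f : 'Hom(M, N)) (U : submodule N) :
  is_hom f -> (forall v, f v \in (U : {vspace N})) ->
  exists2 g : 'Hom(M, subm U), is_hom g & forall v, vsval (g v) = f v.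
Proof.
move=> /homE hf fU.
exists (linfun (@vsproj K N U) \o f)%VF => [|v]; last first.
  by rewrite comp_lfunE lfunE /= vsprojK.
apply/homE => a v; apply: subvs_inj; rewrite sub_actE !comp_lfunE !lfunE /=.
by rewrite !vsprojK // hf.
Qed.

Lemma quotm_hom M (U : submodule M) a v :
  quotm_map U (act M a v) = act (quotm U) a (quotm_map U v).
Proof. by have /homE-> := quotm_map_hom U. Qed.

Lemma quotm_surj M (U : submodule M) (w : quotm U) : exists v, quotm_map U v = w.
Proof. by exists (vsval w); rewrite quotm_map_val. Qed.

Lemma quotm_eq0 M (U : submodule M) v :
  (quotm_map U v == 0) = (v \in (U : {vspace M})).
Proof. by rewrite -memv_ker lker_quotm_map. Qed.

Lemma quotm_ker M (U : submodule M) v :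
  quotm_map U v = 0 <-> v \in (U : {vspace M}).
Proof. by rewrite -quotm_eq0; split=> /eqP. Qed.

Lemma dim_quotm M (U : submodule M) : (dim (quotm U) + \dim U)%N = dim M.
Proof.
rewrite -!dimvf -(limg_quotm_map U) -(limg_ker_dim (quotm_map U) fullv) capfv.
by rewrite lker_quotm_map addnC.
Qed.

(** A homomorphism that is onto identifies its target with the quotient by its
    kernel, so whatever kills the kernel factors through it. *)
Lemma hom_factor M N X (g : 'Hom(M, N)) (h : 'Hom(M, X)) :
  is_hom g -> limg g = fullv -> is_hom h ->
  (forall v, g v = 0 -> h v = 0) ->
  exists2 k : 'Hom(N, X), is_hom k & forall v, k (g v) = h v.
Proof.
move=> /homE hg gf /homE hh gh.
have gV w : g (g^-1%VF w) = w by rewrite limg_lfunVK // gf memvf.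
have kE v : (h \o g^-1)%VF (g v) = h v.
  rewrite comp_lfunE; apply/eqP; rewrite -subr_eq0 -linearB; apply/eqP/gh.
  by rewrite linearB /= gV subrr.
exists (h \o g^-1)%VF => //; apply/homE => a w.
by rewrite -[w]gV -hg !kE hh.
Qed.

Lemma dsum_actE M N a (u : dsum M N) :
  act (dsum M N) a u = (act M a u.1, act N a u.2).
Proof. by rewrite /= /dsum_act lfunE. Qed.

Lemma inl_linear M N : linear (fun u : M => (u, 0) : (M * N)%type).
Proof. by move=> c u v; apply/eqP; rewrite xpair_eqE /= scaler0 addr0 !eqxx. Qed.
Lemma inr_linear M N : linear (fun u : N => (0, u) : (M * N)%type).
Proof. by move=> c u v; apply/eqP; rewrite xpair_eqE /= scaler0 addr0 !eqxx. Qed.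

Definition inlm M N : 'Hom(M, dsum M N) := mklin (@inl_linear M N).
Definition inrm M N : 'Hom(N, dsum M N) := mklin (@inr_linear M N).

Lemma inlmE M N u : inlm M N u = (u, 0). Proof. exact: mklinE. Qed.
Lemma inrmE M N u : inrm M N u = (0, u). Proof. exact: mklinE. Qed.

Lemma inlm_hom M N : is_hom (inlm M N).
Proof. by apply/homE => a u; rewrite dsum_actE !inlmE /= linear0. Qed.
Lemma inrm_hom M N : is_hom (inrm M N).
Proof. by apply/homE => a u; rewrite dsum_actE !inrmE /= linear0. Qed.

Lemma dsum_dim M N : dim (dsum M N) = (dim M + dim N)%N.
Proof. by []. Qed.

(** ** Powers of the radical *)

Implicit Types U V : {vspace A}.

Notation J := (jacobson A).

Lemma Jmul_le M (U : submodule M) (W : {vspace M}) :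
  (forall x u, x \in J -> u \in (U : {vspace M}) -> act M x u \in W) ->
  (Jmul U <= W)%VS.
Proof.
move=> h; apply/subv_sumP => i _; apply/subvP => _ /memv_imgP[u Uu ->].
by apply: h => //; rewrite vbasis_mem ?mem_nth ?size_tuple.
Qed.

Lemma mem_Jmul M (U : submodule M) x u :
  x \in J -> u \in (U : {vspace M}) -> act M x u \in (Jmul U : {vspace M}).
Proof. exact: mem_J_space. Qed.

Lemma Jmul_sub M (U : submodule M) : (Jmul U <= U)%VS.
Proof. by apply: Jmul_le => x u _; apply: mem_submodule. Qed.

Lemma JmulS M (U V : submodule M) : (U <= V)%VS -> (Jmul U <= Jmul V)%VS.
Proof.
by move=> /subvP h; apply: Jmul_le => x u Jx Uu; apply: mem_Jmul => //; apply: h.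
Qed.

(** The radical of a submodule is defined by the action alone, so homomorphisms
    carry it to the radical of the image. *)
Lemma Jmul_img M N (f : 'Hom(M, N)) (U : submodule M) (V : submodule N) :
  is_hom f -> (f @: U)%VS = V -> (f @: Jmul U)%VS = Jmul V.
Proof.
move=> /homE hf e; apply/eqP; rewrite eqEsubv; apply/andP; split.
  apply/subvP => _ /memv_imgP[w Uw ->]; rewrite memv_preim; move: w Uw; apply/subvP.
  apply: Jmul_le => x u Jx Uu; rewrite -memv_preim hf mem_Jmul // -e memv_img //.
apply: Jmul_le => x v Jx; rewrite -e => /memv_imgP[u Uu ->].
by rewrite -hf memv_img // mem_Jmul.
Qed.

Lemma Jmul_add M (U V W : submodule M) :
  (U + V)%VS = W -> (Jmul U + Jmul V)%VS = Jmul W.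
Proof.
move=> e; apply/eqP; rewrite eqEsubv; apply/andP; split.
  by rewrite subv_add !JmulS // -e ?addvSl ?addvSr.
apply: Jmul_le => x w Jx; rewrite -e => /memv_addP[u Uu [v Vv ->]].
by rewrite linearD memv_add // mem_Jmul.
Qed.

Lemma JpowS M l (U : submodule M) : Jpow l.+1 U = Jmul (Jpow l U).
Proof. by []. Qed.

Lemma Jpow_img M N (f : 'Hom(M, N)) (U : submodule M) (V : submodule N) l :
  is_hom f -> (f @: U)%VS = V -> (f @: Jpow l U)%VS = Jpow l V.
Proof. by move=> hf e; elim: l => //= l IH; apply: Jmul_img. Qed.

Lemma Jpow_mono M (U V : submodule M) l : (U <= V)%VS -> (Jpow l U <= Jpow l V)%VS.
Proof. by move=> h; elim: l => //= l IH; apply: JmulS. Qed.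

Lemma Jpow_hom M N (f : 'Hom(M, N)) l v :
  is_hom f -> v \in (Jpow l (fullm M) : {vspace M}) ->
  f v \in (Jpow l (fullm N) : {vspace N}).
Proof.
move=> hf Jv; have := @Jpow_img _ _ f (fullm M) (imm hf (fullm M)) l hf erefl.
move=> e; have : f v \in (f @: Jpow l (fullm M))%VS by apply: memv_img.
by rewrite e; apply/subvP/Jpow_mono/subvf.
Qed.

Lemma Jpow_surj M N (f : 'Hom(M, N)) l :
  is_hom f -> limg f = fullv -> (f @: Jpow l (fullm M))%VS = Jpow l (fullm N).
Proof. by move=> hf ff; apply: Jpow_img. Qed.

Lemma Jpow_subl M (U : submodule M) l : (Jpow l.+1 U <= Jpow l U)%VS.
Proof. exact: Jmul_sub. Qed.

Lemma Jpow_le M (U : submodule M) l k : (l <= k)%N -> (Jpow k U <= Jpow l U)%VS.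
Proof.
move=> /subnK <-; elim: (k - l)%N => [|n IH]; first by rewrite add0n subvv.
by rewrite addSn; apply: subv_trans (Jpow_subl _ _) IH.
Qed.

Lemma Jpow_incl M (U : submodule M) l :
  (incl U @: Jpow l (fullm (subm U)))%VS = Jpow l U.
Proof. by apply: Jpow_img; [apply: incl_hom | rewrite limg_incl]. Qed.

Lemma Jpow_add M (U V W : submodule M) l :
  (U + V)%VS = W -> (Jpow l U + Jpow l V)%VS = Jpow l W.
Proof. by move=> e; elim: l => //= l IH; apply: Jmul_add. Qed.

Lemma Jpow_dsum M N l (u : dsum M N) :
  (u \in (Jpow l (fullm (dsum M N)) : {vspace _})) =
  (u.1 \in (Jpow l (fullm M) : {vspace M})) && (u.2 \in (Jpow l (fullm N) : {vspace N})).
Proof.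
have hl := inlm_hom M N; have hr := inrm_hom M N.
have e : (imm hl (fullm M) + imm hr (fullm N))%VS = fullm (dsum M N).
  apply/vspaceP => -[v w]; rewrite memvf.
  have -> : (v, w) = inlm M N v + inrm M N w.
    by rewrite inlmE inrmE; apply/eqP; rewrite xpair_eqE /= addr0 add0r !eqxx.
  by rewrite memv_add // memv_img // memvf.
rewrite -(Jpow_add l e).
rewrite -(@Jpow_img _ _ (inlm M N) (fullm M) (imm hl (fullm M)) l hl erefl).
rewrite -(@Jpow_img _ _ (inrm M N) (fullm N) (imm hr (fullm N)) l hr erefl).
apply/memv_addP/andP => [[_ /memv_imgP[v Jv ->] [_ /memv_imgP[w Jw ->] ->]]|].
  by rewrite inlmE inrmE /= addr0 add0r.
move=> [Jv Jw]; exists (inlm M N u.1); first exact: memv_img.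
exists (inrm M N u.2); first exact: memv_img.
by rewrite inlmE inrmE; case: u {Jv Jw} => v w; apply/eqP;
  rewrite xpair_eqE /= addr0 add0r !eqxx.
Qed.

End Modules.

(** * Algebras presented by a quiver *)

Section Presented.
Context (K : fieldType) (Q : quiver) (A : falgType K) (pres : presentation Q A).
Implicit Types (a b : A) (p q : qpath Q) (u v w : vertex Q).

Definition pimg p : A := pres << p >>.
Definition eps v : A := pimg (qpath0 v).

Lemma freegZU (c : K) p : << c *g p >> = c *: << p >> :> path_alg K Q.
Proof. by apply/eqP/freeg_eqP => q; rewrite coeffZ !coeffU mul1r. Qed.

Lemma presE (x : path_alg K Q) : pres x = \sum_(p <- dom x) coeff p x *: pimg p.
Proof.
rewrite -{1}[x]freeg_sumE linear_sum; apply: eq_bigr => p _.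
by rewrite freegZU linearZ.
Qed.

Lemma pimgM p q : pimg p * pimg q = if Defs.pcomp p q is Some r then pimg r else 0.
Proof.
rewrite /pimg -presM /pa_mul !domU1 !big_seq1 !coeffU !eqxx !mulr1.
by case: Defs.pcomp => [r|]; rewrite ?linear0.
Qed.

Lemma pcompP p q : pend q = pstart p -> exists r,
  [/\ Defs.pcomp p q = Some r, plength r = (plength p + plength q)%N &
      val r = (pstart q, parrows q ++ parrows p)].
Proof.
move=> /pcompE; case: Defs.pcomp => //= r [e]; exists r; split=> //.
by rewrite /plength /parrows -[\val r]/(sval r) e size_cat addnC.
Qed.

Lemma pcompN p q : pend q <> pstart p -> Defs.pcomp p q = None.
Proof. by rewrite /Defs.pcomp; case: eqP. Qed.

Lemma pcomp_size p q r :
  Defs.pcomp p q = Some r -> plength r = (plength p + plength q)%N.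
Proof.
have [e|/eqP ne] := eqVneq (pend q) (pstart p); last by rewrite pcompN.
by have [r' [-> <- _] [->]] := pcompP e.
Qed.

Lemma pcomp_idr p : Defs.pcomp p (qpath0 (pstart p)) = Some p.
Proof.
have [//|r [-> _ e]] := @pcompP p (qpath0 (pstart p)); congr Some.
by apply: val_inj; rewrite -[LHS]/(sval r) e /pstart /parrows; case: (val p).
Qed.

Lemma plength0 p : plength p = 0%N -> p = qpath0 (pstart p).
Proof.
case: p => -[i s] h; rewrite /plength /parrows /pstart /= => /size0nil e.
by apply: val_inj; rewrite /= e.
Qed.

Lemma epsM u v : eps u * eps v = if u == v then eps u else 0.
Proof.
rewrite pimgM; case: eqP => [->|ne]; first by rewrite -{1}[v]/(pstart (qpath0 v)) pcomp_idr.
by rewrite pcompN // => e; apply: ne; rewrite -[u]/(pstart (qpath0 u)) -e.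
Qed.

Lemma eps_sum : \sum_v eps v = 1.
Proof. by rewrite -(pres1 pres) /pa_one linear_sum. Qed.

Definition arrow_img k a := exists2 x, arrow_ideal_pow k x & pres x = a.

Lemma arrow_img_lin k c a b : arrow_img k a -> arrow_img k b ->
  arrow_img k (c *: a + b).
Proof.
move=> [x hx <-] [y hy <-]; exists (c *: x + y); last by rewrite linearP.
move=> p /domD_subset; rewrite mem_cat => /orP[/domZ_subset|]; [exact: hx|exact: hy].
Qed.

Lemma arrow_img0 k : arrow_img k 0.
Proof. by exists 0; rewrite ?linear0 // => p; rewrite dom0. Qed.

Lemma arrow_imgD k a b : arrow_img k a -> arrow_img k b -> arrow_img k (a + b).
Proof. by move=> ha hb; rewrite -[a]scale1r; apply: arrow_img_lin. Qed.

Lemma arrow_imgZ k c a : arrow_img k a -> arrow_img k (c *: a).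
Proof.
by move=> ha; rewrite -[_ *: _]addr0; apply: arrow_img_lin => //; apply: arrow_img0.
Qed.

Lemma arrow_imgN k a : arrow_img k a -> arrow_img k (- a).
Proof. by rewrite -scaleN1r; apply: arrow_imgZ. Qed.

Lemma arrow_img_sum k (I : eqType) (r : seq I) (F : I -> A) :
  {in r, forall i, arrow_img k (F i)} -> arrow_img k (\sum_(i <- r) F i).
Proof.
move=> h; rewrite big_seq; apply: big_ind => [||i ri]; first exact: arrow_img0.
  exact: arrow_imgD.
exact: h.
Qed.

Lemma arrow_img_pimg k p : (k <= plength p)%N -> arrow_img k (pimg p).
Proof.
by move=> h; exists << p >> => // q; rewrite domU1 inE => /eqP->.
Qed.

Lemma arrow_img_mul k l a b : arrow_img k a -> arrow_img l b ->
  arrow_img (k + l) (a * b).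
Proof.
move=> [x hx <-] [y hy <-]; rewrite !presE mulr_suml.
apply: arrow_img_sum => p px; rewrite mulr_sumr; apply: arrow_img_sum => q qy.
rewrite -scalerAl -scalerAr; do 2!apply: arrow_imgZ; rewrite pimgM.
case e: Defs.pcomp => [r|]; last exact: arrow_img0.
by apply: arrow_img_pimg; rewrite (pcomp_size e) leq_add ?hx ?hy.
Qed.

Lemma arrow_img_le k l a : (k <= l)%N -> arrow_img l a -> arrow_img k a.
Proof.
by move=> kl [x hx e]; exists x => // p /hx; apply: leq_trans.
Qed.

Lemma arrow_img_all a : arrow_img 0 a.
Proof. by have [x <-] := pres_surj pres a; exists x. Qed.

(** The kernel of an admissible presentation contains all long paths, so the arrow
    ideal becomes nilpotent in [A]. *)
Lemma arrow_img_nil : exists m, forall a k, (m <= k)%N -> arrow_img k a -> a = 0.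
Proof.
have [[m _ h] _] := pres_adm pres.
by exists m => a k mk /(arrow_img_le mk)[x hx <-]; apply: h.
Qed.

(** Trivial paths are the only paths outside the arrow ideal. *)
Lemma eps_decomp1 a : exists c : vertex Q -> K,
  arrow_img 1 (a - \sum_v c v *: eps v).
Proof.
have [x <-] := pres_surj pres a; rewrite presE.
elim: (dom x) => [|p s [c hc]].
  exists (fun=> 0); rewrite big_nil big1 ?subr0; first exact: arrow_img0.
  by move=> v _; rewrite scale0r.
have [p0|pn0] := eqVneq (plength p) 0%N.
  exists (fun v => c v + (if v == pstart p then coeff p x else 0)).
  rewrite big_cons; under [X in _ - X]eq_bigr do rewrite scalerDl.
  rewrite big_split /= [X in _ - (_ + X)](bigD1 (pstart p)) //= eqxx.
  rewrite [X in _ + (_ + X)]big1 => [|v /negPf->]; last by rewrite scale0r.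
  have ep : pimg p = eps (pstart p) by rewrite /eps -plength0.
  by rewrite addr0 ep addrC opprD addrA subrK addrC.
exists c; rewrite big_cons -addrA; apply: arrow_imgD => //.
by apply/arrow_imgZ/arrow_img_pimg; rewrite lt0n.
Qed.

(** The other half of admissibility: relations involve only paths of length at least
    two, so no combination of trivial paths falls into the arrow ideal. *)
Lemma eps_indep (c : vertex Q -> K) :
  arrow_img 1 (\sum_v c v *: eps v) -> forall v, c v = 0.
Proof.
move=> [x hx e] v; have [_ hadm] := pres_adm pres.
have := hadm (x - \sum_v c v *: << qpath0 v >>).
rewrite linearB linear_sum /= e.
under [X in _ - X]eq_bigr do rewrite linearZ /=.
rewrite subrr => /(_ erefl) h.
have n0 q : plength q = 0%N -> q \notin dom x.
  by move=> q0; apply/negP => /hx; rewrite q0.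
have /coeff_outdom : qpath0 v \notin dom (x - \sum_v c v *: << qpath0 v >>).
  by apply/negP => /h.
rewrite coeffB (coeff_outdom (n0 _ _)) // sub0r => /eqP; rewrite oppr_eq0.
rewrite raddf_sum /= (bigD1 v) //= coeffZ coeffU eqxx !mulr1 big1 ?addr0 => [/eqP//|u uv].
rewrite coeffZ coeffU (_ : (_ == _) = false) ?mulr0 //.
by apply/negbTE; apply: contra uv => /eqP/(congr1 (@pstart Q))/eqP.
Qed.

(** Modulo the arrow ideal, [A] is a product of copies of [K] indexed by the
    vertices. *)
Lemma mul_eps_decomp a b (c d : vertex Q -> K) :
  arrow_img 1 (a - \sum_v c v *: eps v) -> arrow_img 1 (b - \sum_v d v *: eps v) ->
  arrow_img 1 (a * b - \sum_v (c v * d v) *: eps v).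
Proof.
set ca := \sum_v c v *: eps v; set db := \sum_v d v *: eps v => ha hb.
have <- : ca * db = \sum_v (c v * d v) *: eps v.
  rewrite mulr_suml; apply: eq_bigr => v _; rewrite mulr_sumr (bigD1 v) //=.
  rewrite -scalerAl -scalerAr epsM eqxx scalerA big1 ?addr0 // => u uv.
  by rewrite -scalerAl -scalerAr epsM eq_sym (negbTE uv) !scaler0.
have -> : a * b - ca * db = (a - ca) * b + ca * (b - db).
  by rewrite mulrBl mulrBr addrA subrK.
apply: arrow_imgD.
  by rewrite -[1%N]/(1 + 0)%N; apply: arrow_img_mul (arrow_img_all _).
by rewrite -[1%N]/(0 + 1)%N; apply: arrow_img_mul (arrow_img_all _) _.
Qed.

Notation J := (jacobson A).

(** The kernel of the character of [A] at the vertex [u]. *)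
Definition max_at u : {vspace A} := subspace_of (fun a =>
  exists2 c : vertex Q -> K, c u = 0 & arrow_img 1 (a - \sum_v c v *: eps v)).

Lemma mem_max_at u a : a \in max_at u <->
  exists2 c : vertex Q -> K, c u = 0 & arrow_img 1 (a - \sum_v c v *: eps v).
Proof.
apply: subspace_ofP => [|k b d [c cu hc] [e eu he]].
  exists (fun=> 0) => //; rewrite big1 ?subr0 => [|v _]; last by rewrite scale0r.
  exact: arrow_img0.
exists (fun v => k * c v + e v); first by rewrite cu eu mulr0 addr0.
have -> : \sum_v (k * c v + e v) *: eps v =
    k *: (\sum_v c v *: eps v) + \sum_v e v *: eps v.
  rewrite scaler_sumr -big_split /=; apply: eq_bigr => v _.
  by rewrite scalerDl scalerA.
by rewrite opprD addrACA -scalerBr; apply: arrow_img_lin.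
Qed.

Lemma max_at_max u : maximal_left_ideal (max_at u).
Proof.
have lI : left_ideal (max_at u).
  move=> b a /mem_max_at[c cu hc]; have [d hd] := eps_decomp1 b.
  apply/mem_max_at; exists (fun v => d v * c v); first by rewrite cu mulr0.
  exact: mul_eps_decomp.
split=> // [e|L lL IL].
  have : (1 : A) \in max_at u by rewrite e memvf.
  move=> /mem_max_at[c cu]; rewrite -eps_sum -sumrB => hc.
  have := @eps_indep (fun v => 1 - c v) _ u; rewrite cu subr0.
  under eq_bigr do rewrite scalerBl scale1r.
  by move=> /(_ hc)/eqP; rewrite oner_eq0.
have [LI|/subvPn[a La /negP aI]] := boolP (L <= max_at u)%VS.
  by left; apply/eqP; rewrite eqEsubv LI.
right; have [c hc] := eps_decomp1 a.
have cu : c u != 0.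
  by apply/eqP => cu; apply: aI; apply/mem_max_at; exists c.
have dI b (d : vertex Q -> K) : arrow_img 1 (b - \sum_v d v *: eps v) ->
    b - d u *: eps u \in max_at u.
  move=> hd; apply/mem_max_at; exists (fun v => if v == u then 0 else d v).
    by rewrite eqxx.
  rewrite (bigD1 u) //= eqxx scale0r add0r.
  rewrite (eq_bigr (fun v => d v *: eps v)) => [|v /negPf->//].
  by rewrite -addrA -opprD; move: hd; rewrite (bigD1 u).
have Lu : eps u \in L.
  have : c u *: eps u \in L.
    rewrite -(subKr a (c u *: eps u)) memvB //; exact: (subvP IL) (dI _ _ hc).
  by move=> /(memvZ (c u)^-1); rewrite scalerA mulVf // scale1r.
apply/vspaceP => b; rewrite memvf; have [d hd] := eps_decomp1 b.
rewrite -(subrK (d u *: eps u) b) memvD ?memvZ //.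
exact: (subvP IL) (dI _ _ hd).
Qed.

(** A member of the radical lies in the kernel of each vertex character, so by
    [eps_decomp1] and [eps_indep] it has no component along a trivial path.
    Conversely the image of the arrow ideal is a nilpotent ideal; if a maximal left
    ideal did not contain it, then [1 - n] would lie in that ideal for some
    nilpotent [n], and so would [1 - n ^+ k] for all [k], hence [1]. *)
Lemma jacobsonE a : a \in J <-> arrow_img 1 a.
Proof.
split=> [/mem_jacobson h|ha].
  have [c hc] := eps_decomp1 a.
  suff c0 v : c v = 0.
    move: hc; rewrite big1 ?subr0 // => v _; by rewrite c0 scale0r.
  have /mem_max_at[d dv hd] := h _ (max_at_max v).
  have := @eps_indep (fun v => d v - c v) _ v.
  rewrite dv sub0r => e; apply/eqP; rewrite -oppr_eq0; apply/eqP/e.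
  under eq_bigr do rewrite scalerBl.
  rewrite sumrB (_ : _ - _ = (a - \sum_v c v *: eps v) - (a - \sum_v d v *: eps v)).
    by apply/arrow_imgD/arrow_imgN.
  by rewrite opprB [RHS]addrC addrA subrK.
apply/mem_jacobson => I [lI nI mI].
pose N : {vspace A} := subspace_of (arrow_img 1).
have memN x : x \in N <-> arrow_img 1 x.
  by apply: subspace_ofP; [exact: arrow_img0 | exact: arrow_img_lin].
have lN : left_ideal (I + N)%VS.
  move=> b x /memv_addP[i Ii [n /memN Nn ->]]; rewrite mulrDr memv_add ?lI //.
  by apply/memN; rewrite -[1%N]/(0 + 1)%N; apply: arrow_img_mul (arrow_img_all _) _.
have [e|e] := mI _ lN (addvSl _ _).
  by rewrite -e; apply: (subvP (addvSr _ _)); apply/memN.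
have : (1 : A) \in (I + N)%VS by rewrite e memvf.
move=> /memv_addP[i Ii [n /memN Nn e1]]; case: nI.
have In k : 1 - n ^+ k \in I.
  elim: k => [|k IH]; first by rewrite expr0 subrr mem0v.
  have -> : 1 - n ^+ k.+1 = (1 - n) + n * (1 - n ^+ k).
    by rewrite mulrBr mulr1 -exprS addrA subrK.
  by rewrite memvD ?lI // e1 addrK.
have nk k : arrow_img k (n ^+ k).
  elim: k => [|k IH]; first exact: arrow_img_all.
  by rewrite exprS -[k.+1]/(1 + k)%N; apply: arrow_img_mul.
have [m hm] := arrow_img_nil; have := In m; rewrite (hm _ _ (leqnn m) (nk m)) subr0.
by move=> I1; apply/vspaceP => b; rewrite memvf -[b]mulr1 lI.
Qed.

Lemma eps_decomp a : exists c : vertex Q -> K, a - \sum_v c v *: eps v \in J.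
Proof. by have [c /jacobsonE] := eps_decomp1 a; exists c. Qed.

(** * Modules over an algebra presented by a quiver *)

Implicit Types M N X Y : fdmod A.

Notation "''J_' M" := (Jmul (fullm M)) (at level 8, M at level 2, format "''J_' M").

(** The bound does not depend on the module: it is the length from which on all
    paths vanish in [A]. *)
Lemma Jpow_nil : exists m, forall M k, (m <= k)%N -> Jpow k (fullm M) = 0%VS :> {vspace M}.
Proof.
have [m hm] := arrow_img_nil; exists m => M k mk.
suff main l x (u : M) : (m <= k + l)%N -> arrow_img l x ->
    u \in (Jpow k (fullm M) : {vspace M}) -> act M x u = 0.
  apply/eqP; rewrite -subv0; apply/subvP => u Ju; rewrite memv0 -[u]act1E.
  by apply/eqP/(main 0%N) => //; rewrite ?addn0 //; apply: arrow_img_all.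
elim: k l x u {mk} => [|k IH] l x u ml hx.
  by rewrite (hm _ _ ml hx) act0E.
move=> Ju; apply/eqP; rewrite -memv_ker; move: u Ju; apply/subvP/Jmul_le => y w.
move=> /jacobsonE hy Jw; rewrite memv_ker -actME; apply/eqP; apply: (IH l.+1) => //.
  by rewrite addnS -addSn.
by rewrite -addn1; apply: arrow_img_mul.
Qed.

(** Applying the radical to [U + J M = M] gives [U + J ^ k M = M] for all [k], and
    the powers of the radical reach zero. *)
Lemma nakayama M (U : submodule M) : (U + 'J_M)%VS = fullv -> U = fullv :> {vspace M}.
Proof.
move=> h; have [m hm] := Jpow_nil.
suff hk k : (U + Jpow k (fullm M))%VS = fullv.
  by have := hk m; rewrite hm // addv0.
elim: k => [|k IH] /=; first by rewrite addvf.
have e := @Jmul_add _ _ M U (Jpow k (fullm M)) (fullm M) IH.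
by rewrite -h -e addvA (addv_idPl (Jmul_sub U)).
Qed.

Lemma nakayama_surj M N (f : 'Hom(N, M)) : is_hom f ->
  (forall m, exists n, m - f n \in ('J_M : {vspace M})) -> limg f = fullv.
Proof.
move=> hf h; apply: (@nakayama M (imm hf (fullm N))).
apply/vspaceP => m; rewrite memvf; have [n Jn] := h m.
by rewrite -(subrK (f n) m) addrC memv_add // memv_img ?memvf.
Qed.

Lemma nonzero_J M : nonzero M -> 'J_M <> fullv :> {vspace M}.
Proof.
move=> nz h; apply: nz; rewrite -[RHS]/(zerom M : {vspace M}) (@nakayama M (zerom M)) //.
by rewrite h addvf.
Qed.

Lemma epsK M u v (x : M) : act M (eps u) (act M (eps v) x) =
  if u == v then act M (eps u) x else 0.
Proof. by rewrite -actME epsM; case: eqP => // _; rewrite act0E. Qed.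

Lemma eps_act_sum M (x : M) : x = \sum_v act M (eps v) x.
Proof. by rewrite -act_sumE eps_sum act1E. Qed.

Lemma eps_fix0 M u v (x : M) : act M (eps u) x = x -> u != v -> act M (eps v) x = 0.
Proof. by move=> <- uv; rewrite epsK eq_sym (negbTE uv). Qed.

(** Modulo the radical, [b] acts on vectors at the vertex [u] by a scalar. The
    scalar is the value of a character of [A], so one scalar serves all modules at
    once; this is what makes it possible to transport coefficients between modules. *)
Lemma eps_act_J b u : exists c, forall X (U : submodule X) (x : X),
  act X (eps u) x = x -> x \in (U : {vspace X}) ->
  act X b x - c *: x \in (Jmul U : {vspace X}).
Proof.
have [c hc] := eps_decomp b; exists (c u) => X U x xu Ux.
have := mem_Jmul hc Ux; rewrite -[b - _]addrC actDE -scaleN1r actZE act_sumE.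
rewrite (bigD1 u) //= actZE xu big1 => [|v vu]; last first.
  by rewrite actZE (eps_fix0 xu) ?scaler0 // eq_sym.
by rewrite addr0 scaleN1r addrC.
Qed.

(** The entry at [v] of the dimension vector; it counts the composition factors that
    are isomorphic to the simple module at [v]. *)
Definition dimv_at v M (W : {vspace M}) := \dim (act M (eps v) @: W).

Lemma dimv_at_sum M (W : submodule M) : \dim W = (\sum_v dimv_at v W)%N.
Proof.
rewrite /dimv_at.
have dir : directv (\sum_v (act M (eps v) @: W)).
  apply/directv_sum_independent => x hx e v _.
  have xv w : act M (eps w) (x w) = x w.
    by have /memv_imgP[y _ ->] := hx w isT; rewrite epsK eqxx.
  have := congr1 (act M (eps v)) e; rewrite linear0 linear_sum (bigD1 v) //=.
  by rewrite big1 ?addr0 ?xv // => w wv; apply: (eps_fix0 (xv w)).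
rewrite -(directvP dir) /=; congr (\dim _).
apply/eqP; rewrite eqEsubv; apply/andP; split; last first.
  by apply/subv_sumP => v _; apply: submodule_stable.
apply/subvP => x Wx; rewrite [x]eps_act_sum; apply: memv_sumr => v _.
exact: memv_img.
Qed.

Lemma dimv_at_hom M N (f : 'Hom(M, N)) (W : submodule M) v : is_hom f ->
  (dimv_at v (W :&: lker f) + dimv_at v (f @: W) = dimv_at v W)%N.
Proof.
move=> /homE hf; rewrite /dimv_at -[RHS](limg_ker_dim f).
congr (_ + _)%N; congr (\dim _).
  apply/vspaceP => x; rewrite memv_cap; apply/memv_imgP/andP.
    move=> [y]; rewrite memv_cap memv_ker => /andP[Wy /eqP fy] ->.
    by rewrite memv_img // memv_ker hf fy linear0.
  move=> [/memv_imgP[y Wy ->]]; rewrite memv_ker => fy.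
  exists (act M (eps v) y); last by rewrite epsK eqxx.
  by rewrite memv_cap mem_submodule // memv_ker.
by apply/vspaceP => x; apply/memv_imgP/memv_imgP => -[_ /memv_imgP[y Wy ->] ->];
   [exists (act M (eps v) y) | exists (f y)]; rewrite ?hf ?memv_img.
Qed.

Lemma dimv_at_inj M N (f : 'Hom(M, N)) (W : submodule M) v : is_hom f ->
  lker f = 0%VS -> dimv_at v (f @: W) = dimv_at v W.
Proof.
move=> hf f0; rewrite -(dimv_at_hom W v hf) f0 capv0 /dimv_at limg0 dimv0.
by rewrite add0n.
Qed.

Lemma dimv_at_quot M (U W : submodule M) v :
  (dimv_at v (W :&: U)%VS + dimv_at v (quotm_map U @: W : {vspace quotm U})%VS = dimv_at v W)%N.
Proof. by rewrite -(dimv_at_hom W v (quotm_map_hom U)) lker_quotm_map. Qed.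

Lemma dimv_at_miso M N v : miso M N ->
  dimv_at v (fullv : {vspace M}) = dimv_at v (fullv : {vspace N}).
Proof.
move=> [f [hf f0 ff]]; rewrite -ff; symmetry.
exact: (@dimv_at_inj _ _ _ (fullm M)).
Qed.

Lemma dimv_at_top M v :
  (dimv_at v 'J_M + dimv_at v (fullv : {vspace top M}) =
   dimv_at v (fullv : {vspace M}))%N.
Proof.
have := dimv_at_quot ('J_M) (fullm M) v.
by rewrite -[submodule_space (fullm M)]/fullv capfv limg_quotm_map.
Qed.

Lemma dimv_at_layer M l v :
  (dimv_at v (Jpow l.+1 (fullm M)) + dimv_at v (fullv : {vspace layer l M}) =
   dimv_at v (Jpow l (fullm M)))%N.
Proof.
set U := Jpow l (fullm M).
have e := dimv_at_top (subm U) v; have i0 : lker (incl U) = 0%VS.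
  by apply/lker0_inj; apply: incl_inj.
rewrite -(@dimv_at_inj _ _ _ ('J_(subm U)) v (incl_hom U) i0) in e.
rewrite (Jpow_incl U 1) in e.
rewrite -(@dimv_at_inj _ _ _ (fullm (subm U)) v (incl_hom U) i0) /= in e.
by rewrite limg_incl in e.
Qed.

(** Semisimplicity, expressed through the radical. *)
Definition ssimple X := forall a (x : X), a \in J -> act X a x = 0.

Lemma top_ssimple M : ssimple (top M).
Proof.
move=> a w Ja; have [u <-] := quotm_surj w; rewrite -quotm_hom.
by apply/quotm_ker/mem_Jmul; rewrite ?memvf.
Qed.

(** An isomorphism between equidimensional subspaces, extended by zero to a map on
    the ambient space so that no subspace types are needed. *)
Lemma vspace_iso (V W : vectType K) (X : {vspace V}) (Y : {vspace W}) :
  \dim X = \dim Y -> exists g : 'Hom(V, W),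
    (forall x : V, g x \in Y) /\ {in X, forall x, g x = 0 -> x = 0}.
Proof.
move=> e; pose b i := (vbasis Y)`_i.
have fl : linear (fun x => \sum_(i < \dim X) coord (vbasis X) i x *: b i).
  move=> c x y; rewrite scaler_sumr -big_split /=; apply: eq_bigr => i _.
  by rewrite linearP scalerDl scalerA.
exists (mklin fl); split=> x.
  rewrite mklinE memv_suml // => i _; rewrite memvZ // vbasis_mem ?mem_nth //.
  by rewrite size_tuple -e.
rewrite mklinE => Xx h.
have : forall i : 'I_(\dim Y), coord (vbasis X) (cast_ord (esym e) i) x = 0.
  move/freeP: (basis_free (vbasisP Y)) => fr.
  apply: (fr (fun i => coord (vbasis X) (cast_ord (esym e) i) x)); rewrite -[RHS]h.
  rewrite (reindex (cast_ord e)) /=; last first.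
    by exists (cast_ord (esym e)) => i _; rewrite ?cast_ordK ?cast_ordKV.
  by apply: eq_bigr => i _; rewrite cast_ordK.
move=> c0; rewrite (coord_vbasis Xx) big1 // => i _.
by have := c0 (cast_ord e i); rewrite cast_ordK => ->; rewrite scale0r.
Qed.

(** Such a module is the direct sum of its parts at the vertices, and [A] acts on
    each part by scalars, so arbitrary linear isomorphisms of the parts are
    homomorphisms. *)
Lemma ssimple_miso X Y : ssimple X -> ssimple Y ->
  (forall v, dimv_at v (fullv : {vspace X}) = dimv_at v (fullv : {vspace Y})) ->
  miso X Y.
Proof.
move=> sX sY e.
have /choice[g gP] v := vspace_iso (e v).
have gv v x : act Y (eps v) (g v x) = g v x.
  by have [/(_ x)/memv_imgP[y _ ->] _] := gP v; rewrite epsK eqxx.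
pose f := \sum_v (g v \o act X (eps v))%VF.
have fE x : f x = \sum_v g v (act X (eps v) x).
  by rewrite sum_lfunE; apply: eq_bigr => v _; rewrite comp_lfunE.
have fv v x : act Y (eps v) (f x) = f (act X (eps v) x).
  rewrite !fE linear_sum; apply: eq_bigr => u _ /=.
  rewrite -[in LHS]gv !epsK; have [->|uv] := eqVneq u v; first exact: gv.
  by rewrite linear0.
apply: (@miso_inj _ _ _ _ f).
- apply/homE => a x; have [c hc] := eps_decomp a.
  rewrite -[a](subrK (\sum_v c v *: eps v)); move: (a - _) hc => j hc.
  rewrite !actDE sX // sY // !add0r.
  rewrite !act_sumE linear_sum; apply: eq_bigr => v _.
  by rewrite !actZE linearZ fv.
- apply/eqP; rewrite -subv0; apply/subvP => x; rewrite memv_ker memv0 => /eqP fx.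
  rewrite [x]eps_act_sum big1 // => v _.
  have [_] := gP v; apply; first by rewrite memv_img ?memvf.
  have := fv v x; rewrite fx linear0 fE (bigD1 v) //= epsK eqxx big1 ?addr0 //.
  by move=> u uv; rewrite epsK (negbTE uv) linear0.
rewrite -!dimvf (dimv_at_sum (fullm X)) (dimv_at_sum (fullm Y)).
exact: eq_bigr.
Qed.

Lemma top_miso M N :
  (forall v, dimv_at v (fullv : {vspace M}) = dimv_at v (fullv : {vspace N})) ->
  (forall v, dimv_at v 'J_M = dimv_at v 'J_N) -> miso (top M) (top N).
Proof.
move=> e1 e2; apply: ssimple_miso => [||v]; try exact: top_ssimple.
by apply: (@addnI (dimv_at v 'J_M)); rewrite dimv_at_top e1 e2 dimv_at_top.
Qed.

Lemma layers_miso M N :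
  (forall l v, dimv_at v (Jpow l (fullm M)) = dimv_at v (Jpow l (fullm N))) ->
  forall l, miso (layer l M) (layer l N).
Proof.
move=> e l; apply: ssimple_miso => [||v]; try exact: top_ssimple.
by apply: (@addnI (dimv_at v (Jpow l.+1 (fullm M)))); rewrite dimv_at_layer !e dimv_at_layer.
Qed.

(** Downward induction from a power of the radical that vanishes on both modules:
    the dimension vector of [J ^ l] is that of [J ^ l.+1] plus that of the layer. *)
Lemma miso_layers M N : (forall l, miso (layer l M) (layer l N)) ->
  forall l v, dimv_at v (Jpow l (fullm M)) = dimv_at v (Jpow l (fullm N)).
Proof.
move=> h; have [m hm] := Jpow_nil.
suff main k l : (m <= l + k)%N -> forall v,
    dimv_at v (Jpow l (fullm M)) = dimv_at v (Jpow l (fullm N)).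
  by move=> l; apply: (main m); rewrite leq_addl.
elim: k l => [|k IH] l ml v.
  by rewrite !hm -1?[l]addn0 // /dimv_at !limg0 !dimv0.
rewrite -(dimv_at_layer M) -(dimv_at_layer N) (dimv_at_miso v (h l)) IH //.
by rewrite addSn -addnS.
Qed.

Lemma miso_layers_dim M N : (forall l, miso (layer l M) (layer l N)) ->
  forall l, \dim (Jpow l (fullm M)) = \dim (Jpow l (fullm N)).
Proof.
move=> h l; rewrite !dimv_at_sum; apply: eq_bigr => v _.
exact: miso_layers.
Qed.

(** ** Squarefree tops *)

(** Lifts to [M] of a basis of the top, homogeneous at distinct vertices. They serve
    as coordinates: by Nakayama's lemma they generate [M], so a homomorphism out of
    [M] is determined by their images, which may be any vectors at the same vertices
    subject to the relations of [M]. *)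
Record frame t M (vx : 'I_t -> vertex Q) (z : 'I_t -> M) : Prop := Frame {
  frame_inj : injective vx;
  frame_eps : forall i, act M (eps (vx i)) (z i) = z i;
  frame_span : forall m, exists c : 'I_t -> K, m - \sum_i c i *: z i \in ('J_M : {vspace M});
  frame_free : forall c : 'I_t -> K, \sum_i c i *: z i \in ('J_M : {vspace M}) ->
    forall i, c i = 0 }.

Lemma ssimple_line X v x : ssimple X -> act X (eps v) x = x ->
  forall a y, y \in <[x]>%VS -> act X a y \in <[x]>%VS.
Proof.
move=> sX ex a y /vlineP[k ->]; rewrite linearZ memvZ //=.
have [c hc] := eps_decomp a; rewrite -[a](subrK (\sum_v c v *: eps v)).
move: (a - _) hc => j hc; rewrite actDE sX // add0r act_sumE (bigD1 v) //= actZE ex.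
rewrite big1 ?addr0 ?memvZ ?memv_line // => u uv.
by rewrite actZE (eps_fix0 ex) ?scaler0 // eq_sym.
Qed.

(** Some [eps v] acts nontrivially, and the line through a vector at [v] is stable
    because the radical kills it. *)
Lemma simple_line X : simple X -> ssimple X /\ exists v x,
  [/\ x != 0, act X (eps v) x = x & fullv = <[x]>%VS :> {vspace X}].
Proof.
move=> [nz hX]; have [J0|/(nonzero_J nz)//] := hX ('J_X).
have sX : ssimple X.
  by move=> a x Ja; apply/eqP; rewrite -memv0 -J0 mem_Jmul ?memvf.
split=> //.
have [x0 x0n] : exists x0 : X, x0 != 0.
  exists (vpick fullv); rewrite vpick0; apply/eqP => e; exact: nz.
have [v xv] : exists v, act X (eps v) x0 != 0.
  apply/existsP; apply: contraNT x0n; rewrite negb_exists => /forallP h.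
  by rewrite [x0]eps_act_sum big1 // => v _; apply/eqP; have := h v; rewrite negbK.
set x := act X (eps v) x0 in xv; have ex : act X (eps v) x = x by rewrite epsK eqxx.
exists v, x; split=> //.
have st := ssimple_line sX ex.
have [/= e|/= <-//] := hX (submod_of st).
by have := memv_line x; rewrite e memv0 (negbTE xv).
Qed.

Lemma dimv_at_line X v x u : act X (eps v) x = x -> x != 0 ->
  dimv_at u <[x]>%VS = (u == v).
Proof.
move=> ex x0; rewrite /dimv_at limg_line dim_vline; have [->|uv] := eqVneq u v.
  by rewrite ex x0.
by rewrite (eps_fix0 ex) ?eqxx // eq_sym.
Qed.

(** Simple summands of the top are lines at vertices; two of them at the same vertex
    would have equal dimension vectors and be isomorphic. *)
Lemma squarefree_frame t M : squarefree_top t M ->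
  exists vx z, @frame t M vx z.
Proof.
move=> [S [[Ss Sd] simS noS]].
have /choice[w wP] i : exists v, exists x : top M,
    [/\ x != 0, act (top M) (eps v) x = x & S i = <[x]>%VS :> {vspace _}].
  have [_ [v [x [x0 ex fx]]]] := simple_line (simS i).
  exists v, (incl (S i) x); split.
  - by apply: contra x0 => /eqP e; apply/eqP/(@incl_inj _ _ _ (S i)); rewrite e linear0.
  - by have /homE<- := incl_hom (S i); rewrite ex.
  by rewrite -limg_line -fx limg_incl.
have /choice[x xP] := wP.
have /choice[z0 z0P] i := quotm_surj (x i).
exists w, (fun i => act M (eps (w i)) (z0 i)).
have zq i : quotm_map ('J_M) (act M (eps (w i)) (z0 i)) = (x i).
  by rewrite quotm_hom z0P; have [_ ->] := xP i.
have qsum (c : 'I_t -> K) : quotm_map ('J_M) (\sum_i c i *: act M (eps (w i)) (z0 i)) =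
    \sum_i c i *: (x i).
  by rewrite linear_sum; apply: eq_bigr => i _; rewrite linearZ /= zq.
split.
- move=> i j e; apply: contrapT => /eqP /noS; apply.
  have dimS k u : dimv_at u (fullv : {vspace subm (S k)}) = (u == w k).
    rewrite -(@dimv_at_inj _ _ (incl (S k)) (fullm _) u (incl_hom _)); last first.
      by apply/lker0_inj; apply: incl_inj.
    rewrite -[submodule_space (fullm _)]/fullv limg_incl.
    by have [x0 ex ->] := xP k; apply: dimv_at_line.
  apply: ssimple_miso => [||u]; try by have [] := simple_line (simS i).
    by have [] := simple_line (simS j).
  by rewrite !dimS e.
- by move=> i; rewrite epsK eqxx.
- move=> m; have : quotm_map ('J_M) m \in (\sum_(i < t) submodule_space (S i))%VS.
    by rewrite Ss memvf.
  move=> /memv_sumP[s hs e].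
  have /choice[c hc] i : exists c, s i = c *: (x i).
    by have := hs i isT; have [_ _ ->] := xP i => /vlineP.
  exists c; apply/quotm_ker; rewrite linearB /= qsum e.
  by apply/eqP; rewrite subr_eq0; apply/eqP/eq_bigr => i _; rewrite hc.
move=> c /quotm_ker; rewrite qsum => e i.
have /directv_sum_independent di := Sd.
have ci : c i *: x i = 0.
  apply: (di (fun j => c j *: x j)) => // j _.
  by have [_ _ ->] := xP j; rewrite memvZ ?memv_line.
move/eqP: ci; rewrite scaler_eq0; have [/negPf-> _ _] := xP i.
by rewrite orbF => /eqP.
Qed.

Section Frame.
Context (t : nat) (M : fdmod A) (vx : 'I_t -> vertex Q) (z : 'I_t -> M).
Context (fr : frame vx z).

Lemma frame_eps0 i j : i != j -> act M (eps (vx i)) (z j) = 0.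
Proof.
move=> ij; apply: (eps_fix0 (frame_eps fr j)).
by apply: contra ij => /eqP/(frame_inj fr)->.
Qed.

(** No other generator lives at the vertex [vx i]. *)
Lemma frame_at i x : act M (eps (vx i)) x = x ->
  exists c, x - c *: z i \in ('J_M : {vspace M}).
Proof.
move=> xi; have [c hc] := frame_span fr x; exists (c i).
have := mem_submodule (eps (vx i)) hc; rewrite linearB /= xi linear_sum (bigD1 i) //=.
rewrite linearZ /= (frame_eps fr) big1 ?addr0 // => j ji.
by rewrite linearZ /= frame_eps0 ?scaler0 // eq_sym.
Qed.

Lemma frame_notJ i : z i \notin ('J_M : {vspace M}).
Proof.
apply/negP => Jz.
have := @frame_free _ _ _ _ fr (fun j => (j == i)%:R) _ i; rewrite eqxx.
rewrite (bigD1 i) //= eqxx scale1r big1 ?addr0 => [/(_ Jz)/eqP|j /negPf->].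
  by rewrite oner_eq0.
by rewrite scale0r.
Qed.

Lemma frame_gen (U : submodule M) : (forall i, z i \in (U : {vspace M})) ->
  U = fullv :> {vspace M}.
Proof.
move=> h; apply: nakayama; apply/vspaceP => m; rewrite memvf.
have [c hc] := frame_span fr m.
rewrite -(subrK (\sum_i c i *: z i) m) addrC memv_add //.
by apply: memv_suml => i _; rewrite memvZ.
Qed.

Lemma frame_span_act m : exists a : 'I_t -> A, m = \sum_i act M (a i) (z i).
Proof.
pose P m := exists a : 'I_t -> A, m = \sum_i act M (a i) (z i).
have PU x : x \in subspace_of P <-> P x.
  apply: subspace_ofP => [|c y w [a ->] [b ->]].
    by exists (fun=> 0); rewrite big1 // => i _; rewrite act0E.
  exists (fun i => c *: a i + b i); rewrite scaler_sumr -big_split /=.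
  by apply: eq_bigr => i _; rewrite actDE actZE.
have st b x : x \in subspace_of P -> act M b x \in subspace_of P.
  move=> /PU[a ->]; apply/PU; exists (fun i => b * a i).
  by rewrite linear_sum; apply: eq_bigr => i _; rewrite actME.
apply/PU; rewrite (_ : subspace_of P = fullv) ?memvf //.
apply: (@frame_gen (submod_of st)) => i; apply/PU.
exists (fun j => (j == i)%:R); rewrite (bigD1 i) //= eqxx act1E big1 ?addr0 //.
by move=> j /negPf->; rewrite act0E.
Qed.

Lemma frame_hom_eq X (f g : 'Hom(M, X)) : is_hom f -> is_hom g ->
  (forall i, f (z i) = g (z i)) -> f = g.
Proof.
move=> /homE hf /homE hg e; apply/lfunP => m; have [a ->] := frame_span_act m.
by rewrite !linear_sum /=; apply: eq_bigr => i _; rewrite hf hg e.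
Qed.

Lemma frame_iso N : miso (top M) (top N) -> exists z' : 'I_t -> N, frame vx z'.
Proof.
move=> [f [/homE hf /lker0_inj f0 /limg_fullP ff]].
have /choice[y yP] i := quotm_surj (f (quotm_map ('J_M) (z i))).
exists (fun i => act N (eps (vx i)) (y i)).
have q i : quotm_map ('J_N) (act N (eps (vx i)) (y i)) = f (quotm_map ('J_M) (z i)).
  by rewrite quotm_hom yP -hf -quotm_hom (frame_eps fr).
have qs (c : 'I_t -> K) : quotm_map ('J_N) (\sum_i c i *: act N (eps (vx i)) (y i)) =
    f (quotm_map ('J_M) (\sum_i c i *: z i)).
  by rewrite !linear_sum /=; apply: eq_bigr => i _; rewrite !linearZ /= q.
split; [exact: frame_inj fr | by move=> i; rewrite epsK eqxx | |].
  move=> n; have [w hw] := ff (quotm_map ('J_N) n); have [m hm] := quotm_surj w.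
  have [c hc] := frame_span fr m; exists c; apply/quotm_ker.
  rewrite linearB /= qs -hw -hm; move/quotm_ker: hc; rewrite linearB /= => /eqP.
  by rewrite subr_eq0 => /eqP->; rewrite subrr.
move=> c /quotm_ker; rewrite qs => e; apply: (frame_free fr); apply/quotm_ker.
by apply: f0; rewrite e linear0.
Qed.

End Frame.

End Presented.

(** * Direct sum decompositions *)

Section Decompositions.
Context (K : fieldType) (A : falgType K).
Implicit Types M N X Y : fdmod A.

Lemma dsum_proj M n (U : 'I_n -> submodule M) : internal_dsum U ->
  exists e : 'I_n -> 'Hom(M, M),
  [/\ forall i, is_hom (e i), forall i m, e i m \in (U i : {vspace M}),
      forall m, m = \sum_i e i m &
      forall i j m, m \in (U j : {vspace M}) -> e i m = if i == j then m else 0].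
Proof.
move=> [Us Ud].
pose e i := sumv_pi_for (esym Us) i.
have eU i m : e i m \in (U i : {vspace M}) by apply: memv_sum_pi.
have es m : m = \sum_i e i m by rewrite sumv_pi_sum ?memvf.
have uniq (x y : 'I_n -> M) : (forall i, x i \in (U i : {vspace M})) ->
    (forall i, y i \in (U i : {vspace M})) -> \sum_i x i = \sum_i y i -> x =1 y.
  move=> hx hy xy i; apply/eqP; rewrite -subr_eq0; apply/eqP.
  have /directv_sum_independent di := Ud; apply: (di (fun i => x i - y i)) => //.
    by move=> j _; rewrite memvB.
  by rewrite sumrB xy subrr.
exists e; split=> // [i|i j m Um].
  apply/homE => a m; apply: (uniq (fun i => e i (act M a m)) (fun i => act M a (e i m))).
  - by [].
  - by move=> j; apply: mem_submodule.
  by rewrite -es -linear_sum -es.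
apply: (uniq (fun i => e i m) (fun i => if i == j then m else 0)) => //.
  by move=> k; case: eqP => [->|_] //; rewrite mem0v.
by rewrite -es (bigD1 j) //= eqxx big1 ?addr0 // => k /negPf->.
Qed.

(** The radical commutes with direct sums. *)
Lemma dsum_top_dim M n (U : 'I_n -> submodule M) : internal_dsum U ->
  dim (top M) = (\sum_i dim (top (subm (U i))))%N.
Proof.
move=> hU; have [e [eh eU es eU0]] := dsum_proj hU; have [Us Ud] := hU.
have Js : (\sum_i submodule_space (Jmul (U i)))%VS = Jmul (fullm M).
  apply/eqP; rewrite eqEsubv; apply/andP; split.
    by apply/subv_sumP => i _; apply/JmulS/subvf.
  apply: Jmul_le => x m Jx _; rewrite {1}(es m) linear_sum /=.
  by apply: memv_sumr => i _; rewrite mem_Jmul.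
have dimJ (W : 'I_n -> {vspace M}) : (forall i, (W i <= U i)%VS) ->
    \dim (\sum_i W i) = (\sum_i \dim (W i))%N.
  move=> WU; suff Wd : directv (\sum_i W i) by apply/(directvP Wd).
  apply/directv_sum_independent => u hu; have /directv_sum_independent di := Ud.
  by apply: di => i _; apply: (subvP (WU i)); apply: hu.
have d1 := dim_quotm (Jmul (fullm M)).
have d2 i : (dim (top (subm (U i))) + \dim (Jmul (U i)))%N = \dim (U i).
  rewrite -(dim_subm (U i)) -(dim_quotm (Jmul (fullm (subm (U i))))).
  congr (_ + _)%N; rewrite -(Jpow_incl (U i) 1) limg_dim_eq //.
  by have /lker0_inj -> := @incl_inj _ _ _ (U i); rewrite capv0.
apply: (@addIn (\dim (Jmul (fullm M)))); rewrite d1.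
rewrite -Js dimJ => [|i]; last exact: Jmul_sub.
rewrite -big_split /= -dimvf -Us (directvP Ud) /=.
by apply: eq_bigr => i _; rewrite d2.
Qed.

Lemma simple_dim1 X : dim X = 1%N -> simple X.
Proof.
move=> d; split=> [e|U].
  by have := dimvf X; rewrite d e dimv0.
have := dimvS (subvf (submodule_space U)); rewrite dimvf d.
case e: (\dim U) => [|[|//]] _.
  by left; apply/eqP; rewrite -dimv_eq0 e.
by right; apply/eqP; rewrite eqEdim subvf dimvf d e.
Qed.

(** ** Endomorphisms of indecomposable modules *)

Definition lfun_pow (V : vectType K) (g : 'End(V)) k : 'End(V) :=
  iter k (comp_lfun g) \1%VF.

Lemma lfun_powE (V : vectType K) (g : 'End(V)) k x : lfun_pow g k x = iter k g x.
Proof. by elim: k => [|k IH] /=; rewrite ?id_lfunE // comp_lfunE IH. Qed.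

Lemma lfun_pow_hom X (g : 'Hom(X, X)) k : is_hom g -> is_hom (lfun_pow g k : 'Hom(X, X)).
Proof. by move=> hg; elim: k => [|k IH]; [apply: is_hom_id | apply: is_hom_comp]. Qed.

Definition homker M N (f : 'Hom(M, N)) (hf : is_hom f) : submodule M.
Proof.
apply: (@submod_of _ _ M (lker f)) => a u; rewrite !memv_ker => /eqP e.
by move/homE: hf => ->; rewrite e linear0.
Defined.

(** For a power [g ^ k] of minimal rank, [X] is the direct sum of the kernel and the
    image of [g ^ k] (Fitting's lemma). *)
Lemma fitting X (g : 'Hom(X, X)) : is_hom g -> indecomposable X ->
  (exists k, forall x, iter k g x = 0) \/ limg g = fullv.
Proof.
move=> hg [_ hX].
pose r k := \dim (limg (lfun_pow g k)).
have [k [hk mink]] : exists k, (0 < k)%N /\ forall l, (0 < l)%N -> (r k <= r l)%N.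
  pose R := [pred m | `[< exists k, (0 < k)%N /\ r k = m >]].
  have ex : exists m, R m by exists (r 1%N); apply/asboolP; exists 1%N.
  case: (ex_minnP ex) => m /asboolP[k [k0 <-]] mn; exists k; split=> // l l0.
  by apply: mn; apply/asboolP; exists l.
have hgk := lfun_pow_hom k hg.
have im2 : limg (lfun_pow g (k + k)) = limg (lfun_pow g k).
  apply/eqP; rewrite eqEdim; apply/andP; split; last by rewrite mink ?addn_gt0 ?hk.
  apply/subvP => _ /memv_imgP[x _ ->]; rewrite lfun_powE iterD -!lfun_powE.
  by rewrite memv_img ?memvf.
have sum : (homker hgk + imm hgk (fullm X))%VS = fullv.
  apply/vspaceP => x; rewrite memvf.
  have : lfun_pow g k x \in limg (lfun_pow g (k + k)) by rewrite im2 memv_img ?memvf.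
  move=> /memv_imgP[y _ e]; rewrite -(subrK (lfun_pow g k y) x) memv_add //.
    by rewrite memv_ker linearB /= e !lfun_powE iterD subrr.
  by rewrite memv_img ?memvf.
have cap : (homker hgk :&: imm hgk (fullm X))%VS = 0%VS.
  apply/eqP; rewrite -dimv_eq0 /=; have := dimv_sum_cap (homker hgk) (imm hgk (fullm X)).
  rewrite sum /= -(limg_ker_dim (lfun_pow g k) fullv) capfv => /eqP.
  by rewrite -[X in _ == X]addn0 eqn_add2l.
have [/= k0|/= i0] := hX _ _ sum cap; last first.
  left; exists k => x; apply/eqP; rewrite -lfun_powE -memv0 -i0.
  by rewrite memv_img ?memvf.
right; apply: inj_surj => //; apply/eqP; rewrite -subv0 -k0.
apply/subvP => x; rewrite !memv_ker lfun_powE => /eqP gx.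
by case: (k) hk => // k' _; rewrite iterSr gx; apply/eqP; elim: k' => //= k' ->; rewrite linear0.
Qed.

(** The endomorphism ring of an indecomposable module is local. If [u = g i + h] is
    bijective and [u^-1 g i] is not, then [u^-1 g i] is nilpotent; but it fixes the
    kernel of [h] pointwise, so [h] is injective. *)
Lemma indec_sum X (I : eqType) (s : seq I) (g : I -> 'Hom(X, X)) :
  indecomposable X -> (forall i, is_hom (g i)) ->
  limg (\sum_(i <- s) g i) = fullv -> exists i, limg (g i) = fullv.
Proof.
move=> iX hg; elim: s => [|i s IH].
  rewrite big_nil => h; case: iX => nz _; case: nz; rewrite -h; exact: lim0g.
set h := \sum_(j <- s) g j; rewrite big_cons -/h => fu; set u := g i + h in fu.
have hh : is_hom h.
  apply/mem_HomA; apply: memv_suml => j _; exact/mem_HomA.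
have hu : is_hom u by apply: is_homD.
have u0 := surj_inj fu erefl.
have uK : cancel u (u^-1)%VF by apply/lker0_lfunK/eqP.
have uVK x : u (u^-1%VF x) = x by rewrite limg_lfunVK // fu memvf.
have hv : is_hom (u^-1 \o g i : 'Hom(X, X))%VF by apply: is_hom_comp => //; apply: is_hom_inv.
have [[k nil]|/limg_fullP sv] := fitting hv iX; last first.
  exists i; apply/limg_fullP => x; have [y e] := sv (u^-1%VF x).
  by exists y; move: e; rewrite comp_lfunE => /(congr1 u); rewrite !uVK.
apply: IH; apply: inj_surj => //; apply/eqP; rewrite -subv0; apply/subvP => x.
rewrite memv_ker memv0 => /eqP hx.
have fx : (u^-1 \o g i)%VF x = x.
  by rewrite comp_lfunE -[g i x]addr0 -hx -add_lfunE uK.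
by rewrite -(nil x); apply/eqP; elim: (k) => //= l <-.
Qed.

Lemma surj_top_dim M N (f : 'Hom(M, N)) : is_hom f -> limg f = fullv ->
  (dim (top N) <= dim (top M))%N.
Proof.
move=> hf ff; set q := quotm_map (Jmul (fullm N)).
have hq : is_hom (q \o f : 'Hom(M, top N))%VF.
  by apply: is_hom_comp => //; apply: quotm_map_hom.
have [|v /quotm_ker Jv|k hk kE] := hom_factor (quotm_map_hom (Jmul (fullm M))) _ hq.
- exact: limg_quotm_map.
- by rewrite comp_lfunE; apply/quotm_ker; apply: (Jpow_hom (l := 1) hf).
apply: (@limg_full_dim _ _ _ k); apply/limg_fullP => w.
have [n <-] := quotm_surj w; have /limg_fullP/(_ n)[m <-] := ff.
by exists (quotm_map _ m); rewrite kE comp_lfunE.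
Qed.

End Decompositions.

Section Locals.
Context (K : fieldType) (Q : quiver) (A : falgType K) (pres : presentation Q A).
Implicit Types M N X Y : fdmod A.

Lemma simple_dim X : simple X <-> dim X = 1%N.
Proof.
split; last exact: simple_dim1.
move=> /(simple_line pres)[_ [v [x [x0 _ e]]]].
by rewrite -dimvf e dim_vline x0.
Qed.

Lemma top_dim_gt0 M : nonzero M -> (0 < dim (top M))%N.
Proof.
move=> /(nonzero_J pres) nz; rewrite lt0n; apply/eqP => d0; apply: nz; apply/eqP.
by rewrite eqEdim subvf dimvf -(dim_quotm (Jmul (fullm M))) -/(top M) d0 add0n /=.
Qed.

Lemma squarefree_dim t M : squarefree_top t M -> dim (top M) = t.
Proof.
move=> [S [[Ss Sd] simS _]]; rewrite -dimvf -Ss (directvP Sd) /=.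
rewrite (eq_bigr (fun=> 1%N)) ?sum1_card ?card_ord // => i _.
by rewrite -[LHS](dim_subm (S i)); apply/simple_dim.
Qed.

(** Tops are additive, so [t] is the sum of the dimensions of the tops of the [s]
    indecomposable summands, all positive: [t = s] says that all of them are one. If
    [M] is a sum of local modules, then by [indec_sum] every indecomposable summand
    is a quotient of one of these, hence local. *)
Lemma locals_iff t s M : squarefree_top t M -> indec_decomp s M ->
  sum_of_locals M <-> t = s.
Proof.
move=> /squarefree_dim dt [U [dU iU]].
have tU := dsum_top_dim dU; rewrite dt in tU.
have gt0 i : (0 < dim (top (subm (U i))))%N by apply: top_dim_gt0; case: (iU i).
split=> [[n [L [dL lL]]]|ts].
  suff d1 i : dim (top (subm (U i))) = 1%N.
    by rewrite tU (eq_bigr (fun=> 1%N)) ?sum1_card ?card_ord.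
  apply/eqP; rewrite eqn_leq gt0 andbT.
  have [f [fh fU fs f0]] := dsum_proj dU; have [e [eh eL es e0]] := dsum_proj dL.
  have [fi fih fiE] := vsproj_hom (fh i) (fU i).
  pose g j : 'Hom(subm (U i), subm (U i)) := (fi \o (e j \o incl (U i)))%VF.
  have gh j : is_hom (g j).
    by do 2!apply: is_hom_comp => //; apply: incl_hom.
  have gs : \sum_(j <- enum 'I_n) g j = \1%VF.
    apply/lfunP => x; rewrite id_lfunE sum_lfunE; apply: subvs_inj.
    rewrite -[LHS]inclE linear_sum /=.
    rewrite big_enum /= (eq_bigr (fun j => f i (e j (vsval x)))) => [|j _].
      by rewrite -linear_sum -es /= (f0 i i) ?eqxx // subvsP.
    by rewrite inclE !comp_lfunE fiE inclE.
  have [j gj] : exists j, limg (g j) = fullv.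
    by apply: (indec_sum (s := enum 'I_n) (iU i) gh); rewrite gs; apply: lim1g.
  rewrite -((simple_dim _).1 (lL j)).
  have hfi : is_hom (fi \o incl (L j) : 'Hom(subm (L j), subm (U i)))%VF.
    by apply: is_hom_comp => //; apply: incl_hom.
  apply: (surj_top_dim hfi); apply/limg_fullP => w.
  have /limg_fullP/(_ w)[x <-] := gj; exists (vsproj (L j) (e j (vsval x))).
  by rewrite !comp_lfunE !inclE vsprojK.
exists s, U; split=> // i; apply/simple_dim.
have := tU; rewrite ts => e; apply/eqP; rewrite eqn_leq gt0 andbT.
have : (\sum_(i < s) (dim (top (subm (U i)))).-1 = 0)%N.
  apply: (@addnI (\sum_(i < s) 1)%N); rewrite -big_split addn0.
  rewrite (eq_bigr (fun j => dim (top (subm (U j))))) => [|j _].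
    by rewrite -e sum1_card card_ord.
  by apply: prednK; apply: gt0.
move=> /eqP; rewrite sum_nat_eq0 => /forallP/(_ i)/implyP/(_ isT)/eqP.
by case: (dim _) => [|[]].
Qed.

(** Each local summand carries an element outside the radical; the projections onto
    the summands are then independent modulo the maps into the radical. *)
Lemma locals_proj t M : squarefree_top t M -> sum_of_locals M ->
  exists (e : 'I_t -> 'Hom(M, M)) (y : 'I_t -> M),
  [/\ forall j, is_hom (e j), forall j, y j \notin (Jmul (fullm M) : {vspace M}) &
      forall i j, e i (y j) = if i == j then y j else 0].
Proof.
move=> /squarefree_dim dt [n [L [dL lL]]].
have nt : t = n.
  rewrite -dt (dsum_top_dim dL) (eq_bigr (fun=> 1%N)) ?sum1_card ?card_ord // => i _.
  exact/simple_dim/lL.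
rewrite nt; have [e [eh eL es e0]] := dsum_proj dL.
have /choice[y yP] j : exists y, y \in (L j : {vspace M}) /\ y \notin (Jmul (L j) : {vspace M}).
  have := (simple_dim _).1 (lL j) => d.
  have /subvPn[y Ly nJ] : ~~ (L j <= Jmul (L j))%VS.
    apply/negP => /dimvS; rewrite leqNgt => /negP; apply.
    rewrite -(dim_subm (L j)) -(dim_quotm (Jmul (fullm (subm (L j))))) d add1n ltnS.
    rewrite -(Jpow_incl (L j) 1) limg_dim_eq //.
    by have /lker0_inj -> := @incl_inj _ _ _ (L j); rewrite capv0.
  by exists y.
exists e, y; split=> // [j|i j]; last by apply: e0; case: (yP j).
have [Ly] := yP j; apply: contra => Jy.
rewrite -[y j]/(if true then y j else 0) -(eqxx j) -(e0 _ _ _ Ly).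
apply: (subvP (_ : (e j @: Jmul (fullm M) <= Jmul (L j))%VS)); last exact: memv_img.
rewrite (@Jmul_img _ _ _ _ (e j) (fullm M) (imm (eh j) (fullm M))) //.
by apply: JmulS; apply/subvP => _ /memv_imgP[x _ ->]; apply: eL.
Qed.

End Locals.

(** * Polynomial functions on the module variety *)

Section PolyFun.
Context (K : fieldType).

(** Induction over the structure of a polynomial, for functions that depend on the
    argument only through the values of the variables. It is used for univariate
    polynomials along a line and for regular functions. *)
Lemma meval_closed (T : Type) (P : (T -> K) -> Prop) N (p : {mpoly K[N]})
    (c : 'I_N -> T -> K) :
  (forall k, P (fun=> k)) ->
  (forall f g, P f -> P g -> P (fun t => f t + g t)) ->
  (forall f g, P f -> P g -> P (fun t => f t * g t)) ->
  (forall k, P (c k)) -> P (fun t => p.@[fun k => c k t]).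
Proof.
move=> Pc PD PM Pk.
have Psum (I : Type) (s : seq I) (F : I -> T -> K) : (forall i, P (F i)) ->
    P (fun t => \sum_(i <- s) F i t).
  move=> PF; elim: s => [|i s IH].
    by rewrite (_ : (fun t => _) = fun=> 0) //; apply: funext => t; rewrite big_nil.
  rewrite (_ : (fun t => _) = fun t => F i t + \sum_(j <- s) F j t); first exact: PD.
  by apply: funext => t; rewrite big_cons.
have Pprod (I : Type) (s : seq I) (F : I -> T -> K) : (forall i, P (F i)) ->
    P (fun t => \prod_(i <- s) F i t).
  move=> PF; elim: s => [|i s IH].
    by rewrite (_ : (fun t => _) = fun=> 1) //; apply: funext => t; rewrite big_nil.
  rewrite (_ : (fun t => _) = fun t => F i t * \prod_(j <- s) F j t); first exact: PM.
  by apply: funext => t; rewrite big_cons.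
have PX f e : P f -> P (fun t => f t ^+ e).
  move=> Pf; elim: e => [|e IH].
    by rewrite (_ : (fun t => _) = fun=> 1) //; apply: funext => t; rewrite expr0.
  rewrite (_ : (fun t => _) = fun t => f t * f t ^+ e); first exact: PM.
  by apply: funext => t; rewrite exprS.
rewrite (_ : (fun t => _) =
  fun t => \sum_(m <- msupp p) p@_m * \prod_i c i t ^+ m i); last first.
  by apply: funext => t; rewrite mevalE.
by apply: Psum => m; apply: PM => //; apply: Pprod => i; apply: PX.
Qed.

Context (n d : nat).
Implicit Types (x y : mpoint K n d) (S : mpoint K n d -> Prop).

Definition polyfun (f : mpoint K n d -> K) : Prop :=
  exists p : {mpoly K[#|{: 'I_n * 'I_d * 'I_d}|]}, forall x, f x = p.@[coordinates x].

Lemma polyfun_ext f g : f =1 g -> polyfun f -> polyfun g.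
Proof. by move=> e [p hp]; exists p => x; rewrite -e. Qed.

Lemma polyfun_const c : polyfun (fun=> c).
Proof. by exists c%:MP => x; rewrite mevalC. Qed.

Lemma polyfunD f g : polyfun f -> polyfun g -> polyfun (fun x => f x + g x).
Proof. by move=> [p hp] [q hq]; exists (p + q) => x; rewrite mevalD hp hq. Qed.

Lemma polyfunM f g : polyfun f -> polyfun g -> polyfun (fun x => f x * g x).
Proof. by move=> [p hp] [q hq]; exists (p * q) => x; rewrite mevalM hp hq. Qed.

Lemma polyfunN f : polyfun f -> polyfun (fun x => - f x).
Proof. by move=> [p hp]; exists (- p) => x; rewrite mevalN hp. Qed.

Lemma polyfunB f g : polyfun f -> polyfun g -> polyfun (fun x => f x - g x).
Proof. by move=> hf hg; apply: polyfunD => //; apply: polyfunN. Qed.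

Lemma polyfun_sum (I : Type) (s : seq I) (P : pred I) (F : I -> mpoint K n d -> K) :
  (forall i, polyfun (F i)) -> polyfun (fun x => \sum_(i <- s | P i) F i x).
Proof.
move=> hF; elim: s => [|i s IH].
  by apply: polyfun_ext (polyfun_const 0) => x; rewrite big_nil.
case e: (P i); last by apply: polyfun_ext IH => x; rewrite big_cons e.
by apply: polyfun_ext (polyfunD (hF i) IH) => x; rewrite big_cons e.
Qed.

Lemma polyfun_prod (I : Type) (s : seq I) (P : pred I) (F : I -> mpoint K n d -> K) :
  (forall i, polyfun (F i)) -> polyfun (fun x => \prod_(i <- s | P i) F i x).
Proof.
move=> hF; elim: s => [|i s IH].
  by apply: polyfun_ext (polyfun_const 1) => x; rewrite big_nil.
case e: (P i); last by apply: polyfun_ext IH => x; rewrite big_cons e.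
by apply: polyfun_ext (polyfunM (hF i) IH) => x; rewrite big_cons e.
Qed.

Lemma polyfun_entry i p q : polyfun (fun x => x i p q).
Proof.
exists 'X_(enum_rank (i, p, q)) => x.
by rewrite mevalXU /coordinates enum_rankK.
Qed.

Definition polymx m r (B : mpoint K n d -> 'M[K]_(m, r)) : Prop :=
  forall i j, polyfun (fun x => B x i j).

Lemma polymx_const m r (C : 'M[K]_(m, r)) : polymx (fun=> C).
Proof. by move=> i j; apply: polyfun_const. Qed.

Lemma polymx_entry i : polymx (fun x => x i).
Proof. by move=> p q; apply: polyfun_entry. Qed.

Lemma polymx_mul m r s (B : mpoint K n d -> 'M[K]_(m, r))
    (C : mpoint K n d -> 'M[K]_(r, s)) :
  polymx B -> polymx C -> polymx (fun x => B x *m C x).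
Proof.
move=> hB hC i j; apply: (@polyfun_ext (fun x => \sum_k B x i k * C x k j)).
  by move=> x; rewrite mxE.
by apply: polyfun_sum => k; apply: polyfunM.
Qed.

Lemma polyfun_det m (B : mpoint K n d -> 'M[K]_m) : polymx B -> polyfun (fun x => \det (B x)).
Proof.
move=> hB; apply: polyfun_sum => s; apply: polyfunM; first exact: polyfun_const.
by apply: polyfun_prod => i; apply: hB.
Qed.

Lemma polymx_adj m (B : mpoint K n d -> 'M[K]_m) : polymx B -> polymx (fun x => \adj (B x)).
Proof.
move=> hB i j; apply: (@polyfun_ext (fun x => cofactor (B x) j i)).
  by move=> x; rewrite mxE.
apply: polyfunM; first exact: polyfun_const.
apply: polyfun_det => k l.
apply: (@polyfun_ext (fun x => B x (fintype.lift j k) (fintype.lift i l))) => [x|]; last exact: hB.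
by rewrite !mxE.
Qed.

Lemma closureP S x : zariski_closure S x <->
  forall f, polyfun f -> (forall y, S y -> f y = 0) -> f x = 0.
Proof.
split=> [h f [p hp] f0|h Z [F hF] SZ].
  rewrite hp; have := h (fun y => p.@[coordinates y] = 0).
  apply; last by move=> y Sy; rewrite -hp f0.
  exists (fun q => q = p) => y; split=> [e _ ->//|]; exact.
apply/hF => p Fp; apply: (h (fun y => p.@[coordinates y])); first by exists p.
by move=> y /SZ/hF; apply.
Qed.

(** The rank of a polynomial matrix can only drop on the closure: an invertible
    minor [L *m B x *m R] at [x] is already invertible somewhere on [S]. *)
Lemma closure_rank S x m r (B : mpoint K n d -> 'M[K]_(m, r)) k :
  polymx B -> zariski_closure S x -> (forall y, S y -> (\rank (B y) <= k)%N) ->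
  (\rank (B x) <= k)%N.
Proof.
move=> hB /closureP cl hk; rewrite leqNgt; apply/negP => gt.
pose L := pinvmx (col_base (B x)); pose R := pinvmx (row_base (B x)).
have e : L *m B x *m R = 1%:M.
  have : L *m (col_base (B x) *m row_base (B x)) *m R = 1%:M.
    by rewrite mulmxA mulVpmx ?col_base_full // mul1mx mulmxVp ?row_base_free.
  by rewrite mulmx_base.
suff : \det (L *m B x *m R) = 0 by rewrite e det1 => /eqP; rewrite oner_eq0.
apply: (cl (fun y => \det (L *m B y *m R))).
- apply: polyfun_det; apply: polymx_mul; last exact: polymx_const.
  by apply: polymx_mul => //; apply: polymx_const.
move=> y Sy; apply/eqP; apply: contraTT isT; rewrite -unitfE -unitmxE => /mxrank_unit rk.
have := leq_ltn_trans (hk y Sy) gt; rewrite ltnNge => /negP; case; rewrite -[X in (X <= _)%N]rk.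
by apply: leq_trans (mxrankM_maxl _ _) (mxrankM_maxr _ _).
Qed.

End PolyFun.

(** * Modules as points *)

Section Points.
Import VectorInternalTheory.
Context (K : fieldType) (A : falgType K) (n : nat) (a : 'I_n -> A).
Implicit Types (M N X : fdmod A).

Definition intertwines d (x : mpoint K n d) X (f : 'Hom('cV[K]_d, X)) : Prop :=
  forall i v, f (x i *m v) = act X (a i) (f v).

Lemma intertwines_word d (x : mpoint K n d) X (f : 'Hom('cV[K]_d, X)) (w : seq 'I_n) v :
  intertwines x f -> f ((\prod_(i <- w) x i) *m v) = act X (\prod_(i <- w) a i) (f v).
Proof.
move=> h; elim: w => [|i w IH].
  by rewrite !big_nil mul1mx act1E.
by rewrite !big_cons -[_ * _]/(x i *m _) -mulmxA h IH actME.
Qed.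

(** A linear isomorphism that matches the matrices with the action of the generators
    forces all relations between the generators to hold for the matrices. *)
Lemma representsP d (x : mpoint K n d) M : represents a x M <->
  exists f : 'Hom('cV[K]_d, M), [/\ lker f = 0%VS, limg f = fullv & intertwines x f].
Proof.
split=> [[_ //]|[f [f0 ff h]]]; split; last by exists f.
move=> rho e; have fE v : f ((\sum_(w <- dom rho) coeff w rho *: \prod_(i <- w) x i) *m v) = 0.
  rewrite mulmx_suml linear_sum /= -[RHS](act0E (f v)) -e act_sumE.
  by apply: eq_bigr => w _; rewrite -scalemxAl linearZ actZE /= intertwines_word.
have /lker0_inj fi := f0.
apply/matrixP => p q; rewrite mxE.
have /(congr1 (fun u : 'cV[K]_d => u p 0)) :
   (\sum_(w <- dom rho) coeff w rho *: \prod_(i <- w) x i) *m delta_mx q 0 = 0 :> 'cV[K]_d.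
  by apply: fi; rewrite fE linear0.
by rewrite -colE !mxE.
Qed.

Definition mulv d (m : 'M[K]_d) : 'End('cV[K]_d) := linfun (mulmx m).

Lemma mulvE d (m : 'M[K]_d) v : mulv m v = m *m v.
Proof. by rewrite lfunE. Qed.

Definition colmx d (g : 'End('cV[K]_d)) : 'M[K]_d := \matrix_(p, q) g (delta_mx q 0) p 0.

Lemma colmxE d (g : 'End('cV[K]_d)) v : colmx g *m v = g v.
Proof.
have {2}-> : v = \sum_q v q 0 *: delta_mx q 0.
  rewrite {1}(matrix_sum_delta v); apply: eq_bigr => q _.
  by rewrite big_ord1.
rewrite linear_sum /=; apply/colP => p; rewrite !mxE summxE.
by apply: eq_bigr => q _; rewrite linearZ !mxE mulrC.
Qed.

Lemma colmx_inj d (m m' : 'M[K]_d) : (forall v : 'cV_d, m *m v = m' *m v) -> m = m'.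
Proof.
move=> h; apply/matrixP => p q.
by have /(congr1 (fun u : 'cV[K]_d => u p 0)) := h (delta_mx q 0); rewrite -!colE !mxE.
Qed.

Lemma represents_dim d (x : mpoint K n d) M : represents a x M -> d = dim M.
Proof.
move=> /representsP[f [f0 ff _]]; rewrite -dimvf -ff limg_dim_eq ?f0 ?capv0 //.
by rewrite dimvf dim_matrix; apply: esym (muln1 d).
Qed.

Lemma represents_miso d (x : mpoint K n d) M N :
  represents a x M -> miso M N -> represents a x N.
Proof.
move=> /representsP[f [/lker0_inj f0 /limg_fullP ff h]] [g [/homE hg /lker0_inj g0 /limg_fullP gf]].
apply/representsP; exists (g \o f)%VF; split.
- by apply/lker0_inj => u v; rewrite !comp_lfunE => /g0/f0.
- apply/limg_fullP => w; have [v <-] := gf w; have [u <-] := ff v.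
  by exists u; rewrite comp_lfunE.
by move=> i v; rewrite !comp_lfunE h hg.
Qed.

Lemma represents_orbit d (x y : mpoint K n d) M :
  represents a x M -> Defs.orbit x y -> represents a y M.
Proof.
move=> /representsP[f [/lker0_inj f0 /limg_fullP ff h]] [g gu e].
apply/representsP; exists (f \o mulv (invmx g))%VF; split.
- apply/lker0_inj => u v; rewrite !comp_lfunE !mulvE => /f0/(congr1 (mulmx g)).
  by rewrite !mulKVmx.
- apply/limg_fullP => w; have [v <-] := ff w.
  by exists (g *m v); rewrite comp_lfunE mulvE mulKmx.
by move=> i v; rewrite !comp_lfunE !mulvE e -h !mulmxA mulVmx // mul1mx.
Qed.

(** Two coordinate systems of the same module differ by an invertible matrix. *)
Lemma orbit_represents d (x y : mpoint K n d) M :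
  represents a x M -> represents a y M -> Defs.orbit x y.
Proof.
move=> /representsP[f [f0 ff h]] /representsP[f' [f0' ff' h']].
have fK := lker0_lfunK (introT eqP f0); have fK' := lker0_lfunK (introT eqP f0').
have fV w : f (f^-1%VF w) = w by rewrite limg_lfunVK // ff memvf.
have fV' w : f' (f'^-1%VF w) = w by rewrite limg_lfunVK // ff' memvf.
pose g := colmx (f'^-1 \o f)%VF; pose g' := colmx (f^-1 \o f')%VF.
have gE v : f' (g *m v) = f v by rewrite colmxE comp_lfunE fV'.
have gE' v : f (g' *m v) = f' v by rewrite colmxE comp_lfunE fV.
have gg : g *m g' = 1%:M.
  by apply: colmx_inj => v; rewrite mul1mx -mulmxA; have /lker0_inj := f0'; apply; rewrite gE gE'.
have [gu _] := mulmx1_unit gg; exists g => // i.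
have -> : invmx g = g' by rewrite -[LHS]mulmx1 -gg mulmxA mulVmx // mul1mx.
apply: colmx_inj => v; have /lker0_inj := f0'; apply.
by rewrite h' -!mulmxA gE h gE'.
Qed.

Definition point_of d M (f : 'Hom('cV[K]_d, M)) : mpoint K n d :=
  [ffun i => colmx (f^-1 \o act M (a i) \o f)%VF].

Lemma point_of_represents d M (f : 'Hom('cV[K]_d, M)) :
  lker f = 0%VS -> limg f = fullv -> represents a (point_of f) M.
Proof.
move=> f0 ff; apply/representsP; exists f; split=> // i v.
by rewrite ffunE colmxE !comp_lfunE limg_lfunVK // ff memvf.
Qed.

Definition r2cv M (v : 'cV[K]_(dim M)) : M := r2v v^T.
Lemma r2cv_linear M : linear (@r2cv M).
Proof.
move=> c u v; have e : (c *: u + v)^T = c *: u^T + v^T by apply/matrixP => i j; rewrite !mxE.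
by rewrite /r2cv e linearP.
Qed.

Definition std_coord M : 'Hom('cV[K]_(dim M), M) := mklin (@r2cv_linear M).

Lemma std_coord_inj M : lker (std_coord M) = 0%VS.
Proof.
apply/lker0_inj => u v; rewrite !mklinE /r2cv => /r2v_inj.
exact: trmx_inj.
Qed.

Lemma std_coord_full M : limg (std_coord M) = fullv.
Proof.
apply/limg_fullP => m; exists (v2r m)^T.
by rewrite mklinE /r2cv trmxK v2rK.
Qed.

Hypothesis ha : generates a.

(** Every algebra element is a noncommutative polynomial in the generators, so it
    acts through a polynomial matrix. *)
Lemma evalmx_ex d b : exists B : mpoint K n d -> 'M[K]_d, polymx B /\
  forall x X (f : 'Hom('cV[K]_d, X)), intertwines x f ->
  forall v, f (B x *m v) = act X b (f v).
Proof.
pose P b := exists B : mpoint K n d -> 'M[K]_d, polymx B /\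
  forall x X (f : 'Hom('cV[K]_d, X)), intertwines x f ->
  forall v, f (B x *m v) = act X b (f v).
have PE c : c \in subspace_of P <-> P c.
  apply: subspace_ofP => [|k u v [B [hB eB]] [C [hC eC]]].
    exists (fun=> 0); split=> [|x X f _ v]; first exact: polymx_const.
    by rewrite mul0mx linear0 act0E.
  exists (fun x => k *: B x + C x); split=> [i j|x X f h w].
    apply: (@polyfun_ext _ _ _ (fun x => k * B x i j + C x i j)).
      by move=> x; rewrite !mxE.
    by apply: polyfunD => //; apply: polyfunM => //; apply: polyfun_const.
  by rewrite mulmxDl -scalemxAl linearP /= actDE actZE (eB _ _ _ h) (eC _ _ _ h).
apply/PE; apply: (subvP _ _ (_ : b \in agenv <<codom a>>%VS)); last first.
  by rewrite [agenv _]ha memvf.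
apply: agenv_sub_modl.
  apply/subvP => _ /vlineP[k ->]; rewrite memvZ //; apply/PE.
  exists (fun=> 1%:M); split=> [|x X f _ v]; first exact: polymx_const.
  by rewrite mul1mx act1E.
apply/prodvP => u v Uu /PE[B [hB eB]].
suff : (<<codom a>> <= amulr v @^-1: subspace_of P)%VS.
  by move=> /subvP/(_ _ Uu); rewrite -memv_preim lfunE.
apply/span_subvP => _ /codomP[i ->]; rewrite -memv_preim lfunE /=; apply/PE.
exists (fun x : mpoint K n d => x i *m B x); split=> [|x X f h w].
  by apply: polymx_mul => //; apply: polymx_entry.
by rewrite -mulmxA h (eB _ _ _ h) actME.
Qed.

Lemma intertwines_hom d (x : mpoint K n d) M X (f : 'Hom('cV[K]_d, M))
    (g : 'Hom(M, X)) : intertwines x f -> limg f = fullv ->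
  intertwines x (g \o f)%VF -> is_hom g.
Proof.
move=> hf /limg_fullP ff hg; apply/homE => b m; have [v <-] := ff m.
have [B [_ hB]] := evalmx_ex d b.
by have := hB _ _ _ hg v; rewrite !comp_lfunE (hB _ _ _ hf).
Qed.

Lemma represents_uniq d (x : mpoint K n d) M N :
  represents a x M -> represents a x N -> miso M N.
Proof.
move=> /representsP[f [f0 ff h]] /representsP[g [g0 gf h']].
have fK := lker0_lfunK (introT eqP f0).
have fV w : f (f^-1%VF w) = w by rewrite limg_lfunVK // ff memvf.
exists (g \o f^-1)%VF; split.
- apply: (intertwines_hom h ff) => i v.
  by rewrite !comp_lfunE !fK h'.
- have /lker0_inj gi := g0; apply/lker0_inj => u v.
  by rewrite !comp_lfunE => /gi/(congr1 f); rewrite !fV.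
apply/limg_fullP => w; have /limg_fullP/(_ w)[v <-] := gf.
by exists (f v); rewrite comp_lfunE fK.
Qed.

(** ** Semicontinuity *)

(** Evaluation of a family of linear maps that depends polynomially on the point;
    only the coordinates of the values have to be polynomial functions. *)
Lemma closure_limg d (V W : vectType K) (S : mpoint K n d -> Prop) x
    (Phi : mpoint K n d -> 'Hom(V, W)) k :
  (forall v (l : 'Hom(W, K^o)), polyfun (fun y => l (Phi y v) : K)) ->
  zariski_closure S x -> (forall y, S y -> (\dim (limg (Phi y)) <= k)%N) ->
  (\dim (limg (Phi x)) <= k)%N.
Proof.
move=> hP cl hk.
pose B y : 'M[K]_(dim V, dim W) := f2mx (Phi y).
have rB y : \dim (limg (Phi y)) = \rank (B y).
  have := limg_ker_dim (Phi y) fullv; rewrite capfv dimvf => e.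
  apply: (@addnI (\dim (lker (Phi y)))); rewrite e.
  rewrite {1}/lker /dimv mx2vsK mxrank_ker.
  by rewrite subnK // rank_leq_row.
rewrite rB; apply: (closure_rank _ cl) => [i j|y Sy]; last by rewrite -rB hk.
have ll : linear (fun w : W => v2r w 0 j : K^o).
  by move=> c u v; rewrite linearP !mxE.
apply: (polyfun_ext _ (hP (r2v (delta_mx 0 i)) (mklin ll))) => y.
rewrite mklinE /B; move: (Phi y) => g.
have -> : g (r2v (delta_mx 0 i)) =
   r2v (delta_mx 0 i *m f2mx g).
  by rewrite unlock /= /fun_of_lfun_def /= r2vK.
by rewrite r2vK -rowE mxE.
Qed.

Lemma closure_lker d (V W : vectType K) (S : mpoint K n d -> Prop) x
    (Phi : mpoint K n d -> 'Hom(V, W)) k :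
  (forall v (l : 'Hom(W, K^o)), polyfun (fun y => l (Phi y v) : K)) ->
  zariski_closure S x -> (forall y, S y -> (k <= \dim (lker (Phi y)))%N) ->
  (k <= \dim (lker (Phi x)))%N.
Proof.
move=> hP cl hk.
have rk y : (\dim (lker (Phi y)) + \dim (limg (Phi y)))%N = dim V.
  by rewrite -dimvf -(limg_ker_dim (Phi y) fullv) capfv.
have [le|lt] := leqP k (dim V).
  have := @closure_limg _ _ _ S x Phi (dim V - k) hP cl.
  rewrite -{2}(rk x) => h; rewrite -(leq_add2r (dim V - k)) subnKC // -(rk x) leq_add2l.
  apply: h => y Sy; rewrite -(leq_add2l (\dim (lker (Phi y)))) rk addnBA // leq_subRL.
    by rewrite leq_add2r hk.
  by rewrite (leq_trans le) // leq_addl.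
have /closureP/(_ (fun=> 1)) := cl; case/(_ _ _)/eqP/idPn; rewrite ?oner_eq0 //.
  exact: polyfun_const.
move=> y Sy; have := leq_trans lt (hk y Sy).
by rewrite -(rk y) -{2}[\dim _]addn0 ltn_add2l ltn0.
Qed.

(** [F] is a homomorphism exactly when it solves a linear system whose matrix is
    polynomial in the point, so more maps can appear on the closure. *)
Lemma degeneration_Hom M M' X : degeneration a M M' ->
  (\dim (HomA M X) <= \dim (HomA M' X))%N.
Proof.
move=> [d [x [x' [rx rx' cl]]]].
pose W := {ffun 'I_n -> 'Hom('cV[K]_d, X)}.
pose C (i : 'I_n) p q (F : 'Hom('cV[K]_d, X)) : W :=
  [ffun j => if j == i then (F \o mulv (delta_mx p q))%VF else 0].
pose D (F : 'Hom('cV[K]_d, X)) : W := [ffun i => (act X (a i) \o F)%VF].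
pose phi (y : mpoint K n d) F : W := \sum_i \sum_p \sum_q y i p q *: C i p q F - D F.
have phiE y F i v : phi y F i v = F (y i *m v) - act X (a i) (F v).
  have evs (I : finType) (G : I -> W) : (\sum_k G k) i v = \sum_k G k i v.
    by rewrite sum_ffunE sum_lfunE.
  rewrite /phi !ffunE add_lfunE opp_lfunE comp_lfunE; congr (_ - _).
  transitivity (\sum_k \sum_p \sum_q y k p q *: C k p q F i v).
    rewrite evs; apply: eq_bigr => k _; rewrite evs; apply: eq_bigr => p _.
    by rewrite evs; apply: eq_bigr => q _; rewrite ffunE scale_lfunE.
  rewrite (bigD1 i) //= [X in _ + X]big1 ?addr0 => [|k ki]; last first.
    rewrite big1 // => p _; rewrite big1 // => q _.
    by rewrite ffunE eq_sym (negbTE ki) zero_lfunE scaler0.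
  rewrite [y i in RHS]matrix_sum_delta mulmx_suml linear_sum.
  apply: eq_bigr => p _; rewrite /= mulmx_suml linear_sum.
  apply: eq_bigr => q _; rewrite /= ffunE eqxx comp_lfunE mulvE.
  by rewrite -scalemxAl linearZ.
have phil y : linear (phi y).
  move=> c F G; apply/ffunP => i; apply/lfunP => v.
  have -> (w w' : W) : (c *: w + w') i v = c *: w i v + w' i v.
    by rewrite ffunE ffunE add_lfunE scale_lfunE.
  rewrite !phiE !add_lfunE !scale_lfunE linearP /=.
  rewrite scalerBr opprD; exact: addrACA.
have poly F (l : 'Hom(W, K^o)) : polyfun (fun y => l (mklin (phil y) F) : K).
  apply: (@polyfun_ext _ _ _ (fun y => \sum_i \sum_p \sum_q y i p q * l (C i p q F) - l (D F))).
    move=> y; rewrite mklinE linearB /= !linear_sum; congr (_ - _).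
    apply: eq_bigr => i _; rewrite !linear_sum; apply: eq_bigr => p _.
    by rewrite !linear_sum; apply: eq_bigr => q _; rewrite linearZ.
  apply: polyfunB; last exact: polyfun_const.
  do 3!apply: polyfun_sum => ?; apply: polyfunM; last exact: polyfun_const.
  exact: polyfun_entry.
have ker y N : represents a y N -> \dim (lker (mklin (phil y))) = \dim (HomA N X).
  move=> /representsP[f [f0 ff h]].
  have fK := lker0_lfunK (introT eqP f0).
  have fV w : f (f^-1%VF w) = w by rewrite limg_lfunVK // ff memvf.
  have kerP F : F \in lker (mklin (phil y)) <-> forall i v, F (y i *m v) = act X (a i) (F v).
    rewrite memv_ker mklinE; split=> [/eqP e i v|e].
      have /eqP := phiE y F i v; rewrite e ffunE zero_lfunE eq_sym subr_eq0.
      by move/eqP.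
    apply/eqP/ffunP => i; apply/lfunP => v.
    by rewrite phiE e subrr ffunE zero_lfunE.
  apply/eqP; rewrite eqn_leq; apply/andP; split.
    have ll : linear (fun F : 'Hom('cV[K]_d, X) => (F \o f^-1)%VF : 'Hom(N, X)).
      by move=> c F G; rewrite comp_lfunDl comp_lfunZl.
    apply: (@inj_dim_le _ _ _ (mklin ll)) => F.
      move=> /kerP hF; rewrite mklinE; apply/mem_HomA.
      apply: (intertwines_hom h ff) => i v.
      by rewrite !comp_lfunE !fK hF.
    move=> _; rewrite mklinE => e; apply/lfunP => v.
    by rewrite -[v]fK -comp_lfunE e !zero_lfunE.
  have ll : linear (fun G : 'Hom(N, X) => (G \o f)%VF : 'Hom('cV[K]_d, X)).
    by move=> c F G; rewrite comp_lfunDl comp_lfunZl.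
  apply: (@inj_dim_le _ _ _ (mklin ll)) => G.
    move=> /mem_HomA/homE hG; rewrite mklinE; apply/kerP => i v.
    by rewrite !comp_lfunE h hG.
  move=> _; rewrite mklinE => e; apply/lfunP => v.
  by rewrite -[v]fV -comp_lfunE e !zero_lfunE.
rewrite -(ker _ _ rx'); apply: (closure_lker poly cl) => y oy.
by rewrite (ker _ _ (represents_orbit rx oy)).
Qed.

Definition ideal_span (I : {vspace A}) M : {vspace M} :=
  (\sum_(i < \dim I) act M (vbasis I)`_i @: fullv)%VS.

Lemma mem_ideal_span (I : {vspace A}) M b m : b \in I -> act M b m \in ideal_span I M.
Proof.
move=> Ib; rewrite (coord_vbasis Ib) act_sumE; apply: memv_sumr => i _.
by rewrite actZE memvZ // memv_img ?memvf.
Qed.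

Lemma ideal_span_le (I : {vspace A}) M (W : {vspace M}) :
  (forall b m, b \in I -> act M b m \in W) -> (ideal_span I M <= W)%VS.
Proof.
move=> h; apply/subv_sumP => i _; apply/subvP => _ /memv_imgP[u _ ->].
by apply: h; rewrite vbasis_mem ?mem_nth ?size_tuple.
Qed.

(** This describes [J ^ l M] by finitely many algebra elements that do not depend on
    [M]. *)
Lemma Jpow_ideal l M : Jpow l (fullm M) = ideal_span (jacobson A ^+ l)%VS M :> {vspace M}.
Proof.
elim: l => [|l IH].
  apply/vspaceP => m; rewrite memvf -[m]act1E; apply/esym/mem_ideal_span.
  by rewrite expv0 memv_line.
apply/eqP; rewrite eqEsubv JpowS; apply/andP; split.
  apply: Jmul_le => x u Jx; rewrite IH memv_preim; move: u; apply/subvP/ideal_span_le.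
  move=> b m hb; rewrite -memv_preim -actME; apply: mem_ideal_span.
  by rewrite expvSl memv_mul.
apply: ideal_span_le => b m; rewrite expvSl; move: b.
have ll : linear (fun b => act M b m) by move=> c u v; rewrite actDE actZE.
suff : (jacobson A * jacobson A ^+ l <= mklin ll @^-1: Jmul (Jpow l (fullm M)))%VS.
  by move=> /subvP h b /h; rewrite -memv_preim mklinE.
apply/prodvP => x b Jx hb; rewrite -memv_preim mklinE actME mem_Jmul //.
by rewrite IH mem_ideal_span.
Qed.

(** [J ^ l M] is the image of a map whose matrix is polynomial in the point, so it
    can only shrink on the closure. *)
Lemma degeneration_Jpow l M M' : degeneration a M M' ->
  (\dim (Jpow l (fullm M')) <= \dim (Jpow l (fullm M)))%N.
Proof.
move=> [d [x [x' [rx rx' cl]]]].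
pose I := (jacobson A ^+ l)%VS; pose p := \dim I.
have /choice[B BP] (i : 'I_p) := evalmx_ex d (vbasis I)`_i.
pose phi y (v : {ffun 'I_p -> 'cV[K]_d}) := \sum_i B i y *m v i.
have phil y : linear (phi y).
  move=> c u v; rewrite /phi scaler_sumr -big_split /=; apply: eq_bigr => i _.
  by rewrite !ffunE mulmxDr scalemxAr.
have poly v (L : 'Hom('cV[K]_d, K^o)) : polyfun (fun y => L (mklin (phil y) v) : K).
  apply: (@polyfun_ext _ _ _ (fun y => \sum_i \sum_r \sum_s
      B i y r s * (v i s 0 * L (delta_mx r 0)))).
    move=> y; rewrite mklinE linear_sum; apply: eq_bigr => i _ /=.
    rewrite [B i y *m v i]matrix_sum_delta linear_sum; apply: eq_bigr => r _ /=.
    rewrite big_ord1 linearZ /= mxE -[_ *: _]/(_ * _) mulr_suml; apply: eq_bigr => s _.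
    by rewrite mulrA.
  apply: polyfun_sum => i; apply: polyfun_sum => r; apply: polyfun_sum => s.
  apply: polyfunM; last exact: polyfun_const.
  by have [h _] := BP i; apply: h.
have rk y N : represents a y N -> \dim (limg (mklin (phil y))) = \dim (Jpow l (fullm N)).
  move=> /representsP[f [f0 ff h]]; rewrite Jpow_ideal.
  rewrite -(@limg_dim_eq _ _ _ f); last by rewrite f0 capv0.
  congr (\dim _); apply/eqP; rewrite eqEsubv; apply/andP; split.
    apply/subvP => _ /memv_imgP[_ /memv_imgP[v _ ->] ->]; rewrite mklinE linear_sum.
    apply: memv_suml => i _ /=; rewrite ((BP i).2 _ _ _ h).
    by apply: mem_ideal_span; rewrite vbasis_mem ?mem_nth ?size_tuple.
  apply/subv_sumP => i _; apply/subvP => _ /memv_imgP[m _ ->].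
  have /limg_fullP/(_ m)[v <-] := ff; rewrite -((BP i).2 _ _ _ h).
  apply: memv_img; apply/memv_imgP; exists [ffun j => if j == i then v else 0].
    exact: memvf.
  rewrite mklinE /phi (bigD1 i) //= ffunE eqxx big1 ?addr0 // => j /negPf ji.
  by rewrite ffunE ji mulmx0.
rewrite -(rk _ _ rx'); apply: (closure_limg poly cl) => y oy.
by rewrite (rk _ _ (represents_orbit rx oy)).
Qed.

End Points.

(** * Sums of local modules have no proper layer-stable degenerations *)

Section HomDims.
Context (K : fieldType) (A : falgType K).
Implicit Types M N X Y Z : fdmod A.

(** Composition with [g] is a bijection between the two spaces. *)
Lemma Hom_factor_dim N Z Y (g : 'Hom(N, Z)) : is_hom g -> limg g = fullv ->
  (forall h : 'Hom(N, Y), is_hom h -> forall v, g v = 0 -> h v = 0) ->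
  \dim (HomA N Y) = \dim (HomA Z Y).
Proof.
move=> hg gf gh; apply/eqP; rewrite eqn_leq; apply/andP; split.
  have ll : linear (fun h : 'Hom(N, Y) => (h \o g^-1)%VF : 'Hom(Z, Y)).
    by move=> c u v; rewrite comp_lfunDl comp_lfunZl.
  have hE h : is_hom h -> exists2 k : 'Hom(Z, Y), is_hom k & h = (k \o g)%VF /\ (h \o g^-1)%VF = k.
    move=> hh; have [k hk kE] := hom_factor hg gf hh (gh h hh).
    exists k => //; split; apply/lfunP => w; rewrite !comp_lfunE ?kE //.
    by rewrite -kE limg_lfunVK // gf memvf.
  apply: (@inj_dim_le _ _ _ (mklin ll)) => h /mem_HomA/hE[k hk [e1 e2]]; rewrite mklinE e2.
    exact/mem_HomA.
  by move=> k0; rewrite e1 k0 comp_lfun0l.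
have ll : linear (fun k : 'Hom(Z, Y) => (k \o g)%VF : 'Hom(N, Y)).
  by move=> c u v; rewrite comp_lfunDl comp_lfunZl.
apply: (@inj_dim_le _ _ _ (mklin ll)) => k; rewrite mklinE.
  by move=> /mem_HomA hk; apply/mem_HomA/is_hom_comp.
move=> _ e; apply/lfunP => w; have /limg_fullP/(_ w)[v <-] := gf.
by rewrite -comp_lfunE e !zero_lfunE.
Qed.

(** Homomorphisms into the radical of [X] lie in the kernel of any [L] that only
    sees the top of [X]. The next lemma is the opposite inequality, for an [L] that
    sees all of the top. *)
Lemma Hom_rad_dim_le N X (T : vectType K) (L : 'Hom('Hom(N, X), T)) :
  (forall f, is_hom f -> (forall v, f v \in (Jmul (fullm X) : {vspace X})) -> L f = 0) ->
  (\dim (HomA N (Defs.rad X)) + \dim (L @: HomA N X) <= \dim (HomA N X))%N.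
Proof.
move=> h; rewrite -[leqRHS](limg_ker_dim L) leq_add2r.
have ll : linear (fun k : 'Hom(N, Defs.rad X) => (incl (Jmul (fullm X)) \o k)%VF : 'Hom(N, X)).
  by move=> c u v; rewrite comp_lfunDr comp_lfunZr.
apply: (@inj_dim_le _ _ _ (mklin ll)) => k; rewrite mklinE.
  move=> /mem_HomA hk; have hik : is_hom (incl (Jmul (fullm X)) \o k : 'Hom(N, X))%VF.
    by apply: is_hom_comp => //; apply: incl_hom.
  rewrite memv_cap memv_ker h ?eqxx ?andbT //; first exact/mem_HomA.
  by move=> v; rewrite comp_lfunE inclE subvsP.
move=> _ e; apply/lfunP => v; apply: (@incl_inj _ _ _ (Jmul (fullm X))).
by rewrite -comp_lfunE e !zero_lfunE linear0.
Qed.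

Lemma Hom_rad_dim_ge N X (T : vectType K) (L : 'Hom('Hom(N, X), T)) :
  (forall f, is_hom f -> L f = 0 -> forall v, f v \in (Jmul (fullm X) : {vspace X})) ->
  (\dim (HomA N X) <= \dim (HomA N (Defs.rad X)) + \dim (L @: HomA N X))%N.
Proof.
move=> h; rewrite -[leqLHS](limg_ker_dim L) leq_add2r.
have ll : linear (fun f : 'Hom(N, X) => (linfun (@vsproj K X (Jmul (fullm X))) \o f)%VF : 'Hom(N, Defs.rad X)).
  by move=> c u v; rewrite comp_lfunDr comp_lfunZr.
have pE f : is_hom f -> L f = 0 -> exists2 g : 'Hom(N, Defs.rad X), is_hom g & mklin ll f = g /\
    forall v, vsval (g v) = f v.
  move=> hf Lf; have [g hg gE] := vsproj_hom hf (h f hf Lf).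
  exists g => //; split=> //; apply/lfunP => v.
  by rewrite mklinE comp_lfunE lfunE /= -gE vsvalK.
apply: (@inj_dim_le _ _ _ (mklin ll)) => f; rewrite memv_cap memv_ker.
  by move=> /andP[/mem_HomA hf /eqP Lf]; have [g hg [-> _]] := pE f hf Lf; apply/mem_HomA.
move=> /andP[/mem_HomA hf /eqP Lf]; have [g hg [-> gE]] := pE f hf Lf => g0.
by apply/lfunP => v; rewrite -gE g0 !zero_lfunE.
Qed.

Lemma linear_form X (U : submodule X) x : x \notin (U : {vspace X}) ->
  exists2 l : 'Hom(X, K^o), l x = 1 & forall u, u \in (U : {vspace X}) -> l u = 0.
Proof.
move=> xU; pose s := quotm_map U x.
have s0 : s != 0 by rewrite quotm_eq0.
exists (linfun (coord [tuple s] ord0 : quotm U -> K^o) \o quotm_map U)%VF => [|u /quotm_ker u0].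
  rewrite comp_lfunE lfunE /= -/s -[X in coord _ _ X]/([tuple s]`_(@ord0 0)).
  by rewrite coord_free ?seq1_free.
by rewrite comp_lfunE u0 linear0.
Qed.

End HomDims.

Section Rigid.
Context (K : fieldType) (Q : quiver) (A : falgType K) (pres : presentation Q A).
Context (n : nat) (a : 'I_n -> A) (ha : generates a).
Implicit Types M N X Y : fdmod A.

Notation "''J_' M" := (Jmul (fullm M)) (at level 8, M at level 2, format "''J_' M").

Lemma frame_quot t M (U : submodule M) vx (z : 'I_t -> M) :
  (U <= 'J_M)%VS -> frame pres vx z -> frame pres vx (fun i => quotm_map U (z i) : quotm U).
Proof.
move=> /subvP UJ fr.
have qJ m : (quotm_map U m \in ('J_(quotm U) : {vspace _})) = (m \in ('J_M : {vspace M})).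
  rewrite -(Jpow_surj 1 (quotm_map_hom U) (limg_quotm_map U)).
  apply/idP/idP => [/memv_imgP[u Ju e]|]; last exact: memv_img.
  rewrite -(subrK u m) memvD //; apply: UJ; apply/quotm_ker.
  by rewrite linearB /= e subrr.
have qs (c : 'I_t -> K) : \sum_i c i *: quotm_map U (z i) = quotm_map U (\sum_i c i *: z i).
  by rewrite linear_sum; apply: eq_bigr => i _; rewrite linearZ.
split; first exact: frame_inj fr.
- by move=> i; rewrite -quotm_hom (frame_eps fr).
- move=> w; have [m <-] := quotm_surj w; have [c hc] := frame_span fr m.
  by exists c; rewrite qs -linearB qJ.
by move=> c; rewrite qs qJ; apply: frame_free fr c.
Qed.

(** [L f] records the coefficient of the [i]-th generator of [X] in the image of the
    [i]-th generator of [N]. Modulo the radical this is all of [f], since the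
    generators live at distinct vertices; and if all these coefficients are one, [f]
    is onto by Nakayama's lemma. *)
Lemma frame_eval t N X vx (zN : 'I_t -> N) (zX : 'I_t -> X) :
  frame pres vx zN -> frame pres vx zX ->
  exists L : 'Hom('Hom(N, X), 'rV[K]_t),
    (forall f, is_hom f -> L f = 0 -> forall v, f v \in ('J_X : {vspace X})) /\
    (forall f, is_hom f -> L f = const_mx 1 -> limg f = fullv).
Proof.
move=> fN fX.
have /choice[l lP] i : exists l : 'Hom(X, K^o), l (zX i) = 1 /\
    forall u, u \in ('J_X : {vspace X}) -> l u = 0.
  by have [l h1 h2] := linear_form (frame_notJ fX i); exists l.
have ll : linear (fun f : 'Hom(N, X) => \row_i (l i (f (zN i)) : K)).
  move=> c f g; apply/rowP => i; rewrite !mxE add_lfunE scale_lfunE linearP.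
  by [].
have at_i f i : is_hom f -> f (zN i) - (l i (f (zN i)) : K) *: zX i \in ('J_X : {vspace X}).
  move=> /homE hf.
  have [|c hc] := @frame_at _ _ _ _ _ _ _ _ fX i (f (zN i)).
    by rewrite -hf (frame_eps fN).
  suff -> : l i (f (zN i)) = c by [].
  have [l1 lJ] := lP i; have := lJ _ hc; rewrite linearB linearZ /= l1 => /eqP.
  by rewrite subr_eq0 => /eqP->; apply: mulr1.
exists (mklin ll); split=> f hf; rewrite mklinE => e.
  have e0 i : l i (f (zN i)) = 0 by have /rowP/(_ i) := e; rewrite !mxE.
  suff /subvP h : (limg f <= 'J_X)%VS by move=> v; rewrite h // memv_img ?memvf.
  have pJ : prem hf ('J_X) = fullv :> {vspace N}.
    apply: (frame_gen fN) => i; rewrite /= -memv_preim.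
    by have := at_i f i hf; rewrite e0 scale0r subr0.
  by apply/subvP => _ /memv_imgP[v _ ->]; rewrite memv_preim -[lfun_preim _ _]/(submodule_space (prem hf ('J_X))) pJ memvf.
apply: (nakayama_surj pres hf) => x; have [c hc] := frame_span fX x.
exists (\sum_i c i *: zN i).
rewrite -(subrK (\sum_i c i *: zX i) x) -addrA memvD // linear_sum -sumrB.
apply: memv_suml => i _; rewrite linearZ /= -scalerBr memvZ // -memvN opprB.
have := at_i f i hf; suff -> : l i (f (zN i)) = 1 by rewrite scale1r.
by have /rowP/(_ i) := e; rewrite !mxE.
Qed.

Lemma degeneration_dim M N : degeneration a M N -> dim M = dim N.
Proof.
by move=> [d [x [y [/represents_dim <- /represents_dim <- _]]]].
Qed.

(** By induction on [l], [M'] maps onto [X l = M / J ^ l M]; once [J ^ l] vanishes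
    on [M], equality of dimensions makes this an isomorphism. For the induction
    step, [Y = J (X l.+1)] is killed by [J ^ l]. By layer stability the kernel of
    the surjection onto [X l] has the dimension of [J ^ l M'], so it equals [J ^ l
    M'], and homomorphisms from [M] or from [M'] to [Y] both factor through [X l];
    thus both Hom spaces have the same dimension. Now [dim Hom(M', X l.+1) >= dim
    Hom(M, X l.+1) >= dim Hom(M, Y) + t], where the first inequality is
    [degeneration_Hom] and the second comes from the projections of [locals_proj].
    So the homomorphisms from [M'] to [X l.+1] realize all [t] coefficients of
    [frame_eval], and one of them is onto. *)
Lemma locals_rigid t M M' : squarefree_top t M -> sum_of_locals M ->
  layer_stable_degeneration a M M' -> miso M M'.
Proof.
move=> sq loc [dg lay].
have [e [y [eh yJ ey]]] := locals_proj pres sq loc.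
have [vx [z fz]] := squarefree_frame pres sq.
have dJ l : \dim (Jpow l (fullm M)) = \dim (Jpow l (fullm M')).
  exact: (miso_layers_dim pres lay).
have [z' fz'] : exists z' : 'I_t -> M', frame pres vx z'.
  apply: (frame_iso fz); apply: (top_miso (pres := pres)) => v.
    exact: (miso_layers pres lay 0).
  exact: (miso_layers pres lay 1).
have dM := degeneration_dim dg.
pose X l := quotm (Jpow l (fullm M)); pose q l := quotm_map (Jpow l (fullm M)).
have qh l : is_hom (q l : 'Hom(M, X l)) by apply: quotm_map_hom.
have qf l : limg (q l) = fullv by apply: limg_quotm_map.
have XJ l : Jpow l (fullm (X l)) = 0%VS :> {vspace _}.
  rewrite -(Jpow_surj l (qh l) (qf l)); apply/eqP; rewrite -subv0.
  apply/subvP => _ /memv_imgP[u Ju ->]; rewrite memv0 quotm_eq0; exact: Ju.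
suff main l : exists2 g : 'Hom(M', X l), is_hom g & limg g = fullv.
  have [m /(_ _ _ (leqnn m)) hm] := Jpow_nil pres.
  have [g hg gf] := main m.
  have dX : dim (X m) = dim M.
    by rewrite -(dim_quotm (Jpow m (fullm M))) hm dimv0 addn0.
  apply: (@miso_trans _ _ _ (X m)).
    exact: miso_surj (qh m) (qf m) (esym dX).
  by apply/miso_sym/(miso_surj hg gf); rewrite dX.
elim: l => [|l [g hg gf]].
  exists 0 => [|]; first by apply/homE => b v; rewrite !zero_lfunE linear0.
  apply/eqP; rewrite eqEdim subvf dimvf /=.
  have := dim_quotm (Jpow 0 (fullm M)); rewrite -[submodule_space _]/fullv dimvf.
  by rewrite -{2}[dim M]add0n => /addIn->.
set Y := Defs.rad (X l.+1).
have YJ : Jpow l (fullm Y) = 0%VS :> {vspace _}.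
  apply/eqP; rewrite -subv0; apply/subvP => w Jw; rewrite memv0.
  apply/eqP/(@incl_inj _ _ _ ('J_(X l.+1))); rewrite linear0; apply/eqP; rewrite -memv0.
  rewrite -(XJ l.+1) /Jpow iterSr; apply: (subvP (_ : (_ <= _)%VS)) _ (memv_img _ Jw).
  by rewrite Jpow_incl subvv.
have killY N (h : 'Hom(N, Y)) v : is_hom h -> v \in (Jpow l (fullm N) : {vspace N}) -> h v = 0.
  by move=> hh Jv; apply/eqP; rewrite -memv0 -YJ Jpow_hom.
have kerg : lker g = Jpow l (fullm M').
  apply/esym/eqP; rewrite eqEdim; apply/andP; split.
    apply/subvP => v Jv; rewrite memv_ker -memv0 -(XJ l); exact: Jpow_hom.
  rewrite -dJ -(leq_add2r (dim (X l))).
  have -> : (\dim (lker g) + dim (X l))%N = dim M'.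
    by rewrite -!dimvf -gf -(limg_ker_dim g fullv) capfv.
  by rewrite -dM addnC dim_quotm.
have dY : \dim (HomA M' Y) = \dim (HomA M Y).
  rewrite (Hom_factor_dim hg gf) => [|h hh v /eqP]; last first.
    by rewrite -memv_ker kerg; apply: killY.
  symmetry; apply: (Hom_factor_dim (qh l) (qf l)) => h hh v /eqP; rewrite quotm_eq0.
  exact: killY.
have qJ m : (q l.+1 m \in ('J_(X l.+1) : {vspace _})) -> m \in ('J_M : {vspace M}).
  rewrite -(Jpow_surj 1 (qh l.+1) (qf l.+1)) => /memv_imgP[u Ju eu].
  rewrite -(subrK u m) memvD //; apply: (subvP (Jpow_le (fullm M) (ltn0Sn l))).
  by apply/quotm_ker; rewrite linearB /=; apply/eqP; rewrite subr_eq0; apply/eqP.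
(* the projections onto the local summands give [t] classes modulo the radical *)
have lowM : (\dim (HomA M Y) + t <= \dim (HomA M (X l.+1)))%N.
  have /choice[lam lamP] j : exists f : 'Hom(X l.+1, K^o), f (q l.+1 (y j)) = 1 /\
      forall u, u \in ('J_(X l.+1) : {vspace _}) -> f u = 0.
    have [|f h1 h2] := @linear_form _ _ _ ('J_(X l.+1)) (q l.+1 (y j)).
      by apply/negP => /qJ; apply/negP.
    by exists f.
  have ll : linear (fun f : 'Hom(M, X l.+1) => \row_j (lam j (f (y j)) : K)).
    by move=> c f h; apply/rowP => i; rewrite !mxE add_lfunE scale_lfunE linearP.
  apply: leq_trans (Hom_rad_dim_le (L := mklin ll) _); last first.
    move=> f hf fJ; rewrite mklinE; apply/rowP => i; rewrite !mxE.
    by apply: (lamP i).2.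
  rewrite leq_add2l; suff -> : (mklin ll @: HomA M (X l.+1))%VS = fullv.
    by rewrite dimvf dim_matrix; apply: eq_leq; apply: esym (mul1n t).
  apply/vspaceP => r; rewrite memvf [r]row_sum_delta; apply: memv_suml => j _.
  rewrite memvZ //; apply/memv_imgP; exists (q l.+1 \o e j)%VF.
    by apply/mem_HomA/is_hom_comp.
  rewrite mklinE; apply/rowP => i; rewrite !mxE comp_lfunE ey eqxx /=.
  by have [->|_] := eqVneq i j; rewrite ?(lamP j).1 // !linear0.
have [L [L0 L1]] := frame_eval fz' (frame_quot (Jpow_le (fullm M) (ltn0Sn l)) fz).
have := leq_trans lowM (degeneration_Hom ha (X l.+1) dg).
move=> /leq_trans/(_ (Hom_rad_dim_ge L0)); rewrite dY leq_add2l => tL.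
have Lf : (L @: HomA M' (X l.+1))%VS = fullv.
  apply/eqP; rewrite eqEdim subvf dimvf dim_matrix (leq_trans _ tL) //.
  by apply: eq_leq; apply: mul1n.
have : const_mx 1 \in (L @: HomA M' (X l.+1))%VS by rewrite Lf memvf.
by move=> /memv_imgP[f /mem_HomA hf /esym /(L1 _ hf) ff]; exists f.
Qed.

End Rigid.

(** * Regular functions *)

Section Regular.
Context (K : fieldType) (n d : nat).
Implicit Types (x y : mpoint K n d) (S : mpoint K n d -> Prop).

(** Regularity on the principal open set where [delta] does not vanish. *)
Definition regular (delta f : mpoint K n d -> K) : Prop :=
  exists N p, polyfun p /\ forall y, delta y != 0 -> f y * delta y ^+ N = p y.

Variable delta : mpoint K n d -> K.
Hypothesis hdelta : polyfun delta.

Lemma polyfunX N : polyfun (fun y => delta y ^+ N).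
Proof.
elim: N => [|N IH]; first by apply: polyfun_ext (polyfun_const _ _ 1) => y; rewrite expr0.
by apply: polyfun_ext (polyfunM hdelta IH) => y; rewrite exprS.
Qed.

Lemma reg_ext f g : (forall y, delta y != 0 -> f y = g y) -> regular delta f -> regular delta g.
Proof. by move=> e [N [p [hp h]]]; exists N, p; split=> // y dy; rewrite -e ?h. Qed.

Lemma reg_poly f : polyfun f -> regular delta f.
Proof. by move=> hf; exists 0%N, f; split=> // y _; rewrite expr0 mulr1. Qed.

Lemma reg_const c : regular delta (fun=> c).
Proof. exact/reg_poly/polyfun_const. Qed.

Lemma regD f g : regular delta f -> regular delta g -> regular delta (fun y => f y + g y).
Proof.
move=> [N [p [hp h]]] [M [q [hq k]]]; exists (N + M)%N.
exists (fun y => p y * delta y ^+ M + q y * delta y ^+ N); split.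
  by apply: polyfunD; apply: polyfunM => //; apply: polyfunX.
move=> y dy; rewrite -h // -k // mulrDl exprD mulrA; congr (_ + _).
by rewrite [delta y ^+ N * _]mulrC mulrA.
Qed.

Lemma regM f g : regular delta f -> regular delta g -> regular delta (fun y => f y * g y).
Proof.
move=> [N [p [hp h]]] [M [q [hq k]]]; exists (N + M)%N, (fun y => p y * q y).
split=> [|y dy]; first exact: polyfunM.
by rewrite -h // -k // exprD mulrACA.
Qed.

Lemma regB f g : regular delta f -> regular delta g -> regular delta (fun y => f y - g y).
Proof.
move=> hf hg; apply: (@reg_ext (fun y => f y + (-1) * g y)).
  by move=> y _; rewrite mulN1r.
by apply: regD => //; apply: regM => //; apply: reg_const.
Qed.

Lemma reg_div p : polyfun p -> regular delta (fun y => p y / delta y).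
Proof.
by move=> hp; exists 1%N, p; split=> // y dy; rewrite expr1 divfK.
Qed.

(** A regular function vanishing on the part of [S] inside [D(delta)] vanishes at
    the points of the closure inside [D(delta)]: clear denominators. *)
Lemma reg_closure S x f : zariski_closure S x -> delta x != 0 -> regular delta f ->
  (forall y, S y -> delta y != 0 -> f y = 0) -> f x = 0.
Proof.
move=> /closureP cl dx [N [p [hp h]]] f0.
have : delta x * p x = 0.
  apply: (cl (fun y => delta y * p y)); first exact: polyfunM.
  move=> y Sy; have [->|dy] := eqVneq (delta y) 0; first by rewrite mul0r.
  by rewrite -h // f0 // mul0r mulr0.
move=> /eqP; rewrite mulf_eq0 (negPf dx) -h // mulf_eq0 expf_eq0 (negPf dx) andbF orbF.
by move/eqP.
Qed.

Lemma reg_meval N (p : {mpoly K[N]}) (c : 'I_N -> mpoint K n d -> K) :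
  (forall k, regular delta (c k)) -> regular delta (fun y => p.@[fun k => c k y]).
Proof.
move=> hc; apply: (meval_closed (P := regular delta)) => //.
- exact: reg_const.
- exact: regD.
exact: regM.
Qed.

End Regular.

(** * Charts *)

(** Fix elements [w k] of the algebra and generators number [j k]: a module with
    generators [z] for which the [w k *: z (j k)] form a basis is described by the
    coordinates [pi i b k] of the products [b *: z i] in that basis. *)
Section Charts.
Context (K : fieldType) (A : falgType K) (n : nat) (a : 'I_n -> A).
Context (t d : nat) (w : 'I_d -> A) (j : 'I_d -> 'I_t).
Implicit Types (M N X : fdmod A) (pi : 'I_t -> A -> 'I_d -> K).

Definition basis_fun M (z : 'I_t -> M) (v : 'cV[K]_d) : M :=
  \sum_k v k 0 *: act M (w k) (z (j k)).
Lemma basis_fun_linear M (z : 'I_t -> M) : linear (basis_fun z).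
Proof.
move=> c u v; rewrite /basis_fun scaler_sumr -big_split /=; apply: eq_bigr => k _.
by rewrite !mxE scalerDl scalerA.
Qed.
Definition basis_map M (z : 'I_t -> M) : 'Hom('cV[K]_d, M) := mklin (basis_fun_linear z).

Lemma basis_mapE M (z : 'I_t -> M) v :
  basis_map z v = \sum_k v k 0 *: act M (w k) (z (j k)).
Proof. exact: mklinE. Qed.

Record chart M (z : 'I_t -> M) pi : Prop := Chart {
  chart_inj : lker (basis_map z) = 0%VS;
  chart_full : limg (basis_map z) = fullv;
  chart_act : forall i b, act M b (z i) = \sum_k pi i b k *: act M (w k) (z (j k)) }.

Lemma chart_uniq M (z : 'I_t -> M) pi (c c' : 'I_d -> K) : chart z pi ->
  \sum_k c k *: act M (w k) (z (j k)) = \sum_k c' k *: act M (w k) (z (j k)) -> c =1 c'.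
Proof.
move=> [/lker0_inj inj _ _] e k.
have /inj/colP/(_ k) : basis_map z (\col_k c k) = basis_map z (\col_k c' k).
  rewrite !basis_mapE; under eq_bigr do rewrite mxE; rewrite e.
  by under [RHS]eq_bigr do rewrite mxE.
by rewrite !mxE.
Qed.

Lemma chart_hom M N (f : 'Hom(M, N)) (z : 'I_t -> M) pi : is_hom f ->
  lker f = 0%VS -> limg f = fullv -> chart z pi -> chart (fun i => f (z i)) pi.
Proof.
move=> /homE hf /lker0_inj f0 /limg_fullP ff [/lker0_inj inj /limg_fullP full ac].
have E v : basis_map (fun i => f (z i)) v = f (basis_map z v).
  by rewrite !basis_mapE linear_sum; apply: eq_bigr => k _; rewrite linearZ /= hf.
split.
- by apply/lker0_inj => u v; rewrite !E => /f0/inj.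
- apply/limg_fullP => m; have [m' <-] := ff m; have [v <-] := full m'.
  by exists v.
move=> i b; rewrite -hf ac linear_sum; apply: eq_bigr => k _.
by rewrite linearZ /= hf.
Qed.

(** Rescaling the generators acts on charts through the torus. *)
Lemma chart_scale M (z : 'I_t -> M) pi (th : 'I_t -> K) : (forall i, th i != 0) ->
  chart z pi -> chart (fun i => th i *: z i) (fun i b k => th i / th (j k) * pi i b k).
Proof.
move=> th0 [/lker0_inj inj /limg_fullP full ac].
have E v : basis_map (fun i => th i *: z i) v = basis_map z (\col_k (th (j k) * v k 0)).
  rewrite !basis_mapE; apply: eq_bigr => k _.
  by rewrite linearZ /= scalerA mxE mulrC.
split.
- apply/lker0_inj => u v; rewrite !E => /inj/colP e; apply/colP => k.
  by have := e k; rewrite !mxE => /(mulfI (th0 _)).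
- apply/limg_fullP => m; have [v <-] := full m; exists (\col_k ((th (j k))^-1 * v k 0)).
  by rewrite E; congr (basis_map z _); apply/colP => k; rewrite !mxE mulVKf.
move=> i b; rewrite linearZ /= ac scaler_sumr; apply: eq_bigr => k _.
by rewrite [act M (w k) (th _ *: _)]linearZ /= !scalerA mulrAC divfK.
Qed.

(** The matrices of the generators of the algebra in the basis of the chart. *)
Definition chart_point pi : mpoint K n d :=
  [ffun m => \matrix_(k', k) pi (j k) (a m * w k) k'].

Lemma chart_represents M (z : 'I_t -> M) pi : chart z pi -> represents a (chart_point pi) M.
Proof.
move=> [inj full ac]; apply/representsP; exists (basis_map z); split=> // m v.
rewrite !basis_mapE linear_sum /=.
under [RHS]eq_bigr => k _ do rewrite linearZ /= -actME ac scaler_sumr.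
rewrite exchange_big /=; apply: eq_bigr => k' _; rewrite mxE scaler_suml.
by apply: eq_bigr => k _; rewrite ffunE mxE scalerA mulrC.
Qed.

Lemma chart_dim M (z : 'I_t -> M) pi : chart z pi -> d = dim M.
Proof. by move/chart_represents/represents_dim. Qed.

Lemma eq_chart M (z : 'I_t -> M) pi pi' : (forall i b k, pi i b k = pi' i b k) ->
  chart z pi -> chart z pi'.
Proof.
move=> e [inj full ac]; split=> // i b; rewrite ac; apply: eq_bigr => k _.
by rewrite e.
Qed.

Hypothesis ha : generates a.

Lemma chart_miso M N (z : 'I_t -> M) (z' : 'I_t -> N) pi :
  chart z pi -> chart z' pi -> miso M N.
Proof.
by move=> /chart_represents h /chart_represents; apply: represents_uniq.
Qed.

End Charts.

Section UniversalChart.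
Import VectorInternalTheory.
Context (K : fieldType) (Q : quiver) (A : falgType K) (pres : presentation Q A).
Context (n : nat) (a : 'I_n -> A) (ha : generates a).
Implicit Types M N X Y : fdmod A.

Lemma span_basis (V : vectType K) (I : finType) (F : I -> V) d :
  (forall v, exists c : I -> K, v = \sum_i c i *: F i) -> d = dim V ->
  exists g : 'I_d -> I, forall c : 'I_d -> K, \sum_k c k *: F (g k) = 0 -> forall k, c k = 0.
Proof.
move=> sp ->.
pose B : 'M[K]_(#|I|, dim V) := \matrix_k v2r (F (enum_val k)).
have full : row_full B.
  rewrite -sub1mx; apply/row_subP => r; rewrite row1.
  have [c hc] := sp (r2v (delta_mx 0 r)).
  rewrite -[delta_mx 0 r]r2vK hc linear_sum /=.
  apply: summx_sub => i _; rewrite linearZ scalemx_sub //=.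
  by rewrite -[i in F i]enum_rankK (_ : v2r _ = row (enum_rank i) B) ?row_sub // rowK enum_rankK.
exists (fun k => enum_val (fullrankfun full k)) => c e k.
have : (\row_k c k) *m rowsub (fullrankfun full) B = 0.
  rewrite mulmx_sum_row; apply: (can_inj (@r2vK _ V)); rewrite linear0 -[RHS]e linear_sum.
  apply: eq_bigr => i _; rewrite linearZ mxE row_rowsub rowK /=.
  by rewrite v2rK.
move=> /(congr1 (mulmx^~ (invmx (rowsub (fullrankfun full) B)))).
rewrite mulmxK ?fullrowsub_unit // mul0mx => /rowP/(_ k).
by rewrite !mxE.
Qed.

Lemma inj_unitmx d (m : 'M[K]_d) : (forall v : 'cV_d, m *m v = 0 -> v = 0) -> m \in unitmx.
Proof.
move=> h; have k0 : lker (mulv m) = 0%VS.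
  apply/eqP; rewrite -subv0; apply/subvP => v; rewrite memv_ker memv0 mulvE.
  by move=> /eqP/h/eqP.
have e : m *m colmx (mulv m)^-1%VF = 1%:M.
  apply: colmx_inj => v; rewrite mul1mx -mulmxA colmxE -mulvE.
  by rewrite limg_lfunVK // (inj_surj k0) ?memvf.
by have [] := mulmx1_unit e.
Qed.

Lemma frame_basis t M vx (z : 'I_t -> M) d : frame pres vx z -> d = dim M ->
  exists (w : 'I_d -> A) (j : 'I_d -> 'I_t), lker (basis_map w j z) = 0%VS.
Proof.
move=> fr dM; pose b := vbasis {:A}.
pose F (r : 'I_(\dim {:A}) * 'I_t) := act M b`_r.1 (z r.2).
have [|g hg] := @span_basis M _ F d _ dM.
  move=> m; have [c ->] := frame_span_act fr m.
  exists (fun r => coord b r.1 (c r.2)).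
  rewrite -(pair_bigA _ (fun k i => coord b k (c i) *: F (k, i))) exchange_big /=.
  apply: eq_bigr => i _; rewrite {1}(coord_vbasis (memvf (c i))) act_sumE.
  by apply: eq_bigr => k _; rewrite actZE.
exists (fun k => b`_(g k).1), (fun k => (g k).2).
apply/eqP; rewrite -subv0; apply/subvP => v; rewrite memv_ker memv0 basis_mapE => /eqP e.
by apply/eqP/colP => k; rewrite mxE; apply: (hg (fun k => v k 0)).
Qed.

(** Around a point of the module variety, generators and the chart they define can
    be chosen to depend regularly on the point: move the generators [z'] of [M'] as
    constant vectors and project them to their vertices. *)
Lemma universal_chart t M' vx (z' : 'I_t -> M') d (x' : mpoint K n d) :
  frame pres vx z' -> represents a x' M' ->
  exists (w : 'I_d -> A) (j : 'I_d -> 'I_t) (delta : mpoint K n d -> K)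
    (pi : mpoint K n d -> 'I_t -> A -> 'I_d -> K),
  [/\ polyfun delta, delta x' != 0,
      forall i b k, regular delta (fun y => pi y i b k) &
      forall y N, represents a y N -> delta y != 0 ->
      exists2 z : 'I_t -> N, (forall i, act N (eps pres (vx i)) (z i) = z i) &
        chart w j z (pi y)].
Proof.
move=> fr rx'; have dM := represents_dim rx'.
have [w [j inj]] := frame_basis fr dM.
have /choice[X XP] b := evalmx_ex ha d b.
have Xpoly b := (XP b).1; have XE b := (XP b).2.
have /representsP[f' [f'0 f'f hf']] := rx'.
pose z0 i : 'cV[K]_d := (f'^-1)%VF (z' i).
have f'z i : f' (z0 i) = z' i by rewrite limg_lfunVK // f'f memvf.
pose zeta i y := X (eps pres (vx i)) y *m z0 i.
have zpoly i : polymx (zeta i) by apply: polymx_mul => //; apply: polymx_const.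
(* the columns are the coordinates of the vectors [w k *: z (j k)] *)
pose W y : 'M[K]_d := \matrix_(p, k) (X (w k) y *m zeta (j k) y) p 0.
have Wpoly : polymx W.
  move=> p k; apply: (@polyfun_ext _ _ _ (fun y => (X (w k) y *m zeta (j k) y) p 0)).
    by move=> y; rewrite [RHS]mxE.
  exact: polymx_mul.
have basisE y N (f : 'Hom('cV[K]_d, N)) v : intertwines a y f ->
    f (W y *m v) = basis_map w j (fun i => f (zeta i y)) v.
  move=> hf; rewrite basis_mapE.
  have -> : W y *m v = \sum_k v k 0 *: (X (w k) y *m zeta (j k) y).
    apply/colP => p; rewrite mxE summxE; apply: eq_bigr => k _.
    by rewrite !mxE mulrC.
  by rewrite linear_sum; apply: eq_bigr => k _; rewrite linearZ /= (XE _ _ _ _ hf).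
exists w, j, (fun y => \det (W y)), (fun y i b k => (invmx (W y) *m (X b y *m zeta i y)) k 0).
split.
- exact: polyfun_det.
- have : W x' \in unitmx.
    apply: inj_unitmx => v Wv; have /lker0_inj := inj; apply.
    rewrite linear0; have := basisE x' M' f' v hf'; rewrite Wv linear0 => ->.
    rewrite !basis_mapE; apply: eq_bigr => k _; congr (_ *: act _ _ _).
    by rewrite /zeta (XE _ _ _ _ hf') f'z (frame_eps fr).
  by rewrite unitmxE unitfE.
- move=> i b k.
  apply: (@reg_ext _ _ _ _ (fun y => (\adj (W y) *m (X b y *m zeta i y)) k 0 / \det (W y))).
    move=> y dy; rewrite /invmx unitmxE unitfE dy -scalemxAl [RHS]mxE.
    by rewrite mulrC.
  apply: reg_div.
  by apply: polymx_mul; [apply: polymx_adj | apply: polymx_mul].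
move=> y N /representsP[f [f0 ff hf]] dy.
have Wu : W y \in unitmx by rewrite unitmxE unitfE.
have /lker0_inj fi := f0.
exists (fun i => f (zeta i y)).
  by move=> i; rewrite /zeta (XE _ _ _ _ hf) epsK eqxx.
split.
- apply/lker0_inj => u v; rewrite -!basisE // => /fi/(congr1 (mulmx (invmx (W y)))).
  by rewrite !mulKmx.
- apply/limg_fullP => m; have /limg_fullP/(_ m)[v <-] := ff.
  by exists (invmx (W y) *m v); rewrite -basisE // mulKVmx.
move=> i b; have := basisE y N f (invmx (W y) *m (X b y *m zeta i y)) hf.
by rewrite basis_mapE mulKVmx // (XE _ _ _ _ hf).
Qed.

End UniversalChart.

(** * Modules with vanishing [frak_m] *)

Section FreeModule.
Context (K : fieldType) (A : falgType K) (t : nat).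

Definition free_fun (b : A) (f : {ffun 'I_t -> A}) : {ffun 'I_t -> A} := [ffun i => b * f i].
Lemma free_fun_linear b : linear (free_fun b).
Proof. by move=> c f g; apply/ffunP => i; rewrite !ffunE mulrDr scalerAr. Qed.
Definition free_act b : 'End({ffun 'I_t -> A}) := mklin (free_fun_linear b).

Lemma free_act_linear : linear free_act.
Proof.
move=> c a b; apply/lfunP => f; rewrite add_lfunE scale_lfunE !mklinE.
by apply/ffunP => i; rewrite !ffunE mulrDl scalerAl.
Qed.
Lemma free_act1 : free_act 1 = \1%VF.
Proof. by apply/lfunP => f; rewrite id_lfunE mklinE; apply/ffunP => i; rewrite ffunE mul1r. Qed.
Lemma free_actM a b : free_act (a * b) = (free_act a \o free_act b)%VF.
Proof.
apply/lfunP => f; rewrite comp_lfunE !mklinE; apply/ffunP => i.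
by rewrite !ffunE mulrA.
Qed.

Definition free_mod : fdmod A := FdMod free_act_linear free_act1 free_actM.

Lemma free_actE b (f : free_mod) i : act free_mod b f i = b * f i.
Proof. by rewrite /= mklinE ffunE. Qed.

Definition free_map_fun (X : fdmod A) (x : 'I_t -> X) (f : {ffun 'I_t -> A}) : X :=
  \sum_i act X (f i) (x i).
Lemma free_map_linear (X : fdmod A) (x : 'I_t -> X) : linear (free_map_fun x).
Proof.
move=> c f g; rewrite /free_map_fun scaler_sumr -big_split /=; apply: eq_bigr => i _.
by rewrite !ffunE actDE actZE.
Qed.
Definition free_map (X : fdmod A) (x : 'I_t -> X) : 'Hom(free_mod, X) := mklin (free_map_linear x).

Lemma free_mapE (X : fdmod A) (x : 'I_t -> X) f : free_map x f = \sum_i act X (f i) (x i).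
Proof. exact: mklinE. Qed.

Lemma free_map_hom (X : fdmod A) (x : 'I_t -> X) : is_hom (free_map x).
Proof.
apply/homE => b f; rewrite !free_mapE linear_sum; apply: eq_bigr => i _ /=.
by rewrite free_actE actME.
Qed.

End FreeModule.

Section ProjectiveCover.
Context (K : fieldType) (Q : quiver) (A : falgType K) (pres : presentation Q A).
Implicit Types M N X Y P : fdmod A.
Notation "''J_' M" := (Jmul (fullm M)) (at level 8, M at level 2, format "''J_' M").
Local Notation ep := (eps pres).

(** Families of possible images of generators at the vertices [vx i]; these are the
    homomorphisms out of the projective module with one generator at each of them. *)
Definition at_verts t (vx : 'I_t -> vertex Q) X : {vspace {ffun 'I_t -> X}} :=
  subspace_of (fun x : {ffun 'I_t -> X} => forall i, act X (ep (vx i)) (x i) = x i).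

Lemma mem_at_verts t (vx : 'I_t -> vertex Q) X (x : {ffun 'I_t -> X}) :
  x \in at_verts vx X <-> forall i, act X (ep (vx i)) (x i) = x i.
Proof.
apply: (@subspace_ofP _ _ (fun x : {ffun 'I_t -> X} => forall i, act X (ep (vx i)) (x i) = x i)).
  by move=> i; rewrite ffunE linear0.
by move=> c u v hu hv i; rewrite !ffunE linearP /= hu hv.
Qed.

(** A homomorphism is determined by the images of the generators. *)
Lemma frame_Hom_img t M X vx (z : 'I_t -> M) : frame pres vx z ->
  exists2 ev : 'Hom('Hom(M, X), {ffun 'I_t -> X}),
    (forall f i, ev f i = f (z i)) &
    (ev @: HomA M X <= at_verts vx X)%VS /\ \dim (ev @: HomA M X) = \dim (HomA M X).
Proof.
move=> fr.
have ll : linear (fun f : 'Hom(M, X) => [ffun i => f (z i)] : {ffun 'I_t -> X}).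
  by move=> c f g; apply/ffunP => i; rewrite !ffunE add_lfunE scale_lfunE.
exists (mklin ll) => [f i|]; first by rewrite mklinE ffunE.
split.
  apply/subvP => _ /memv_imgP[f /mem_HomA/homE hf ->]; apply/mem_at_verts => i.
  by rewrite mklinE ffunE -hf (frame_eps fr).
apply: limg_dim_eq; apply/eqP; rewrite -subv0; apply/subvP => f.
rewrite memv_cap memv_ker memv0 mklinE => /andP[/mem_HomA hf /eqP f0].
apply/eqP/(frame_hom_eq fr hf); first by apply/homE => b v; rewrite !zero_lfunE linear0.
by move=> i; rewrite zero_lfunE; have /ffunP/(_ i) := f0; rewrite !ffunE.
Qed.

(** The free module on lifts [zP] of the generators maps onto [P], and this map
    splits. Since the splitting fixes the images of the generators in the top of
    [M], its matrix is the identity modulo the radical. Hence a family [x] that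
    gives the zero map lies in [J ^ l X] for all [l]. *)
Lemma cover_Hom_dim t M P X vx (z : 'I_t -> M) : frame pres vx z ->
  projective_cover P (top M) -> (\dim (at_verts vx X) <= \dim (HomA P X))%N.
Proof.
move=> fr [projP [p [hp pf pess]]].
have hpE := (homE p).1 hp.
pose sz i : top M := quotm_map ('J_M) (z i).
have szE i : act (top M) (ep (vx i)) (sz i) = sz i by rewrite -quotm_hom (frame_eps fr).
have /choice[zP0 zP0P] i := (limg_fullP p).1 pf (sz i).
pose zP i := act P (ep (vx i)) (zP0 i).
have zPE i : act P (ep (vx i)) (zP i) = zP i by rewrite epsK eqxx.
have pz i : p (zP i) = sz i by rewrite hpE zP0P szE.
have gf : limg (free_map zP) = fullv.
  apply: (pess (imm (free_map_hom zP) (fullm _))).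
  apply/vspaceP => y; rewrite memvf.
  have [m hm] := quotm_surj (p y); have [c hc] := frame_span fr m.
  have -> : y = \sum_i c i *: zP i + (y - \sum_i c i *: zP i) by rewrite addrC subrK.
  apply: memv_add.
    apply/memv_imgP; exists [ffun i => c i *: 1]; first exact: memvf.
    by rewrite free_mapE; apply: eq_bigr => i _; rewrite ffunE actZE act1E.
  rewrite memv_ker linearB /= -hm linear_sum; apply/eqP.
  move/quotm_ker: hc; rewrite linearB linear_sum /= => /eqP; rewrite subr_eq0 => /eqP->.
  by rewrite -sumrB big1 // => i _; rewrite linearZ [p _]linearZ /= pz subrr.
have [sg hsg sgK] := projP _ _ _ _ (free_map_hom zP) gf (is_hom_id P).
have sgE := (homE sg).1 hsg.
pose s i k : A := sg (zP i) k.
have szP i : \sum_k act P (s i k) (zP k) = zP i.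
  by rewrite -free_mapE -comp_lfunE sgK id_lfunE.
have /choice[c cP] (ik : 'I_t * 'I_t) := eps_act_J pres (s ik.1 ik.2) (vx ik.2).
have c1 i k : c (i, k) = (i == k)%:R.
  apply/eqP; rewrite eq_sym -subr_eq0; apply/eqP.
  apply: (frame_free fr (c := fun k => (i == k)%:R - c (i, k))).
  apply/quotm_ker; rewrite linear_sum /=.
  transitivity (sz i - p (\sum_k act P (s i k) (zP k))); last by rewrite szP pz subrr.
  rewrite linear_sum -[sz i](_ : \sum_k (i == k)%:R *: sz k = _); last first.
    rewrite (bigD1 i) //= eqxx scale1r big1 ?addr0 // => l li.
    by rewrite eq_sym (negbTE li) scale0r.
  rewrite -sumrB; apply: eq_bigr => l _; rewrite linearZ /= scalerBl; congr (_ - _).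
  rewrite hpE pz; apply/eqP; rewrite eq_sym -subr_eq0 -memv0.
  have <- : Jmul (fullm (top M)) = 0%VS :> {vspace _}.
    apply/eqP; rewrite -subv0; apply: Jmul_le => x m Jx _.
    by rewrite (top_ssimple _ Jx) mem0v.
  by apply: (cP (i, l) (top M) (fullm (top M)) (sz l)) => //; apply: memvf.
pose hx (x : {ffun 'I_t -> X}) : 'Hom(P, X) := (free_map x \o sg)%VF.
have hl : linear hx.
  move=> k x y; rewrite /hx comp_lfunZl -comp_lfunDl; congr (_ \o _)%VF.
  apply/lfunP => f; rewrite add_lfunE scale_lfunE !free_mapE scaler_sumr -big_split /=.
  by apply: eq_bigr => i _; rewrite !ffunE linearP.
apply: (@inj_dim_le _ _ _ (mklin hl)) => x; rewrite mklinE.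
  by move=> _; apply/mem_HomA; apply: is_hom_comp => //; apply: free_map_hom.
move=> /mem_at_verts xE h0.
have sx i : \sum_k act X (s i k) (x k) = 0.
  by rewrite -(free_mapE x) -comp_lfunE -/(hx x) h0 zero_lfunE.
have [m hm] := Jpow_nil pres.
suff Jx l i : x i \in (Jpow l (fullm X) : {vspace X}).
  by apply/ffunP => i; rewrite ffunE; apply/eqP; rewrite -memv0 -(hm X m (leqnn m)).
elim: l i => [|l IH] i; first exact: memvf.
have -> : x i = - \sum_k (act X (s i k) (x k) - c (i, k) *: x k).
  rewrite sumrB sx sub0r opprK (bigD1 i) //= c1 eqxx scale1r big1 ?addr0 // => k ki.
  by rewrite c1 eq_sym (negbTE ki) scale0r.
by rewrite memvN; apply: memv_suml => k _; apply: (cP (i, k)).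
Qed.

(** Homomorphisms from [M] to its radical embed, by evaluation at the generators,
    into the families of vectors of the radical at the right vertices; this space is
    no larger than [Hom(P, J M)]. When [frak_m] vanishes the embedding is onto by
    dimension. *)
Lemma frak_m0_hom t M P vx (z : 'I_t -> M) : frame pres vx z ->
  projective_cover P (top M) -> frak_m P M = 0 ->
  forall y : 'I_t -> M, (forall i, act M (ep (vx i)) (y i) = y i) ->
    (forall i, y i \in ('J_M : {vspace M})) ->
  exists2 h : 'Hom(M, M), is_hom h & forall i, h (z i) = y i.
Proof.
move=> fr cov /eqP; rewrite subr_eq0 => /eqP[dm] y yE yJ.
have [ev evE [evs evd]] := frame_Hom_img (Defs.rad M) fr.
have eqv : (ev @: HomA M (Defs.rad M))%VS = at_verts vx (Defs.rad M).
  by apply/eqP; rewrite eqEdim evs evd -dm (cover_Hom_dim _ fr cov).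
have : [ffun i => vsproj ('J_M) (y i)] \in at_verts vx (Defs.rad M).
  apply/mem_at_verts => i; apply: subvs_inj; rewrite sub_actE !ffunE.
  by rewrite vsprojK // yE.
rewrite -eqv => /memv_imgP[f /mem_HomA hf e].
exists (incl ('J_M) \o f)%VF; first by apply: is_hom_comp => //; apply: incl_hom.
move=> i; have := evE f i; rewrite -e ffunE => fz.
by rewrite comp_lfunE inclE -fz vsprojK.
Qed.

End ProjectiveCover.

(** * Layer-stable degenerations when [frak_m] vanishes *)

Section Curves.
Context (K : closedFieldType) (n d : nat).

(** If [p] is nonzero, then [X * p + 1] has a root, which is neither zero nor a root
    of [p]. *)
Lemma poly_punctured (p : {poly K}) : (forall c, c != 0 -> p.[c] = 0) -> p = 0.
Proof.
move=> h; apply/eqP; apply: contraT => p0.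
have /closed_rootP[c] : size ('X * p + 1) != 1%N.
  have sz : size ('X * p) = (size p).+1 by rewrite mulrC size_mulX.
  by rewrite size_polyDl sz ?size_poly1 ?eqSS ?ltnS ?lt0n size_poly_eq0.
move=> /poly.rootP; rewrite !(hornerD, hornerM, hornerX, hornerC) => e; have [c0|/h pc] := eqVneq c 0.
  by move: e; rewrite c0 mul0r add0r => /eqP; rewrite oner_eq0.
by move: e; rewrite pc mulr0 add0r => /eqP; rewrite oner_eq0.
Qed.

Lemma line_closure (S : mpoint K n d -> Prop) (x0 x1 : mpoint K n d) :
  (forall c, c != 0 -> S [ffun i => x0 i + c *: x1 i]) -> zariski_closure S x0.
Proof.
move=> h; apply/closureP => f [p hp] f0.
pose P (g : K -> K) := exists q : {poly K}, forall c, g c = q.[c].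
have : P (fun c => p.@[fun k => coordinates x0 k + c * coordinates x1 k]).
  apply: (@meval_closed K K P _ p (fun k c => coordinates x0 k + c * coordinates x1 k)).
  - by move=> k; exists k%:P => c; rewrite hornerC.
  - by move=> g g' [q hq] [q' hq']; exists (q + q') => c; rewrite hornerD hq hq'.
  - by move=> g g' [q hq] [q' hq']; exists (q * q') => c; rewrite hornerM hq hq'.
  by move=> k; exists ((coordinates x0 k)%:P + 'X * (coordinates x1 k)%:P) => c; rewrite !(hornerD, hornerM, hornerX, hornerC).
move=> [q hq].
have q0 : q = 0.
  apply: poly_punctured => c c0; rewrite -hq -(f0 _ (h c c0)) hp; apply: meval_eq => k.
  by rewrite /coordinates; case: (enum_val k) => [[i r] s]; rewrite ffunE !mxE.
rewrite hp; have := hq 0; rewrite q0 horner0 => <-; apply: meval_eq => k.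
by rewrite mul0r addr0.
Qed.

End Curves.

Section Torus.
Context (K : fieldType) (Q : quiver) (A : falgType K) (pres : presentation Q A).
Implicit Types M N X Y P : fdmod A.
Notation "''J_' M" := (Jmul (fullm M)) (at level 8, M at level 2, format "''J_' M").
Local Notation ep := (eps pres).

Context (t d : nat) (w : 'I_d -> A) (j : 'I_d -> 'I_t) (vx : 'I_t -> vertex Q).

(** Generators at the vertices [vx i] differ from a frame by nonzero scalars, modulo
    the radical. *)
Lemma gens_frame M (z0 z : 'I_t -> M) : frame pres vx z0 ->
  (forall i, act M (ep (vx i)) (z i) = z i) -> limg (basis_map w j z) = fullv ->
  frame pres vx z.
Proof.
move=> fr ez /limg_fullP full.
have /choice[c cP] i : exists c, z i - c *: z0 i \in ('J_M : {vspace M}).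
  exact: (frame_at fr).
have span m : exists r : 'I_t -> K, m - \sum_i r i *: z i \in ('J_M : {vspace M}).
  have [v <-] := full m.
  have /choice[s sP] k : exists s, act M (w k) (z (j k)) - s *: z (j k) \in ('J_M : {vspace M}).
    by have [s hs] := eps_act_J pres (w k) (vx (j k)); exists s; apply: hs; rewrite ?memvf.
  exists (fun i => \sum_(k | j k == i) v k 0 * s k).
  have -> : \sum_i (\sum_(k | j k == i) v k 0 * s k) *: z i = \sum_k v k 0 *: (s k *: z (j k)).
    rewrite [RHS](partition_big j predT) //=; apply: eq_bigr => i _; rewrite scaler_suml.
    by apply: eq_bigr => k /eqP->; rewrite scalerA.
  rewrite basis_mapE -sumrB; apply: memv_suml => k _.
  by rewrite -scalerBr memvZ.
have sumJ (r : 'I_t -> K) : \sum_i r i *: z i - \sum_i (r i * c i) *: z0 i \in ('J_M : {vspace M}).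
  rewrite -sumrB; apply: memv_suml => i _.
  by rewrite -scalerA -scalerBr memvZ.
have c0 i : c i != 0.
  apply/eqP => ci; have [r hr] := span (z0 i).
  have := memvD hr (sumJ r); rewrite addrA subrK => h.
  have := @frame_free _ _ _ _ _ _ _ _ fr (fun k => (k == i)%:R - r k * c k) _ i.
  rewrite eqxx ci mulr0 subr0.
  suff -> : \sum_k ((k == i)%:R - r k * c k) *: z0 k = z0 i - \sum_k (r k * c k) *: z0 k.
    by move=> /(_ h)/eqP; rewrite oner_eq0.
  under eq_bigr do rewrite scalerBl.
  rewrite sumrB (bigD1 i) //= eqxx scale1r big1 ?addr0 // => k /negPf->.
  by rewrite scale0r.
split; [exact: frame_inj fr | exact: ez | exact: span |] => r hr i.
have /(frame_free fr)/(_ i)/eqP : \sum_i (r i * c i) *: z0 i \in ('J_M : {vspace M}).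
  by have := memvB hr (sumJ r); rewrite opprB addrC subrK.
by rewrite mulf_eq0 (negPf (c0 i)) orbF => /eqP.
Qed.

(** The conclusion of [frak_m0_hom]: translations of the generators by elements of
    the radical extend to endomorphisms. *)
Definition translatable M := forall z : 'I_t -> M, frame pres vx z ->
  forall y : 'I_t -> M, (forall i, act M (ep (vx i)) (y i) = y i) ->
    (forall i, y i \in ('J_M : {vspace M})) ->
  exists2 h : 'Hom(M, M), is_hom h & forall i, h (z i) = y i.

(** Modulo the radical, [z' i] is a multiple [th i] of [z i]. The remaining
    difference extends to an endomorphism [h] of [M], so [1 + h] maps [z i] to [(th
    i)^-1 *: z' i], and the charts agree up to the scaling. *)
Lemma chart_torus M (z0 z z' : 'I_t -> M) pi pi' : translatable M -> frame pres vx z0 ->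
  (forall i, act M (ep (vx i)) (z i) = z i) -> chart w j z pi ->
  (forall i, act M (ep (vx i)) (z' i) = z' i) -> chart w j z' pi' ->
  exists2 th : 'I_t -> K, forall i, th i != 0 &
    forall i b k, pi' i b k = th i / th (j k) * pi i b k.
Proof.
move=> tr fr0 ez ch ez' ch'.
have fr := gens_frame fr0 ez (chart_full ch).
have fr' := gens_frame fr0 ez' (chart_full ch').
have /choice[th thP] i : exists c, z' i - c *: z i \in ('J_M : {vspace M}).
  exact: (frame_at fr).
have th0 i : th i != 0.
  apply: contra (frame_notJ fr' i) => /eqP e.
  by have := thP i; rewrite e scale0r subr0.
exists th => // i b k.
have [|l|h hh hz] := tr z fr (fun i => (th i)^-1 *: (z' i - th i *: z i)).
- by move=> l; rewrite linearZ linearB linearZ /= ez ez'.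
- exact: memvZ.
have uz l : z l + h (z l) = (th l)^-1 *: z' l.
  by rewrite hz scalerBr scalerA mulVf // scale1r addrC subrK.
move/homE: hh => hh.
have ac c : act M c (z' i) = \sum_l (th i / th (j l) * pi i c l) *: act M (w l) (z' (j l)).
  have -> : act M c (z' i) = th i *: (act M c (z i) + h (act M c (z i))).
    by rewrite hh -linearD /= uz linearZ /= scalerA mulfV // scale1r.
  rewrite (chart_act ch) linear_sum -big_split scaler_sumr /=; apply: eq_bigr => l _.
  rewrite [h (_ *: _)]linearZ /= -scalerDr hh -linearD /= uz [act M (w l) _]linearZ /= !scalerA.
  by congr (_ *: _); rewrite mulrAC.
have e : \sum_l pi' i b l *: act M (w l) (z' (j l)) =
    \sum_l (th i / th (j l) * pi i b l) *: act M (w l) (z' (j l)).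
  by rewrite -(chart_act ch') ac.
exact: (chart_uniq ch' e k).
Qed.

End Torus.

Section SplitModule.
Context (K : fieldType) (Q : quiver) (A : falgType K) (pres : presentation Q A).
Implicit Types M N X Y P : fdmod A.
Local Notation ep := (eps pres).
Context (t d : nat) (w : 'I_d -> A) (j : 'I_d -> 'I_t) (vx : 'I_t -> vertex Q).
Context (M : fdmod A) (z : 'I_t -> M) (pi : 'I_t -> A -> 'I_d -> K).
Hypotheses (ez : forall i, act M (ep (vx i)) (z i) = z i) (ch : chart w j z pi).
Variable I : pred 'I_t.
Hypothesis closedI : forall i b k, i \in I -> pi i b k != 0 -> j k \in I.

(** The submodule generated by the [z i] with [i \in I], and the family of
    generators of [U (+) M/U] that it induces. *)

Definition part_vec (v : 'cV[K]_d) : 'cV[K]_d := \col_k (if j k \in I then v k 0 else 0).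

Definition part_space : {vspace M} := subspace_of (fun m =>
  exists2 v : 'cV[K]_d, (forall k, j k \notin I -> v k 0 = 0) & m = basis_map w j z v).

Lemma mem_part v : basis_map w j z v \in part_space <-> forall k, j k \notin I -> v k 0 = 0.
Proof.
have P m : m \in part_space <->
  exists2 v : 'cV[K]_d, (forall k, j k \notin I -> v k 0 = 0) & m = basis_map w j z v.
  apply: subspace_ofP => [|c m1 m2 [v1 h1 ->] [v2 h2 ->]].
    by exists 0; rewrite ?linear0 // => k _; rewrite mxE.
  by exists (c *: v1 + v2); rewrite ?linearP // => k hk; rewrite !mxE h1 // h2 // mulr0 addr0.
split=> [/P[u hu]|h]; last by apply/P; exists v.
by have /lker0_inj inj := chart_inj ch => /inj->.
Qed.

Lemma part_act i b : i \in I -> act M b (z i) \in part_space.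
Proof.
move=> Ii; rewrite (chart_act ch).
have := (mem_part (\col_k pi i b k)).2; rewrite basis_mapE.
under eq_bigr do rewrite mxE; apply=> k nI; rewrite mxE.
by apply/eqP; apply: contraNT nI; apply: closedI.
Qed.

Lemma part_stable b m : m \in part_space -> act M b m \in part_space.
Proof.
have /limg_fullP/(_ m)[v <-] := chart_full ch => /mem_part h.
rewrite basis_mapE linear_sum; apply: memv_suml => k _; rewrite linearZ /= -actME.
have [Ik|/h->] := boolP (j k \in I); last by rewrite scale0r mem0v.
by rewrite memvZ // part_act.
Qed.

Definition part_sub : submodule M := submod_of part_stable.

Definition split_gen i : dsum (subm part_sub) (quotm part_sub) :=
  if i \in I then (vsproj part_sub (z i), 0) else (0, quotm_map part_sub (z i)).

Lemma part_z i : i \in I -> z i \in part_space.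
Proof. by move=> Ii; rewrite -[z i]act1E part_act. Qed.

Lemma split_gen_act i b : act _ b (split_gen i) =
  if i \in I then (vsproj part_sub (act M b (z i)), 0)
  else (0, quotm_map part_sub (act M b (z i))).
Proof.
rewrite /split_gen; case: ifP => Ii; rewrite dsum_actE [_.1]/= [_.2]/= linear0; last first.
  by rewrite -quotm_hom.
congr (_, _); apply: subvs_inj.
by rewrite sub_actE !vsprojK ?part_act ?part_z.
Qed.

Lemma split_gen_eps i : act _ (ep (vx i)) (split_gen i) = split_gen i.
Proof. by rewrite split_gen_act ez. Qed.

Definition split_pi i b k := if (i \in I) == (j k \in I) then pi i b k else 0.

Lemma split_basis v : basis_map w j split_gen v =
  (vsproj part_sub (basis_map w j z (part_vec v)),
   quotm_map part_sub (basis_map w j z (v - part_vec v))).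
Proof.
rewrite !basis_mapE !linear_sum.
have -> (X Y : vectType K) (F : 'I_d -> X) (G : 'I_d -> Y) :
  (\sum_k F k, \sum_k G k) = \sum_k (F k, G k) :> (X * Y)%type.
  by apply: (big_ind3 (fun x y u => (x, y) = u)) => // x1 y1 u1 x2 y2 u2 <- <-.
apply: eq_bigr => k _; rewrite split_gen_act !linearZ /= !mxE.
case: ifP => Ik; apply/eqP; rewrite xpair_eqE /=.
  by rewrite subrr scale0r scaler0 !eqxx.
by rewrite subr0 scale0r scaler0 !eqxx.
Qed.

(** Passing to [U (+) M/U] keeps the coordinates within [I] and within its
    complement, and drops those that lead from the complement into [I]. *)
Lemma split_chart : chart w j split_gen split_pi.
Proof.
have dM := chart_dim (fun _ : 'I_0 => 0 : A) ch.
have inj : lker (basis_map w j split_gen) = 0%VS.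
  apply/eqP; rewrite -subv0; apply/subvP => v; rewrite memv_ker memv0 split_basis.
  rewrite xpair_eqE => /andP[/eqP e1 /eqP/quotm_ker/mem_part h2].
  have : basis_map w j z (part_vec v) = 0.
    rewrite -[LHS](@vsprojK _ _ part_sub) ?e1 ?linear0 //.
    by apply/mem_part => k /negPf nI; rewrite mxE nI.
  rewrite -(linear0 (basis_map w j z)); have /lker0_inj binj := chart_inj ch.
  move=> /binj/colP e; apply/eqP/colP => k; rewrite mxE.
  have := e k; rewrite !mxE; case: ifP => // /negbT nI _.
  by have := h2 k nI; rewrite !mxE (negPf nI) subr0.
split=> //.
  apply: inj_surj => //; rewrite dsum_dim dim_subm addnC dim_quotm dim_matrix -dM.
  exact: muln1.
move=> i b; have := split_basis (\col_k split_pi i b k); rewrite basis_mapE.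
under eq_bigr do rewrite mxE.
move=> ->; rewrite split_gen_act; case: ifP => Ii; congr (_, _).
- congr (vsproj _ _); rewrite (chart_act ch) basis_mapE; apply: eq_bigr => k _.
  rewrite !mxE /split_pi Ii; case: ifP => [-> //|/negbT/negPf nI].
  have [->|/(closedI Ii)] := eqVneq (pi i b k) 0; first by [].
  by rewrite nI.
- rewrite (_ : _ - _ = 0) ?linear0 //; apply/colP => k; rewrite !mxE /split_pi Ii.
  by case: ifP => e; rewrite ?subrr //; move: e; case: (j k \in I) => //=; rewrite subrr.
- rewrite (_ : part_vec _ = 0) ?linear0 //; apply/colP => k; rewrite !mxE /split_pi Ii.
  by case: (j k \in I).
apply/eqP; rewrite -subr_eq0 -linearB; apply/eqP/quotm_ker.
have -> : act M b (z i) = basis_map w j z (\col_k pi i b k).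
  by rewrite basis_mapE (chart_act ch); apply: eq_bigr => k _; rewrite mxE.
rewrite -linearB; apply/mem_part => k /negPf nI.
by rewrite !mxE /split_pi Ii nI /= subr0 subrr.
Qed.

End SplitModule.

Section Layers.
Context (K : fieldType) (Q : quiver) (A : falgType K) (pres : presentation Q A).
Implicit Types M N X Y : fdmod A.

Lemma fst_linear X Y : linear (fun u : dsum X Y => u.1 : X).
Proof. by []. Qed.
Definition fstm X Y : 'Hom(dsum X Y, X) := mklin (@fst_linear X Y).

Lemma fstm_hom X Y : is_hom (fstm X Y).
Proof. by apply/homE => b u; rewrite dsum_actE !mklinE. Qed.

Lemma dimv_at_dsum X Y l v :
  dimv_at pres v (Jpow l (fullm (dsum X Y))) =
  (dimv_at pres v (Jpow l (fullm X)) + dimv_at pres v (Jpow l (fullm Y)))%N.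
Proof.
rewrite -(dimv_at_hom pres _ v (fstm_hom X Y)) (Jpow_surj l (fstm_hom X Y)); last first.
  by apply/limg_fullP => x; exists (x, 0); rewrite mklinE.
rewrite addnC; congr (_ + _)%N.
rewrite -(@dimv_at_inj _ _ _ pres _ _ (inrm X Y) _ v (inrm_hom X Y)); last first.
  by apply/lker0_inj => u u'; rewrite !inrmE => -[].
congr (dimv_at pres v _); apply/vspaceP => -[x y]; rewrite memv_cap memv_ker mklinE /=.
rewrite Jpow_dsum /=; apply/andP/memv_imgP => [[/andP[_ Jy] /eqP->]|[y' Jy]].
  by exists y; rewrite ?inrmE.
by rewrite inrmE => -[-> ->]; rewrite mem0v Jy eqxx.
Qed.

(** Passing to [U (+) M/U] preserves the radical layers when [U] is layer-stably
    embedded. *)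
Lemma embedded_layers M (U : submodule M) : layer_stably_embedded U ->
  forall l v, dimv_at pres v (Jpow l (fullm M)) =
    dimv_at pres v (Jpow l (fullm (dsum (subm U) (quotm U)))).
Proof.
move=> emb l v; rewrite dimv_at_dsum.
have eU : Jpow l U = (Jpow l (fullm M) :&: U)%VS :> {vspace M}.
  by case: l => [|l]; rewrite ?capfv // emb.
rewrite -(dimv_at_quot pres U (Jpow l (fullm M)) v) -eU; congr (_ + _)%N.
  rewrite -(@dimv_at_inj _ _ _ pres _ _ (incl U) _ v (incl_hom U)) ?Jpow_incl //.
  by apply/lker0_inj; apply: incl_inj.
by rewrite (Jpow_surj l (quotm_map_hom U) (limg_quotm_map U)).
Qed.

(** The quotient part of [J ^ l (U (+) M/U)] is the image of [J ^ l M], so the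
    inequality compares [J ^ l M :&: U] with the smaller [J ^ l U]. *)
Lemma embedded_of_dim M (U : submodule M) :
  (forall l, (\dim (Jpow l (fullm M)) <= \dim (Jpow l (fullm (dsum (subm U) (quotm U)))))%N) ->
  layer_stably_embedded U.
Proof.
move=> h l _; apply/esym/eqP; rewrite eqEdim subv_cap; apply/andP; split.
  rewrite Jpow_mono ?subvf //; exact: (Jpow_le U (leq0n l)).
have := h l; rewrite [X in (_ <= X)%N](dimv_at_sum pres).
rewrite (eq_bigr _ (fun v _ => dimv_at_dsum _ _ l v)) big_split /= -!dimv_at_sum.
have -> : \dim (Jpow l (fullm (subm U))) = \dim (Jpow l U).
  rewrite -(Jpow_incl U) limg_dim_eq //.
  by have /lker0_inj -> := @incl_inj _ _ _ U; rewrite capv0.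
rewrite -(limg_ker_dim (quotm_map U) (Jpow l (fullm M))) lker_quotm_map.
by rewrite (Jpow_surj l (quotm_map_hom U) (limg_quotm_map U)) leq_add2r.
Qed.

End Layers.

Section Minimal.
Context (K : closedFieldType) (Q : quiver) (A : falgType K) (pres : presentation Q A).
Context (n : nat) (a : 'I_n -> A) (ha : generates a).
Implicit Types M N X Y : fdmod A.
Local Notation ep := (eps pres).

Lemma embedded_layer_stable M (U : submodule M) : layer_stably_embedded U ->
  degeneration a M (dsum (subm U) (quotm U)) ->
  layer_stable_degeneration a M (dsum (subm U) (quotm U)).
Proof.
by move=> emb dg; split=> //; apply: (layers_miso (pres := pres)); apply: embedded_layers.
Qed.

Context (t d : nat) (w : 'I_d -> A) (j : 'I_d -> 'I_t).

Lemma chart_point_orbit M (z : 'I_t -> M) pi pi' (th : 'I_t -> K) :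
  chart w j z pi -> (forall i, th i != 0) ->
  (forall i b k, pi' i b k = th i / th (j k) * pi i b k) ->
  Defs.orbit (chart_point a w j pi) (chart_point a w j pi').
Proof.
move=> ch th0 e; apply: (@orbit_represents _ _ _ a _ _ _ M).
  exact: chart_represents ch.
apply: (@chart_represents _ _ _ _ _ _ _ _ _ (fun i => th i *: z i)).
by apply: eq_chart (chart_scale th0 ch) => i b k; rewrite e.
Qed.

(** Scaling the generators outside [I] by [c] multiplies the coordinates that lead
    from the complement into [I] by [c] and fixes the others; let [c] tend to zero. *)
Lemma split_degeneration M (z : 'I_t -> M) pi (ch : chart w j z pi) (I : pred 'I_t)
    (cI : forall i b k, i \in I -> pi i b k != 0 -> j k \in I) :
  degeneration a M (dsum (subm (part_sub ch cI)) (quotm (part_sub ch cI))).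
Proof.
exists d, (chart_point a w j pi), (chart_point a w j (split_pi j pi I)).
split; [exact: chart_represents ch | exact: (chart_represents _ (split_chart ch cI)) |].
apply: (@line_closure _ _ _ _ _ (chart_point a w j (fun i b k => pi i b k - split_pi j pi I i b k))).
move=> c c0.
rewrite (_ : [ffun i => _] = chart_point a w j (fun i b k =>
  split_pi j pi I i b k + c * (pi i b k - split_pi j pi I i b k))).
  apply: (chart_point_orbit (th := fun i => if i \in I then 1 else c) ch).
    by move=> i; case: ifP; rewrite ?oner_eq0.
  move=> i b k; rewrite /split_pi; case: ifP => [/eqP ->|].
    rewrite subrr mulr0 addr0; case: ifP => _; rewrite ?divr1 ?mulfV // mul1r //.
  case: ifP => Ii; case: ifP => Ik // _; rewrite subr0 add0r ?divr1 //.
  have [->|/(cI _ _ _ Ii)] := eqVneq (pi i b k) 0; first by rewrite !mulr0.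
  by rewrite Ik.
by apply/ffunP => m; apply/matrixP => r s; rewrite !(ffunE, mxE).
Qed.

End Minimal.

Section Part2.
Context (K : closedFieldType) (Q : quiver) (A : falgType K) (pres : presentation Q A).
Context (n : nat) (a : 'I_n -> A) (ha : generates a).
Implicit Types M N X Y : fdmod A.
Local Notation ep := (eps pres).

(** Near a point [x'] of [M'] the universal chart [pi] describes all modules of the
    orbit of [M]. There [pi y i b k] is [th i / th (j k)] times a fixed coordinate
    [p i b k] of [M], for some [th] that depends on [y]. Call [(i, l)] an edge if
    some such coordinate with [j k = l] is nonzero; along edges the ratio
    [th i / th l] is a regular function, with the value [c i l] at [x'].

    If no [c i l] is zero, the ratios can be followed from each [i] to a chosen
    member of its connected component, which gives a limiting [th]: then [M'] is
    isomorphic to [M], which is excluded. If [c i0 l0 = 0], let [I] consist of the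
    [k] for which [th l0] is a multiple of [th k] by a function that is regular at
    [x']. It is closed under edges, contains [l0] but not [i0], and no edge from the
    complement into [I] survives in the limit. So the submodule [U] generated by [I]
    gives a degeneration [N = U (+) M/U] of [M] that degenerates to [M'] in turn,
    and [N] is not isomorphic to [M], since the coordinates on the edge from [i0] to
    [l0] vanish. Semicontinuity of [dim J ^ l] makes [U] layer-stably embedded, and
    minimality identifies [M'] with [N]. *)
Lemma minimal_split t M P M' : squarefree_top t M ->
  projective_cover P (top M) -> frak_m P M = 0 ->
  minimal_layer_stable_degeneration a M M' ->
  exists2 U : submodule M, layer_stably_embedded U & miso M' (dsum (subm U) (quotm U)).
Proof.
move=> sq cov m0 [[[dg lay] niso] hmin].
have [vx [z0 fr0]] := squarefree_frame pres sq.
have tr : translatable pres vx M by move=> z fr; apply: (frak_m0_hom fr cov m0).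
have [z' fr'] : exists z' : 'I_t -> M', frame pres vx z'.
  apply: (frame_iso fr0); apply: (top_miso (pres := pres)) => v.
    exact: (miso_layers pres lay 0).
  exact: (miso_layers pres lay 1).
have [d [x [x' [rx rx' cl]]]] := dg.
have [w [j [delta [pi [hdelta dx' piR piC]]]]] := universal_chart ha fr' rx'.
have orbR y : Defs.orbit x y -> represents a y M by apply: represents_orbit.
have [z [p [ez ch]]] : exists z p, (forall i, act M (ep (vx i)) (z i) = z i) /\ chart w j z p.
  apply: contrapT => no; move/eqP: dx'; apply; have /closureP := cl; apply=> // y oy.
  apply/eqP; apply: contrapT => /negP dy; apply: no.
  by have [z ez ch] := piC y M (orbR y oy) dy; exists z, (pi y).
(* on the orbit, [pi] runs through a single torus orbit *)
pose good y (th : 'I_t -> K) := (forall i, th i != 0) /\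
  forall i b k, pi y i b k = th i / th (j k) * p i b k.
have torus y : Defs.orbit x y -> delta y != 0 -> exists th, good y th.
  move=> oy dy; have [zy ezy chy] := piC y M (orbR y oy) dy.
  by have [th th0 e] := chart_torus tr fr0 ez ch ezy chy; exists th.
have clos f : regular delta f ->
    (forall y th, delta y != 0 -> good y th -> f y = 0) -> f x' = 0.
  move=> hf f0; apply: (reg_closure hdelta cl dx' hf) => y oy dy.
  by have [th g] := torus y oy dy; apply: (f0 y th).
pose edge i l := exists b k, j k = l /\ p i b k != 0.
(* on edges, [q i l] takes the value [th i / th l] *)
have [q [qR qE q0]] : exists q : 'I_t -> 'I_t -> mpoint K n d -> K,
    [/\ forall i l, regular delta (q i l),
        forall i l y th, edge i l -> delta y != 0 -> good y th -> th i = q i l y * th l &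
        forall i l y, ~ edge i l -> q i l y = 0].
  have /choice[q hq] (il : 'I_t * 'I_t) : exists q : mpoint K n d -> K,
     [/\ regular delta q,
       forall y th, edge il.1 il.2 -> delta y != 0 -> good y th -> th il.1 = q y * th il.2 &
       forall y, ~ edge il.1 il.2 -> q y = 0].
    have [[b [k [jk pk]]]|ne] := pselect (edge il.1 il.2); last first.
      by exists (fun=> 0); split=> //; apply: reg_const.
    exists (fun y => pi y il.1 b k * (p il.1 b k)^-1); split.
    - by apply: regM => //; apply: reg_const.
    - move=> y th _ dy [th0 ->]; rewrite jk.
      by rewrite mulfK // divfK.
    by move=> y []; exists b, k.
  by exists (fun i l => q (i, l)); split=> [i l|i l y th|i l y]; have [? ? ?] := hq (i, l); auto.
pose c i l := q i l x'.
have pi' i b k : pi x' i b k = c i (j k) * p i b k.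
  apply/eqP; rewrite -subr_eq0; apply/eqP.
  apply: (clos (fun y => pi y i b k - q i (j k) y * p i b k)).
    by apply: regB => //; apply: regM => //; apply: reg_const.
  move=> y th dy g; have [p0|pn] := eqVneq (p i b k) 0.
    by rewrite g.2 p0 !mulr0 subrr.
  have e : edge i (j k) by exists b, k.
  by rewrite g.2 {1}(qE _ _ _ _ e dy g) mulfK ?subrr // (g.1 _).
have [z'' ez'' ch'] := piC x' M' rx' dx'.
(* a relation between torus coordinates whose coefficients make sense in the limit *)
pose rel i l f g := [/\ regular delta f, regular delta g &
  forall y th, delta y != 0 -> good y th -> f y * th i = g y * th l].
have rel_trans i l k f g f' g' : rel i l f g -> rel l k f' g' ->
    rel i k (fun y => f y * f' y) (fun y => g y * g' y).
  move=> [fR gR e] [fR' gR' e']; split; [exact: regM | exact: regM |].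
  by move=> y th dy gd; rewrite mulrAC (e _ _ dy gd) mulrAC -mulrA (e' _ _ dy gd) mulrA.
have rel_edge i l : edge i l -> rel i l (fun=> 1) (q i l).
  move=> e; split=> //; first exact: reg_const.
  by move=> y th dy gd; rewrite mul1r (qE _ _ _ _ e dy gd).
have rel_sym i l f g : rel i l f g -> rel l i g f.
  by move=> [fR gR e]; split=> // y th dy gd; rewrite e.
have rel_refl i : rel i i (fun=> 1) (fun=> 1).
  by split=> //; apply: reg_const.
have [[i0 [l0 [e0 c0]]]|nc0] := pselect (exists i l, edge i l /\ c i l = 0).
  (* an edge is lost in the limit: collect the [k] for which [th l0 / th k] stays finite *)
  pose I : pred 'I_t := fun k => `[< exists f g, rel l0 k f g /\ f x' != 0 >].
  have memI k : (k \in I) <-> exists f g, rel l0 k f g /\ f x' != 0.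
    by split=> [/asboolP|h]; last exact/asboolP.
  have cI i b k : i \in I -> p i b k != 0 -> j k \in I.
    move=> /memI[f [g [h fx]]] pn; apply/memI.
    have e : edge i (j k) by exists b, k.
    exists (fun y => f y * 1), (fun y => g y * q i (j k) y); split.
      exact: rel_trans h (rel_edge _ _ e).
    by rewrite mulr1.
  have Il0 : l0 \in I.
    by apply/memI; exists (fun=> 1), (fun=> 1); split=> //; apply: oner_neq0.
  have Ii0 : i0 \notin I.
    apply/negP => /memI[f [g [h /negP]]]; apply; apply/eqP.
    have [fR _ E] := rel_trans _ _ _ _ _ _ _ h (rel_edge _ _ e0).
    have -> : f x' = g x' * c i0 l0.
      apply/eqP; rewrite -subr_eq0; apply/eqP.
      apply: (clos (fun y => f y - g y * q i0 l0 y)).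
        have [hf hg _] := h; apply: regB => //; exact: regM.
      move=> y th dy gd; have [th0 _] := gd; apply: (mulIf (th0 l0)).
      by rewrite mul0r mulrBl -(E y th dy gd) mulr1 subrr.
    by rewrite c0 mulr0.
  have cross i b k : (i \in I) != (j k \in I) -> pi x' i b k = 0.
    move=> ne; rewrite pi'; have [->|pn] := eqVneq (p i b k) 0; first by rewrite mulr0.
    have e : edge i (j k) by exists b, k.
    have [->|cn] := eqVneq (c i (j k)) 0; first by rewrite mul0r.
    move: ne; case Ii: (i \in I); first by rewrite (cI i b k).
    case Ik: (j k \in I) => //; move: Ii; move/memI: Ik => [f [g [h fx]]] Ii.
    have : i \in I.
      apply/memI; exists (fun y => f y * q i (j k) y), (fun y => g y * 1); split.
        exact: rel_trans h (rel_sym _ _ _ _ (rel_edge _ _ e)).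
      by rewrite mulf_neq0.
    by rewrite Ii.
  pose U := part_sub ch cI; pose N := dsum (subm U) (quotm U).
  have chN : chart w j (split_gen ch cI) (split_pi j p I) := split_chart ch cI.
  have dMN : degeneration a M N := split_degeneration a ch cI.
  have dNM' : degeneration a N M'.
    pose Psi y := chart_point a w j (split_pi j (pi y) I).
    exists d, (chart_point a w j (split_pi j p I)), (Psi x'); split.
    - exact: chart_represents chN.
    - apply: (@chart_represents _ _ _ _ _ _ _ _ _ z''); apply: eq_chart ch' => i b k.
      by rewrite /split_pi; case: ifP => // /negbT/cross.
    apply/closureP => f [s hs] f0; rewrite hs.
    apply: (clos (fun y => s.@[coordinates (Psi y)])).
      apply: (@reg_meval _ _ _ delta hdelta _ s (fun k y => coordinates (Psi y) k)) => k.
      rewrite /coordinates; case: (enum_val k) => [[m r] l].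
      apply: (@reg_ext _ _ _ _ (fun y => ((j l \in I) == (j r \in I))%:R * pi y (j l) (a m * w l) r)).
        by move=> y _; rewrite ffunE mxE /split_pi; case: ifP; rewrite ?mul1r ?mul0r.
      by apply: regM => //; apply: reg_const.
    move=> y th dy gd; rewrite -hs; apply: f0.
    apply: (chart_point_orbit a chN gd.1) => i b k.
    by rewrite /split_pi; case: ifP; rewrite ?mulr0 // gd.2.
  have nMN : ~ miso M N.
    move=> /miso_sym[f [hf f0 ff]].
    have [i|th th0 e] := chart_torus tr fr0 ez ch _ (chart_hom hf f0 ff chN).
      by have /homE<- := hf; rewrite split_gen_eps.
    have [b [k [jk pn]]] := e0; have := e i0 b k.
    rewrite /split_pi jk Il0 (negPf Ii0) /= => /esym/eqP.
    by rewrite !mulf_eq0 invr_eq0 !(negPf (th0 _)) (negPf pn).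
  have emb : layer_stably_embedded U.
    apply: (embedded_of_dim pres) => l.
    rewrite (miso_layers_dim pres lay l).
    exact: (degeneration_Jpow ha l dNM').
  exists U => //; apply: miso_sym; apply: contrapT => nNM'; apply: hmin.
  exists N; split=> //; split=> //.
  exact: (embedded_layer_stable pres).
(* no edge is lost: the limit lies on the torus orbit itself *)
have cn i l : edge i l -> c i l != 0.
  by move=> e; apply/eqP => c0; apply: nc0; exists i, l.
exfalso; apply: niso.
pose conn i l := exists f g, [/\ rel i l f g, f x' != 0 & g x' != 0].
have conn_sym i l : conn i l -> conn l i.
  by move=> [f [g [h fx gx]]]; exists g, f; split=> //; apply: rel_sym.
have conn_trans i l k : conn i l -> conn l k -> conn i k.
  move=> [f [g [h fx gx]]] [f' [g' [h' fx' gx']]].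
  exists (fun y => f y * f' y), (fun y => g y * g' y); split.
  - exact: rel_trans h h'.
  - exact: mulf_neq0.
  exact: mulf_neq0.
have conn_edge i l : edge i l -> conn i l.
  move=> e; exists (fun=> 1), (q i l); split; [exact: rel_edge | exact: oner_neq0 | exact: cn].
pose root i := odflt i [pick l | `[< conn i l >]].
have connr i : conn i (root i).
  rewrite /root; case: pickP => [l /asboolP//|/(_ i)/asboolP[]].
  by exists (fun=> 1), (fun=> 1); split=> //; apply: oner_neq0.
have root_edge i l : edge i l -> root i = root l.
  move=> /conn_edge il; have := connr i; rewrite /root.
  have /eq_pick -> : (fun k => `[< conn i k >]) =1 (fun k => `[< conn l k >]).
    move=> k; apply/asboolP/asboolP; first exact/conn_trans/conn_sym.
    exact: conn_trans.
  case: pickP => //= /(_ l)/asboolP[].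
  by exists (fun=> 1), (fun=> 1); split=> //; apply: oner_neq0.
have /choice[F /choice[G FG]] i : exists f g, [/\ rel i (root i) f g, f x' != 0 & g x' != 0].
  exact: connr.
pose th i := G i x' / F i x'.
have th0 i : th i != 0 by have [_ fx gx] := FG i; rewrite mulf_neq0 ?invr_eq0.
apply: (chart_miso ha (chart_scale th0 ch)); apply: eq_chart ch' => i b k.
rewrite pi'; have [->|pn] := eqVneq (p i b k) 0; first by rewrite !mulr0.
have e : edge i (j k) by exists b, k.
congr (_ * _); have [[fR gR E] fx gx] := FG i; have [[fR' gR' E'] fx' gx'] := FG (j k).
have : F i x' * c i (j k) * G (j k) x' = G i x' * F (j k) x'.
  apply/eqP; rewrite -subr_eq0; apply/eqP.
  apply: (clos (fun y => F i y * q i (j k) y * G (j k) y - G i y * F (j k) y)).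
    by apply: regB => //; apply: regM => //; apply: regM.
  move=> y s dy gd; have [s0 _] := gd; apply: (mulIf (s0 (root i))).
  have E1 := E _ _ dy gd; have E2 := E' _ _ dy gd.
  rewrite (qE _ _ _ _ e dy gd) in E1; rewrite -(root_edge _ _ e) in E2.
  rewrite mul0r mulrBl.
  have -> : F i y * q i (j k) y * G (j k) y * s (root i) =
      F (j k) y * (F i y * (q i (j k) y * s (j k))).
    by rewrite -[LHS]mulrA -E2 -mulrA [RHS]mulrCA; congr (_ * _); rewrite mulrCA.
  by rewrite E1 mulrA [F _ _ * _]mulrC subrr.
move=> e2; rewrite /th invf_div.
have fg : F i x' * G (j k) x' != 0 by apply: mulf_neq0.
by rewrite mulf_div -e2; apply: (mulIf fg); rewrite divfK // mulrA [c _ _ * _]mulrC.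
Qed.

End Part2.

(** * Truncated path algebras *)

Section TruncatedPaths.
Context (Q : quiver) (m : nat).

(** Bounded length makes this a finite type, so that the functions on it form a
    finite-dimensional space. *)
Definition tpath := {p : vertex Q * {bseq m of arrow Q} | chain p.1 p.2}.
HB.instance Definition _ := Finite.on tpath.

Definition tstart (b : tpath) : vertex Q := (val b).1.
Definition tarrows (b : tpath) : seq (arrow Q) := (val b).2.
Definition tend (b : tpath) : vertex Q := last (tstart b) [seq tgt a | a <- tarrows b].
Definition tqpath (b : tpath) : qpath Q :=
  exist (fun p : vertex Q * seq (arrow Q) => chain p.1 p.2) (tstart b, tarrows b) (valP b).

Lemma tpath_ext b c : tstart b = tstart c -> tarrows b = tarrows c -> b = c.
Proof.
rewrite /tstart /tarrows => e1 e2; apply: val_inj.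
by case: b e1 e2 => -[i s] /= hb; case: c => -[i' s'] /= hc -> /val_inj->.
Qed.

Lemma tarrows_size b : (size (tarrows b) <= m)%N.
Proof. exact: size_bseq. Qed.

Lemma tchain b : chain (tstart b) (tarrows b).
Proof. exact: valP b. Qed.

Lemma mk_tpath i s : chain i s -> (size s <= m)%N -> exists b, tstart b = i /\ tarrows b = s.
Proof. by move=> hc hs; exists (exist _ (i, Bseq hs) hc). Qed.

Definition tcomp (p q b : tpath) : bool :=
  [&& tend q == tstart p, tstart b == tstart q & tarrows b == tarrows q ++ tarrows p].

Lemma tcomp_uniq p q b c : tcomp p q b -> tcomp p q c -> b = c.
Proof.
move=> /and3P[_ /eqP e1 /eqP e2] /and3P[_ /eqP e3 /eqP e4].
by apply: tpath_ext; rewrite ?e1 ?e2 ?e3 ?e4.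
Qed.

Lemma tcomp_end p q b : tcomp p q b -> tend b = tend p.
Proof.
move=> /and3P[/eqP e /eqP e1 /eqP e2].
by rewrite /tend e1 e2 map_cat last_cat -/(tend q) e.
Qed.

(** Both sides say that the composite of the three paths exists and is [b];
    intermediate composites are parts of [b], so they are short enough. *)
Lemma tcompA p q r b :
  [exists u, tcomp p q u && tcomp u r b] = [exists v, tcomp q r v && tcomp p v b].
Proof.
apply/existsP/existsP => -[u /andP[]].
  move=> h1 h2; have eu := tcomp_end h1; move: h1 h2.
  move=> /and3P[/eqP e1 /eqP e2 /eqP e3] /and3P[/eqP f1 /eqP f2 /eqP f3].
  have [||v [v1 v2]] := @mk_tpath (tstart r) (tarrows r ++ tarrows q).
  - by rewrite chain_cat tchain -/(tend r) f1 e2 tchain.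
  - have := tarrows_size b; rewrite f3 e3 catA size_cat; apply: leq_trans.
    exact: leq_addr.
  have cv : tcomp q r v by rewrite /tcomp f1 e2 v1 v2 !eqxx.
  exists v; rewrite cv /tcomp (tcomp_end cv) e1 v1 v2 f2 f3 e3 catA !eqxx //.
move=> h1 h2; have eu := tcomp_end h1; move: h1 h2.
move=> /and3P[/eqP e1 /eqP e2 /eqP e3] /and3P[/eqP f1 /eqP f2 /eqP f3].
have [||v [v1 v2]] := @mk_tpath (tstart q) (tarrows q ++ tarrows p).
- by rewrite chain_cat tchain -/(tend q) -eu f1 tchain.
- have := tarrows_size b; rewrite f3 e3 -catA size_cat; apply: leq_trans.
  exact: leq_addl.
exists v; rewrite /tcomp -eu f1 v1 v2 e1 f2 e2 f3 e3 catA !eqxx //.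
Qed.

Definition triv (v : vertex Q) : tpath.
Proof. by exists (v, [bseq]). Defined.

End TruncatedPaths.

Section TruncatedAlgebra.
Context (K : fieldType) (Q : quiver) (m : nat) (v0 : vertex Q).
Notation B := (tpath Q m).

(** The path algebra modulo the paths of length greater than [m]; the base vertex
    [v0] only witnesses that the algebra is nonzero. *)
Definition talg (_ : vertex Q) := {ffun B -> K^o}.
Local Notation T := (talg v0).
HB.instance Definition _ := Vector.copy T {ffun B -> K^o}.

Definition tmul (x y : T) : T :=
  [ffun b => \sum_p \sum_q x p * y q * (tcomp p q b)%:R].
Definition tone : T := [ffun b => (tarrows b == [::])%:R].

Lemma sum_exists (P R : pred B) : (forall u v, P u -> P v -> u = v) ->
  \sum_u (P u)%:R * (R u)%:R = [exists u, P u && R u]%:R :> K.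
Proof.
move=> uP; have [/existsP[u /andP[Pu Ru]]|/existsPn nP] := boolP [exists u, P u && R u].
  rewrite (bigD1 u) //= Pu Ru mulr1 big1 ?addr0 // => v vu.
  case Pv: (P v); last by rewrite mul0r.
  by rewrite (uP _ _ Pv Pu) eqxx in vu.
rewrite big1 // => u _; have := nP u.
by case: (P u); case: (R u); rewrite ?mulr0 ?mul0r.
Qed.

Lemma tmulA : associative tmul.
Proof.
move=> x y z; apply/ffunP => b; rewrite !ffunE.
transitivity (\sum_p \sum_q \sum_r x p * y q * z r * [exists v, tcomp q r v && tcomp p v b]%:R).
  apply: eq_bigr => p _.
  transitivity (\sum_v \sum_q \sum_r x p * y q * z r * ((tcomp q r v)%:R * (tcomp p v b)%:R)).
    apply: eq_bigr => v _; rewrite ffunE mulr_sumr mulr_suml; apply: eq_bigr => q _.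
    by rewrite mulr_sumr mulr_suml; apply: eq_bigr => r _; rewrite !mulrA.
  rewrite exchange_big; apply: eq_bigr => q _; rewrite exchange_big; apply: eq_bigr => r _.
  by rewrite -mulr_sumr sum_exists //; apply: tcomp_uniq.
symmetry.
transitivity (\sum_u \sum_r \sum_p \sum_q x p * y q * z r * ((tcomp p q u)%:R * (tcomp u r b)%:R)).
  apply: eq_bigr => u _; apply: eq_bigr => r _; rewrite ffunE !mulr_suml.
  apply: eq_bigr => p _; rewrite !mulr_suml; apply: eq_bigr => q _.
  by rewrite -!mulrA; congr (_ * (_ * _)); rewrite !mulrA; congr (_ * _); rewrite mulrC.
rewrite exchange_big /=.
under eq_bigr => r _ do rewrite exchange_big /=.
rewrite exchange_big /=; apply: eq_bigr => p _.
under eq_bigr => r _ do rewrite exchange_big /=.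
rewrite exchange_big /=; apply: eq_bigr => q _; apply: eq_bigr => r _.
rewrite -mulr_sumr sum_exists ?tcompA //; exact: tcomp_uniq.
Qed.

Lemma tmul1x : left_id tone tmul.
Proof.
move=> x; apply/ffunP => b; rewrite ffunE exchange_big (bigD1 b) //=.
rewrite (bigD1 (triv m (tend b))) //= big1 ?addr0 => [|p pn]; last first.
  rewrite ffunE; case: eqP => [p0|]; last by rewrite !mul0r.
  rewrite [tcomp _ _ _](_ : _ = false) ?mulr0 //; apply: contraNF pn.
  by move=> /and3P[/eqP e _ _]; apply/eqP/tpath_ext; rewrite ?p0.
rewrite ffunE eqxx mul1r big1 ?addr0 => [|q qb].
  by rewrite /tcomp cats0 !eqxx mulr1.
apply: big1 => p _; rewrite ffunE; case: eqP => [p0|]; last by rewrite !mul0r.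
rewrite [tcomp _ _ _](_ : _ = false) ?mulr0 //; apply: contraNF qb.
by rewrite /tcomp p0 cats0 => /and3P[_ /eqP e1 /eqP e2]; apply/eqP/tpath_ext.
Qed.

Lemma tmulx1 : right_id tone tmul.
Proof.
move=> x; apply/ffunP => b; rewrite ffunE (bigD1 b) //=.
rewrite (bigD1 (triv m (tstart b))) //= big1 ?addr0 => [|q qn]; last first.
  rewrite ffunE; case: eqP => [q0|]; last by rewrite mulr0 mul0r.
  rewrite [tcomp _ _ _](_ : _ = false) ?mulr0 //; apply: contraNF qn.
  by move=> /and3P[_ /eqP e _]; apply/eqP/tpath_ext; rewrite ?q0.
rewrite ffunE eqxx mulr1 big1 ?addr0 => [|p pb].
  by rewrite /tcomp /tend /= !eqxx mulr1.
apply: big1 => q _; rewrite ffunE; case: eqP => [q0|]; last by rewrite mulr0 mul0r.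
rewrite [tcomp _ _ _](_ : _ = false) ?mulr0 //; apply: contraNF pb.
rewrite /tcomp q0 /= => /and3P[/eqP e1 /eqP e2 /eqP e3]; apply/eqP/tpath_ext => //.
by rewrite e2 -e1 /tend q0.
Qed.

Lemma tmulDl : left_distributive tmul +%R.
Proof.
move=> x y z; apply/ffunP => b; rewrite !ffunE -big_split /=; apply: eq_bigr => p _.
by rewrite -big_split /=; apply: eq_bigr => q _; rewrite ffunE !mulrDl.
Qed.

Lemma tmulDr : right_distributive tmul +%R.
Proof.
move=> x y z; apply/ffunP => b; rewrite !ffunE -big_split /=; apply: eq_bigr => p _.
by rewrite -big_split /=; apply: eq_bigr => q _; rewrite ffunE mulrDr mulrDl.
Qed.

Lemma tone_neq0 : tone != 0.
Proof.
apply/eqP => /ffunP/(_ (triv m v0)); rewrite !ffunE eqxx => /eqP.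
by rewrite oner_eq0.
Qed.

HB.instance Definition _ := GRing.Zmodule_isNzRing.Build T tmulA tmul1x tmulx1
  tmulDl tmulDr tone_neq0.

Lemma tscaleAl (c : K) (x y : T) : c *: (x * y) = c *: x * y.
Proof.
apply/ffunP => b; rewrite !ffunE scaler_sumr; apply: eq_bigr => p _.
rewrite scaler_sumr; apply: eq_bigr => q _; rewrite ffunE.
by rewrite -[_ *: _]/(_ * _) -[c *: x p]/(c * x p) !mulrA.
Qed.
HB.instance Definition _ := GRing.Lmodule_isLalgebra.Build K T tscaleAl.

Lemma tscaleAr (c : K) (x y : T) : c *: (x * y) = x * (c *: y).
Proof.
apply/ffunP => b; rewrite !ffunE scaler_sumr; apply: eq_bigr => p _.
rewrite scaler_sumr; apply: eq_bigr => q _; rewrite ffunE.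
by rewrite -[_ *: _]/(_ * _) -[c *: y q]/(c * y q) !mulrA [c * x p]mulrC.
Qed.
HB.instance Definition _ := GRing.Lalgebra_isAlgebra.Build K T tscaleAr.
HB.instance Definition _ := Algebra_isFalgebra.Build K T.

End TruncatedAlgebra.

Section TruncatedPresentation.
Context (K : fieldType) (Q : quiver) (m : nat) (v0 : vertex Q).
Notation B := (tpath Q m).
Local Notation T := (talg K m v0).

Definition delta (b : B) : T := [ffun c => (c == b)%:R].

Lemma tqpath_inj : injective (@tqpath Q m).
Proof. by move=> b c [e1 e2]; apply: tpath_ext. Qed.

Lemma tqpath_size (b : B) : (plength (tqpath b) <= m)%N.
Proof. exact: tarrows_size. Qed.

Lemma tqpath_ex (p : qpath Q) : (plength p <= m)%N -> exists b : B, tqpath b = p.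
Proof.
case: p => -[i s] hc /= hs; have [b [b1 b2]] := mk_tpath hc hs.
by exists b; apply: val_inj; rewrite /= b1 b2.
Qed.

Lemma tqpath_comp (p q b : B) :
  (Defs.pcomp (tqpath p) (tqpath q) == Some (tqpath b)) = tcomp p q b.
Proof.
rewrite /tcomp; have [e|ne] := eqVneq (tend q) (tstart p); last first.
  by rewrite pcompN //; apply/eqP.
have [r [-> _ hr]] := @pcompP _ (tqpath p) (tqpath q) e.
rewrite andTb; apply/eqP/andP => [[er]|[/eqP e1 /eqP e2]].
  by move: hr; rewrite er => -[-> ->]; rewrite !eqxx.
by congr Some; apply: val_inj; rewrite -[LHS]/(sval r) hr /= e1 e2.
Qed.

Definition trunc_fun (x : path_alg K Q) : T := [ffun b => coeff (tqpath b) x : K].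
Lemma trunc_linear : linear trunc_fun.
Proof. by move=> c x y; apply/ffunP => b; rewrite !ffunE coeffD coeffZ. Qed.
HB.instance Definition _ := GRing.isSemilinear.Build K (path_alg K Q) T _ trunc_fun
  (GRing.semilinear_linear trunc_linear).

(** Paths of length greater than [m] may be left out of a sum. *)
Lemma coeff_sum_dom (x : path_alg K Q) (g : qpath Q -> K) :
  (forall p, (m < plength p)%N -> g p = 0) ->
  \sum_(p <- dom x) coeff p x * g p = \sum_(b : B) coeff (tqpath b) x * g (tqpath b).
Proof.
move=> g0.
transitivity (\sum_(p <- dom x) \sum_(b : B) (tqpath b == p)%:R * (coeff p x * g p)).
  apply: eq_bigr => p _; have [le|gt] := leqP (plength p) m; last first.
    by rewrite g0 // mulr0 big1 // => b _; rewrite mulr0.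
  have [b <-] := tqpath_ex le; rewrite (bigD1 b) //= eqxx mul1r big1 ?addr0 // => c cb.
  by rewrite (inj_eq tqpath_inj) (negbTE cb) mul0r.
rewrite exchange_big; apply: eq_bigr => b _ /=.
have [bx|bx] := boolP (tqpath b \in dom x).
  rewrite (bigD1_seq (tqpath b)) ?uniq_dom //= eqxx mul1r big1 ?addr0 // => p pb.
  by rewrite eq_sym (negbTE pb) mul0r.
rewrite (coeff_outdom bx) mul0r big_seq big1 // => p px.
by case: eqP => [e|_]; [rewrite e px in bx | rewrite mul0r].
Qed.

Lemma trunc1 : trunc_fun (pa_one K Q) = 1.
Proof.
apply/ffunP => b; rewrite !ffunE /pa_one raddf_sum /=.
have [e|ne] := eqVneq (tarrows b) [::].
  rewrite (bigD1 (tstart b)) //= coeffU mul1r (_ : qpath0 _ = tqpath b) ?eqxx; last first.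
    by apply: val_inj; rewrite /= e.
  rewrite big1 ?addr0 // => i ib; rewrite coeffU mul1r; case: eqP => // h.
  by move: ib; rewrite -[i]/(pstart (qpath0 i)) h eqxx.
rewrite big1 // => i _; rewrite coeffU mul1r; case: eqP => // h.
by move: ne; rewrite -[tarrows b]/(parrows (tqpath b)) -h.
Qed.

Lemma truncM x y : trunc_fun (pa_mul x y) = trunc_fun x * trunc_fun y.
Proof.
apply/ffunP => b; rewrite ffunE /pa_mul raddf_sum /= ffunE.
pose g p q : K := (Defs.pcomp p q == Some (tqpath b))%:R.
have g0 p q : (m < plength p)%N || (m < plength q)%N -> g p q = 0.
  rewrite /g; case: eqP => // /pcomp_size e; have := tqpath_size b; rewrite e => le.
  by rewrite !ltnNge (leq_trans (leq_addr _ _) le) (leq_trans (leq_addl _ _) le).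
transitivity (\sum_(p <- dom x) coeff p x * (\sum_(q <- dom y) coeff q y * g p q)).
  apply: eq_bigr => p _; rewrite raddf_sum mulr_sumr; apply: eq_bigr => q _ /=.
  rewrite /g; case: (Defs.pcomp p q) => [r|]; last by rewrite coeff0 !mulr0.
  by rewrite coeffU mulrA.
rewrite coeff_sum_dom => [|p pm]; last first.
  by rewrite big1 // => q _; rewrite g0 ?pm // mulr0.
apply: eq_bigr => p _; rewrite coeff_sum_dom => [|q qm]; last by rewrite g0 ?qm ?orbT.
rewrite mulr_sumr; apply: eq_bigr => q _.
by rewrite !ffunE /g tqpath_comp mulrA.
Qed.

Lemma trunc_surj (a : T) : exists x, trunc_fun x = a.
Proof.
exists (\sum_(b : B) << (a b : K) *g tqpath b >>); apply/ffunP => c.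
rewrite ffunE raddf_sum (bigD1 c) //= coeffU eqxx mulr1 big1 ?addr0 // => b bc.
by rewrite coeffU (inj_eq tqpath_inj) (negbTE bc) mulr0.
Qed.

Hypothesis m0 : (0 < m)%N.

Lemma trunc_adm : admissible (fun x => trunc_fun x = 0).
Proof.
split=> [|x x0 p px].
  exists m.+1 => // x hx; apply/ffunP => b; rewrite !ffunE; apply: coeff_outdom.
  by apply/negP => /hx; rewrite ltnNge tqpath_size.
rewrite ltnNge; apply/negP => p1; have [b eb] := tqpath_ex (leq_trans p1 m0).
have /ffunP/(_ b) := x0; rewrite !ffunE eb => /eqP; apply/negP.
by rewrite -mem_dom.
Qed.

Definition trunc_pres : presentation Q T :=
  Presentation trunc1 truncM trunc_surj trunc_adm.

Lemma trunc_pimg (b : B) : pimg trunc_pres (tqpath b) = delta b.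
Proof.
apply/ffunP => c; rewrite ffunE /= /trunc_fun ffunE coeffU mul1r eq_sym.
by rewrite (inj_eq tqpath_inj).
Qed.

(** ** Modules from representations of the quiver *)

Section QuiverRep.
Context (V : vectType K) (E : vertex Q -> 'End(V)) (X : arrow Q -> 'End(V)).
Hypothesis E1 : forall u, u = \sum_v E v u.
Hypothesis EE : forall u v x, E u (E v x) = if u == v then E u x else 0.
Hypothesis EX : forall r u, E (tgt r) (X r u) = X r u.
Hypothesis XE : forall r u, X r (E (src r) u) = X r u.
Hypothesis short : forall (i : vertex Q) s, chain i s -> (size s <= m)%N.

Definition word_act (s : seq (arrow Q)) (u : V) : V := foldl (fun w r => X r w) u s.

Lemma word_act_linear s : linear (word_act s).
Proof.
elim: s => [|r s IH] c u v //; rewrite /word_act /= linearP; exact: IH.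
Qed.

Definition path_act (b : B) : 'End(V) := (mklin (word_act_linear (tarrows b)) \o E (tstart b))%VF.

Lemma path_actE b u : path_act b u = word_act (tarrows b) (E (tstart b) u).
Proof. by rewrite comp_lfunE mklinE. Qed.

Lemma word_act_end i s u : chain i s ->
  E (last i [seq tgt r | r <- s]) (word_act s (E i u)) = word_act s (E i u).
Proof.
elim: s i u => [|r s IH] i u /=; first by rewrite EE eqxx.
by move=> /andP[/eqP<- hs]; rewrite XE -(EX r u) IH.
Qed.

Definition rep_fun (x : T) : 'End(V) := \sum_b (x b : K) *: path_act b.

Lemma rep_linear : linear rep_fun.
Proof.
move=> c x y; rewrite /rep_fun scaler_sumr -big_split /=; apply: eq_bigr => b _.
by rewrite !ffunE scalerDl scalerA.
Qed.

Lemma rep_delta b : rep_fun (delta b) = path_act b.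
Proof.
rewrite /rep_fun (bigD1 b) //= ffunE eqxx scale1r big1 ?addr0 // => c cb.
by rewrite ffunE (negbTE cb) scale0r.
Qed.

Lemma tone_sum : 1 = \sum_v delta (triv m v) :> T.
Proof.
apply/ffunP => b; rewrite !ffunE sum_ffunE.
have [e|ne] := eqVneq (tarrows b) [::].
  rewrite (bigD1 (tstart b)) //= ffunE (_ : b = triv m (tstart b)) ?eqxx; last exact: tpath_ext.
  rewrite big1 ?addr0 // => v vb; rewrite ffunE; case: eqP => // /(congr1 (@tstart _ _)) h.
  by move: vb; rewrite h eqxx.
rewrite big1 // => v _; rewrite ffunE; case: eqP => // h.
by rewrite h eqxx in ne.
Qed.

Lemma path_act_comp p q : (path_act p \o path_act q)%VF = \sum_b (tcomp p q b)%:R *: path_act b.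
Proof.
apply/lfunP => u; rewrite comp_lfunE sum_lfunE !path_actE.
have qe := word_act_end u (tchain q); rewrite -/(tend q) in qe.
have [e|ne] := eqVneq (tend q) (tstart p); last first.
  rewrite -qe EE eq_sym (negbTE ne) big1 => [|b _]; last first.
    by rewrite /tcomp (negbTE ne) scale0r zero_lfunE.
  by rewrite -(mklinE (word_act_linear (tarrows p))) linear0.
have hc : chain (tstart q) (tarrows q ++ tarrows p).
  by rewrite chain_cat tchain -/(tend q) e tchain.
have [b [b1 b2]] := mk_tpath hc (short hc).
rewrite (bigD1 b) //= /tcomp e b1 b2 !eqxx scale1r big1 ?addr0 => [|c cb]; last first.
  rewrite (_ : (_ == _) && _ = false) ?scale0r ?zero_lfunE //; apply: contraNF cb.
  by move=> /andP[/eqP e1 /eqP e2]; apply/eqP/tpath_ext; rewrite ?b1 ?b2.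
by rewrite -e qe path_actE b1 b2 /word_act foldl_cat.
Qed.

Lemma rep1 : rep_fun 1 = \1%VF.
Proof.
have sumE (I : finType) (F : I -> T) : rep_fun (\sum_i F i) = \sum_i rep_fun (F i).
  apply: (big_morph rep_fun) => [x y|].
    by rewrite -[x]scale1r rep_linear !scale1r.
  by rewrite /rep_fun big1 // => b _; rewrite ffunE scale0r.
rewrite tone_sum sumE; apply/lfunP => u; rewrite id_lfunE sum_lfunE [RHS]E1.
by apply: eq_bigr => v _; rewrite rep_delta path_actE.
Qed.

Lemma repM x y : rep_fun (x * y) = (rep_fun x \o rep_fun y)%VF.
Proof.
apply/lfunP => u; rewrite comp_lfunE /rep_fun !sum_lfunE.
transitivity (\sum_p \sum_q (x p * y q : K) *: path_act p (path_act q u)).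
  transitivity (\sum_b \sum_p \sum_q (x p * y q * (tcomp p q b)%:R : K) *: path_act b u).
    apply: eq_bigr => b _; rewrite scale_lfunE ffunE scaler_suml; apply: eq_bigr => p _.
    by rewrite scaler_suml.
  rewrite exchange_big; apply: eq_bigr => p _; rewrite exchange_big; apply: eq_bigr => q _ /=.
  rewrite -comp_lfunE path_act_comp sum_lfunE scaler_sumr; apply: eq_bigr => b _.
  by rewrite scale_lfunE scalerA.
apply: eq_bigr => p _; rewrite scale_lfunE linear_sum scaler_sumr; apply: eq_bigr => q _ /=.
by rewrite scale_lfunE linearZ scalerA.
Qed.

(** The hypothesis [short] makes the truncation harmless: there are no longer paths
    whose action would have to vanish. *)
Definition quiver_rep : fdmod T := FdMod rep_linear rep1 repM.

Lemma rep_eps v u : act quiver_rep (eps trunc_pres v) u = E v u.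
Proof.
rewrite /eps (_ : qpath0 v = tqpath (triv m v)); last exact: val_inj.
by rewrite trunc_pimg /= rep_delta path_actE.
Qed.

Definition arrow_elt (r : arrow Q) : T := pimg trunc_pres
  (exist (fun p : vertex Q * seq (arrow Q) => chain p.1 p.2) (src r, [:: r]) (introT andP (conj (eqxx _) isT))).

Lemma rep_arrow r u : act quiver_rep (arrow_elt r) u = X r u.
Proof.
rewrite /arrow_elt.
have [b eb] := @tqpath_ex (exist (fun p : vertex Q * seq (arrow Q) => chain p.1 p.2)
   (src r, [:: r]) (introT andP (conj (eqxx _) isT))) m0.
rewrite -eb trunc_pimg /= rep_delta path_actE.
have -> : tstart b = src r by have := congr1 (@pstart _) eb.
have -> : tarrows b = [:: r] by have := congr1 (@parrows _) eb.
exact: XE.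
Qed.

Lemma arrow_elt_J r : arrow_elt r \in jacobson T.
Proof. by apply/(jacobsonE trunc_pres); apply: arrow_img_pimg. Qed.

Lemma J_triv (x : T) b : x \in jacobson T -> tarrows b = [::] -> x b = 0.
Proof.
move=> /(jacobsonE trunc_pres)[y hy <-] e; rewrite /= /trunc_fun ffunE; apply: coeff_outdom.
by apply/negP => /hy; rewrite /plength /parrows /= e.
Qed.

Lemma word_act_stable (W : {vspace V}) s u : (forall r w, w \in W -> X r w \in W) ->
  u \in W -> word_act s u \in W.
Proof. by move=> h; elim: s u => //= r s IH u Wu; apply/IH/h. Qed.

(** The radical of a submodule is spanned by its images under nontrivial paths. *)
Lemma rep_Jmul (W : submodule quiver_rep) (Z : {vspace V}) :
  (forall r w, w \in Z -> X r w \in Z) ->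
  (forall r w, w \in (W : {vspace V}) -> X r w \in Z) -> (Jmul W <= Z)%VS.
Proof.
move=> hZ hW; apply: Jmul_le => x u Jx Wu; rewrite /= /rep_fun sum_lfunE memv_suml // => b _.
rewrite scale_lfunE path_actE; case e: (tarrows b) => [|r s].
  by rewrite (J_triv Jx e) scale0r mem0v.
rewrite memvZ // -[word_act _ _]/(word_act s (X r (E (tstart b) u))).
rewrite word_act_stable // hW //.
by have := mem_submodule (eps trunc_pres (tstart b)) Wu; rewrite rep_eps.
Qed.

End QuiverRep.

Lemma rep_hom (V V' : vectType K) (E : vertex Q -> 'End(V)) (X : arrow Q -> 'End(V))
    (E' : vertex Q -> 'End(V')) (X' : arrow Q -> 'End(V')) E1 EE EX XE sh E1' EE' EX' XE' sh'
    (f : 'Hom(V, V')) : (forall v u, f (E v u) = E' v (f u)) ->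
  (forall r u, f (X r u) = X' r (f u)) ->
  @is_hom K T (@quiver_rep V E X E1 EE EX XE sh) (@quiver_rep V' E' X' E1' EE' EX' XE' sh') f.
Proof.
move=> hE hX; apply/homE => x u; rewrite /= /rep_fun !sum_lfunE linear_sum.
apply: eq_bigr => b _ /=; rewrite !scale_lfunE linearZ !path_actE /=; congr (_ *: _).
by rewrite -hE; elim: (tarrows b) (E (tstart b) u) => //= r s IH w; rewrite IH hX.
Qed.

End TruncatedPresentation.

(** * A projective family of degenerations *)

Section Criteria.
Context (K : fieldType) (A : falgType K).
Implicit Types M N X : fdmod A.

(** A direct sum decomposition yields an idempotent endomorphism. *)
Lemma idem_indecomposable M : nonzero M ->
  (forall f : 'Hom(M, M), is_hom f -> (forall u, f (f u) = f u) ->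
    (forall u, f u = 0) \/ (forall u, f u = u)) ->
  indecomposable M.
Proof.
move=> nz h; split=> // U V UV cUV.
have fU u : u \in (U : {vspace M}) -> daddv_pi U V u = u by apply: daddv_pi_id.
have fV v : v \in (V : {vspace M}) -> daddv_pi U V v = 0.
  move=> Vv; have Uu := memv_pi U V v.
  have e : daddv_pi U V v + daddv_pi V U v = v by apply: daddv_pi_add; rewrite // UV memvf.
  have Vu : daddv_pi U V v \in (V : {vspace M}).
    by rewrite -[daddv_pi U V v](addrK (daddv_pi V U v)) e memvB // memv_pi.
  by apply/eqP; rewrite -memv0 -cUV memv_cap Uu Vu.
have dec u : exists2 x, x \in (U : {vspace M}) & exists2 y, y \in (V : {vspace M}) & u = x + y.
  by have /memv_addP[x Ux [y Vy e]] : u \in (U + V)%VS by [rewrite UV memvf]; exists x => //; exists y.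
have [||f0|f1] := h (daddv_pi U V).
- apply/homE => b u; have [x Ux [y Vy ->]] := dec u.
  rewrite 3!linearD /= (fU x Ux) (fV y Vy) (fU (act M b x)) ?mem_submodule //.
  by rewrite (fV (act M b y)) ?mem_submodule // addr0 ?linearD /= ?linear0 ?addr0.
- by move=> u; rewrite fU // memv_pi.
- by left; apply/eqP; rewrite -subv0; apply/subvP => u Uu; rewrite memv0 -(fU u) ?f0.
by right; apply/eqP; rewrite -subv0; apply/subvP => u Vu; rewrite memv0 -(f1 u) fV.
Qed.

(** The lines through the images of the generators are the simple summands of the
    top; distinct vertices make them non-isomorphic. *)
Lemma frame_squarefree (Q : quiver) (pres : presentation Q A) t M vx (z : 'I_t -> M) :
  frame pres vx z -> squarefree_top t M.
Proof.
move=> fr; pose s i : top M := quotm_map (Jmul (fullm M)) (z i).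
have sE i : act (top M) (eps pres (vx i)) (s i) = s i.
  by rewrite -quotm_hom (frame_eps fr).
have s0 i : s i != 0 by rewrite quotm_eq0; apply: (frame_notJ fr).
have st i := ssimple_line (@top_ssimple _ _ M) (sE i).
exists (fun i => submod_of (st i)); split.
- have sum m : exists c : 'I_t -> K, quotm_map (Jmul (fullm M)) m = \sum_i c i *: s i.
    have [c hc] := frame_span fr m; exists c; apply/eqP; rewrite -subr_eq0.
    move/quotm_ker: hc; rewrite linearB linear_sum /=.
    by under eq_bigr do rewrite linearZ; move=> ->.
  split.
    apply/vspaceP => w; rewrite memvf; have [m <-] := quotm_surj w; have [c ->] := sum m.
    by apply: memv_sumr => i _; rewrite memvZ ?memv_line.
  apply/directv_sum_independent => u hu e i _.
  have /choice[c hc] k : exists c, u k = c *: s k by apply/vlineP; apply: hu.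
  suff c0 : c i = 0 by rewrite hc c0 scale0r.
  apply: (frame_free fr (c := c)); apply/quotm_ker; rewrite linear_sum -[RHS]e.
  by apply: eq_bigr => k _; rewrite linearZ hc.
- move=> i; apply: simple_dim1; rewrite dim_subm /= dim_vline s0 //.
move=> i j ij [f [/homE hf _ /limg_fullP ff]].
pose y : subm (submod_of (st j)) := vsproj _ (s j).
have yE : vsval y = s j by rewrite vsprojK ?memv_line.
have [x xy] := ff y.
have x0 : act (subm (submod_of (st i))) (eps pres (vx j)) x = 0.
  apply: subvs_inj; rewrite sub_actE linear0.
  have /vlineP[k ->] : vsval x \in <[s i]>%VS by apply: subvsP.
  rewrite linearZ /= (eps_fix0 (sE i)) ?scaler0 //.
  by apply: contra ij => /eqP/(frame_inj fr)->.
have := s0 j; rewrite -yE -xy -(_ : act _ (eps pres (vx j)) (f x) = f x).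
  by rewrite -hf x0 linear0 linear0 eqxx.
by rewrite xy; apply: subvs_inj; rewrite sub_actE yE sE.
Qed.

End Criteria.

Section Quiver.
Context (r : nat).

Definition ex_src (e : 'I_r.+1 + 'I_4) : 'I_5 :=
  match e with
  | inl _ => @Ordinal 5 1 isT
  | inr k => match nat_of_ord k with
    | 0 => @Ordinal 5 0 isT | 1 => @Ordinal 5 2 isT
    | 2 => @Ordinal 5 1 isT | _ => @Ordinal 5 0 isT end
  end.
Definition ex_tgt (e : 'I_r.+1 + 'I_4) : 'I_5 :=
  match e with
  | inl _ => @Ordinal 5 0 isT
  | inr k => match nat_of_ord k with
    | 0 => @Ordinal 5 3 isT | 1 => @Ordinal 5 3 isT
    | 2 => @Ordinal 5 4 isT | _ => @Ordinal 5 4 isT end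
  end.

(** Vertices 0 to 4 and arrows: [r.+1] arrows from 1 to 0, and one arrow each from 0
    to 3, from 2 to 3, from 1 to 4 and from 0 to 4, in this order. The modules have
    dimension [r.+2] at 0 and 3 and dimension one elsewhere. The many arrows from 1
    to 0 single out the first [r.+1] unit vectors, the arrow from 0 to 3 is the
    identity, and the two arrows into 4 tie the last coordinate to the vertex 1; so
    an endomorphism is essentially scalar at 0 and 3, up to translations of the last
    unit vector. The arrow from 2 to 3 marks a vector [om]. *)
Definition ex_quiver : quiver := @Quiver 'I_5 ('I_r.+1 + 'I_4)%type ex_src ex_tgt.

Lemma ex_short (i : vertex ex_quiver) s : chain i s -> (size s <= 2)%N.
Proof.
case: s => [//|e1 [//|e2 [//|e3 s]]] /= /and4P[_ h1 h2 _]; exfalso.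
case: e1 h1 => [i1|[[|[|[|[|k]]]] hk]] //=; case: e2 h2 => [i2|[[|[|[|[|k2]]]] hk2]] //=;
 case: e3 => [i3|[[|[|[|[|k3]]]] hk3]] //=.
Qed.

End Quiver.

Section Example.
Context (K : fieldType) (r : nat).
Notation n := r.+2.
Local Notation Q := (ex_quiver r).
Notation arr := ('I_r.+1 + 'I_4)%type.

(** The coordinates are grouped as: vertices 0 and 3, then vertices 1, 2 and 4. *)
Definition exV : vectType K := ('rV[K]_n * 'rV[K]_n * (K^o * K^o * K^o))%type.
Definition mkV (p q : 'rV[K]_n) (x y z : K) : exV := (p, q, (x, y, z)).

Lemma mkVP (u : exV) : exists p q x y z, u = mkV p q x y z.
Proof. by case: u => -[p q] [[x y] z]; exists p, q, x, y, z. Qed.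

Lemma mkVL k p q x y z p' q' x' y' z' :
  k *: mkV p q x y z + mkV p' q' x' y' z' =
  mkV (k *: p + p') (k *: q + q') (k * x + x') (k * y + y') (k * z + z').
Proof. by []. Qed.

Lemma mkVD p q x y z p' q' x' y' z' :
  mkV p q x y z + mkV p' q' x' y' z' =
  mkV (p + p') (q + q') (x + x') (y + y') (z + z').
Proof. by []. Qed.

Lemma mkVZ k p q x y z : k *: mkV p q x y z = mkV (k *: p) (k *: q) (k * x) (k * y) (k * z).
Proof. by []. Qed.

Definition vfun (v : 'I_5) (u : exV) : exV :=
  let: (p, q, (x, y, z)) := u in
  match nat_of_ord v with
  | 0 => mkV p 0 0 0 0 | 1 => mkV 0 0 x 0 0 | 2 => mkV 0 0 0 y 0
  | 3 => mkV 0 q 0 0 0 | _ => mkV 0 0 0 0 z end.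

Definition last_coord (p : 'rV[K]_n) : K := p 0 ord_max.
Definition unit_vec (j : 'I_n) : 'rV[K]_n := delta_mx 0 j.

Definition afun (om : 'rV[K]_n) (e : arr) (u : exV) : exV :=
  let: (p, q, (x, y, z)) := u in
  match e with
  | inl i => mkV (x *: unit_vec (fintype.lift ord_max i)) 0 0 0 0
  | inr k => match nat_of_ord k with
    | 0 => mkV 0 p 0 0 0
    | 1 => mkV 0 (y *: om) 0 0 0
    | 2 => mkV 0 0 0 0 x
    | _ => mkV 0 0 0 0 (last_coord p) end
  end.

Lemma last_coordD p q : last_coord (p + q) = last_coord p + last_coord q.
Proof. by rewrite /last_coord mxE. Qed.
Lemma last_coordZ k p : last_coord (k *: p) = k * last_coord p.
Proof. by rewrite /last_coord mxE. Qed.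

Lemma vfun_linear v : linear (vfun v).
Proof.
move=> k u w; have [p [q [x [y [z ->]]]]] := mkVP u.
have [p' [q' [x' [y' [z' ->]]]]] := mkVP w; rewrite mkVL.
by case: v => -[|[|[|[|v]]]] hv; rewrite /vfun /= mkVL ?scaler0 ?mulr0 ?addr0.
Qed.

Lemma afun_linear om e : linear (afun om e).
Proof.
move=> k u w; have [p [q [x [y [z ->]]]]] := mkVP u.
have [p' [q' [x' [y' [z' ->]]]]] := mkVP w; rewrite mkVL.
case: e => [i|[[|[|[|v]]] hv]]; rewrite /afun /= mkVL ?scaler0 ?mulr0 ?addr0 //.
- by rewrite scalerA -scalerDl.
- by rewrite scalerA -scalerDl.
by rewrite last_coordD last_coordZ.
Qed.

Definition exE (v : vertex Q) : 'End(exV) := mklin (vfun_linear v).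
Definition exX om (e : arrow Q) : 'End(exV) := mklin (afun_linear om e).

Lemma exEE u v x : exE u (exE v x) = if u == v then exE u x else 0.
Proof.
rewrite !mklinE; have [p [q [x1 [y [z ->]]]]] := mkVP x.
by case: u => -[|[|[|[|[|u]]]]] hu //; case: v => -[|[|[|[|[|v]]]]] hv.
Qed.

Lemma exE1 u : u = \sum_v exE v u.
Proof.
have [p [q [x [y [z ->]]]]] := mkVP u; rewrite !big_ord_recl big_ord0 !mklinE /= addr0.
by rewrite /vfun /= !mkVD !addr0 !add0r.
Qed.

Lemma exEX om e u : exE (tgt e) (exX om e u) = exX om e u.
Proof.
rewrite !mklinE; have [p [q [x [y [z ->]]]]] := mkVP u.
by case: e => [i|[[|[|[|v]]] hv]].
Qed.

Lemma exXE om e u : exX om e (exE (src e) u) = exX om e u.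
Proof.
rewrite !mklinE; have [p [q [x [y [z ->]]]]] := mkVP u.
by case: e => [i|[[|[|[|v]]] hv]].
Qed.

End Example.

Section ExampleModules.
Context (K : fieldType) (r : nat).
Notation n := r.+2.
Local Notation Q := (ex_quiver r).
Local Notation V := (exV K r).
Local Notation mkV := (@mkV K r).
Local Notation unit_vec := (@unit_vec K r).
Local Notation exE := (@exE K r).

Definition ex_base : vertex Q := @Ordinal 5 0 isT.
Definition exA : falgType K := talg K 2 ex_base.
Definition ex_pres : presentation Q exA := trunc_pres K ex_base (m := 2) isT.
Definition exM (om : 'rV[K]_n) : fdmod exA :=
  quiver_rep ex_base (@exE1 K r) (@exEE K r) (@exEX K r om) (@exXE K r om) (@ex_short r).

Lemma exM_eps om v u : act (exM om) (eps ex_pres v) u = exE v u.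
Proof. exact: rep_eps. Qed.

(** The maps between these modules: scale by [b] away from the vertex 2 and by [s]
    there, and translate the last unit vector by [k]. *)
Definition hom_fun b s (k : 'rV[K]_n) (u : V) : V :=
  let: (p, q, (x, y, z)) := u in
  mkV (b *: p + last_coord p *: k) (b *: q + last_coord q *: k) (b * x) (s * y) (b * z).

Lemma hom_linear b s k : linear (hom_fun b s k).
Proof.
move=> c u w; have [p [q [x [y [z ->]]]]] := mkVP u.
have [p' [q' [x' [y' [z' ->]]]]] := mkVP w; rewrite mkVL /hom_fun /= mkVL.
have sE (v v' : 'rV[K]_n) : b *: (c *: v + v') + last_coord (c *: v + v') *: k =
  c *: (b *: v + last_coord v *: k) + (b *: v' + last_coord v' *: k).
  rewrite last_coordD last_coordZ !scalerDr scalerDl !scalerA [b * c]mulrC.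
  by rewrite addrACA.
by rewrite !sE !mulrDr !mulrA ![b * c]mulrC [s * c]mulrC.
Qed.
Definition ex_hom b s k : 'End(V) := mklin (hom_linear b s k).

Lemma last_unit i : last_coord (unit_vec (fintype.lift ord_max i)) = 0.
Proof. by rewrite /last_coord mxE eqxx /= (negbTE (neq_lift _ _)). Qed.

Lemma last_unit_max : last_coord (unit_vec ord_max) = 1.
Proof. by rewrite /last_coord mxE !eqxx. Qed.

Lemma ex_homP om om' b s k : last_coord k = 0 -> b *: om + last_coord om *: k = s *: om' ->
  @is_hom _ _ (exM om) (exM om') (ex_hom b s k).
Proof.
move=> k0 e; apply: rep_hom => [v u|a u]; rewrite !mklinE.
  have [p [q [x [y [z ->]]]]] := mkVP u.
  by case: v => -[|[|[|[|v]]]] hv; rewrite /vfun /hom_fun /= /last_coord ?mxE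
    ?mulr0 ?scaler0 ?scale0r ?addr0.
have [p [q [x [y [z ->]]]]] := mkVP u.
case: a => [i|[[|[|[|a]]] ha]]; rewrite /afun /hom_fun /=.
- rewrite last_coordZ last_unit mulr0 scale0r !addr0 scalerA !mulr0.
  by rewrite scaler0 /last_coord mxE scale0r addr0.
- by rewrite scaler0 /last_coord mxE scale0r addr0 !mulr0.
- rewrite scaler0 {1}/last_coord mxE scale0r addr0 !mulr0 last_coordZ.
  by rewrite [s * y]mulrC -[in RHS]scalerA -e scalerDr !scalerA [y * b]mulrC.
- by rewrite !scaler0 {1 2}/last_coord !mxE !scale0r !addr0 !mulr0.
by rewrite !scaler0 {1 2}/last_coord !mxE !scale0r !addr0 !mulr0 last_coordD !last_coordZ k0 mulr0 addr0.
Qed.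

Lemma ex_homE b s k p q x y z : ex_hom b s k (mkV p q x y z) =
  mkV (b *: p + last_coord p *: k) (b *: q + last_coord q *: k) (b * x) (s * y) (b * z).
Proof. by rewrite mklinE. Qed.

Lemma exM_arrow om a u : act (exM om) (arrow_elt K ex_base (m := 2) isT a) u = exX om a u.
Proof. exact: rep_arrow. Qed.

Lemma ex_Jmul om (W : submodule (exM om)) (Z : {vspace V}) :
  (forall a w, w \in Z -> exX om a w \in Z) ->
  (forall a w, w \in (W : {vspace V}) -> exX om a w \in Z) -> ((Jmul W : {vspace V}) <= Z)%VS.
Proof. exact: rep_Jmul. Qed.

Lemma ex_mem_Jmul om (W : submodule (exM om)) a (w : V) :
  w \in (W : {vspace V}) -> exX om a w \in (Jmul W : {vspace V}).
Proof. by move=> Ww; have := @mem_Jmul _ exA (exM om) W _ _ (arrow_elt_J K ex_base (m := 2) isT a) Ww; rewrite exM_arrow. Qed.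

Lemma eq_on_unit_vecs (f g : 'End(V)) : 
  (forall j, f (mkV (unit_vec j) 0 0 0 0) = g (mkV (unit_vec j) 0 0 0 0)) ->
  forall p, f (mkV p 0 0 0 0) = g (mkV p 0 0 0 0).
Proof.
move=> h p; have -> : mkV p 0 0 0 0 = \sum_j p 0 j *: mkV (unit_vec j) 0 0 0 0.
  have e (F : 'I_n -> 'rV[K]_n) : mkV (\sum_j F j) 0 0 0 0 = \sum_j mkV (F j) 0 0 0 0.
    by apply: (big_morph (fun p => mkV p 0 0 0 0)) => // u v; rewrite mkVD !addr0.
  rewrite {1}[p]row_sum_delta e; apply: eq_bigr => j _.
  by rewrite mkVZ !scaler0 !mulr0.
by rewrite !linear_sum; apply: eq_bigr => j _; rewrite !linearZ /= h.
Qed.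

(** The arrows from 1 to 0 make the images of the first [r.+1] unit vectors [b]
    times themselves; the arrows into 4 force the last coordinate of the image of
    the last one to be [b] as well. *)
Lemma ex_hom_form om om' (f : 'Hom(exM om, exM om')) : is_hom f -> exists b s k,
  [/\ last_coord k = 0, b *: om + last_coord om *: k = s *: om' & forall u, f u = ex_hom b s k u].
Proof.
move=> /homE hf.
have fE v u : f (exE v u) = exE v (f u) by exact: etrans (etrans (congr1 f (esym (@exM_eps om v u))) (hf _ _)) (@exM_eps om' v _).
have fX a u : f (exX om a u) = exX om' a (f u).
  exact: etrans (etrans (congr1 f (esym (@exM_arrow om a u))) (hf _ _)) (@exM_arrow om' a _).
pose e1 : vertex Q := @Ordinal 5 1 isT; pose e2 : vertex Q := @Ordinal 5 2 isT.
pose e0 : vertex Q := @Ordinal 5 0 isT.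
have [b fb] : exists b, f (mkV 0 0 1 0 0) = mkV 0 0 b 0 0.
  have h := fE e1 (mkV 0 0 1 0 0).
  have [p [q [x [y [z e]]]]] := mkVP (f (mkV 0 0 1 0 0)).
  by move: h; rewrite e !mklinE => h; exists x; exact: etrans (esym e) h.
have [s fs] : exists s, f (mkV 0 0 0 1 0) = mkV 0 0 0 s 0.
  have h := fE e2 (mkV 0 0 0 1 0).
  have [p [q [x [y [z e]]]]] := mkVP (f (mkV 0 0 0 1 0)).
  by move: h; rewrite e !mklinE => h; exists y; exact: etrans (esym e) h.
have [p' fp] : exists p, f (mkV (unit_vec ord_max) 0 0 0 0) = mkV p 0 0 0 0.
  have h := fE e0 (mkV (unit_vec ord_max) 0 0 0 0).
  have [p [q [x [y [z e]]]]] := mkVP (f (mkV (unit_vec ord_max) 0 0 0 0)).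
  by move: h; rewrite e !mklinE => h; exists p; exact: etrans (esym e) h.
have fc : f (mkV 0 0 0 0 1) = mkV 0 0 0 0 b.
  have := fX (inr (@Ordinal 4 2 isT)) (mkV 0 0 1 0 0).
  by rewrite fb !mklinE /afun /=.
have lp : last_coord p' = b.
  have := fX (inr (@Ordinal 4 3 isT)) (mkV (unit_vec ord_max) 0 0 0 0).
  by rewrite fp !mklinE /afun /= last_unit_max fc => -[].
pose k := p' - b *: unit_vec ord_max.
have k0 : last_coord k = 0.
  by rewrite /k -scaleN1r last_coordD !last_coordZ lp last_unit_max mulr1 mulN1r subrr.
have fP p : f (mkV p 0 0 0 0) = ex_hom b s k (mkV p 0 0 0 0).
  apply: eq_on_unit_vecs => j; rewrite ex_homE !mulr0 scaler0 /= {2}/last_coord mxE scale0r addr0.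
  have [i ->|->] := unliftP ord_max j.
    rewrite last_unit scale0r addr0.
    have := fX (inl i) (mkV 0 0 1 0 0); rewrite fb !mklinE /afun /= scale1r => ->.
    by [].
  by rewrite last_unit_max scale1r /k addrC subrK fp.
have fQ q : f (mkV 0 q 0 0 0) = ex_hom b s k (mkV 0 q 0 0 0).
  have := fX (inr (@Ordinal 4 0 isT)) (mkV q 0 0 0 0).
  rewrite fP !ex_homE !mklinE /afun /= => ->.
  by rewrite !mulr0 scaler0 /= {2}/last_coord mxE scale0r addr0.
exists b, s, k; split=> // [|u].
  have := fX (inr (@Ordinal 4 1 isT)) (mkV 0 0 0 1 0).
  rewrite fs !mklinE /afun /= scale1r fQ ex_homE => -[_ -> //].
have [p [q [x [y [z ->]]]]] := mkVP u.
have -> : mkV p q x y z = mkV p 0 0 0 0 + mkV 0 q 0 0 0 + x *: mkV 0 0 1 0 0 +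
    y *: mkV 0 0 0 1 0 + z *: mkV 0 0 0 0 1.
  by rewrite !mkVZ !mkVD !scaler0 !mulr0 !mulr1 !addr0 !add0r.
rewrite !linearD !linearZ /= fP fQ fb fs fc !ex_homE !scaler0 /last_coord !mxE !scale0r.
by rewrite !addr0 !mulr0 !mulr1.
Qed.

Lemma ex_nonzero om : nonzero (exM om).
Proof.
move=> e; have : (mkV 0 0 1 0 0 : exM om) \in (fullv : {vspace exM om}) by apply: memvf.
rewrite e memv0 => /eqP[] /eqP; by rewrite oner_eq0.
Qed.

Lemma ex_indecomposable om : om != 0 -> indecomposable (exM om).
Proof.
move=> om0; apply: (idem_indecomposable (@ex_nonzero om)) => f hf ff.
have [b [s [k [k0 e fE]]]] := ex_hom_form hf.
have bb : b * b = b.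
  have := ff (mkV 0 0 1 0 0); rewrite !fE !ex_homE => -[_ _].
  by rewrite !mulr1.
have kk : b *: k + b *: k = k.
  have := ff (mkV (unit_vec ord_max) 0 0 0 0); rewrite !fE !ex_homE => -[h _].
  move: h; rewrite last_coordD !last_coordZ last_unit_max k0 !mulr1 mulr0 addr0 scale1r.
  rewrite scalerDr scalerA bb -addrA => /addrI; exact.
have b01 : b = 0 \/ b = 1.
  have /eqP := bb; rewrite -subr_eq0 -{3}[b]mulr1 -mulrBr mulf_eq0 subr_eq0.
  by move=> /orP[/eqP|/eqP]; [left | right].
have kz : k = 0.
  have [b0|b1] := b01; first by rewrite -kk b0 !scale0r addr0.
  by apply: (@addrI _ k); rewrite addr0 -[RHS]kk b1 scale1r.
have bs : b = s.
  apply/eqP; rewrite -subr_eq0; move: e => /eqP; rewrite kz scaler0 addr0 -subr_eq0 -scalerBl.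
  by rewrite scaler_eq0 (negbTE om0) orbF.
have fu u : f u = b *: u.
  have [p [q [x [y [z ->]]]]] := mkVP u.
  by rewrite fE ex_homE kz !scaler0 !addr0 -bs mkVZ.
have [b0|b1] := b01; [left | right] => u; first by rewrite fu b0 scale0r.
by rewrite fu b1 scale1r.
Qed.

(** ** Radical layers *)

Definition W1 : {vspace V} := subspace_of (fun u : V =>
  let: (p, q, (x, y, z)) := u in [/\ last_coord p = 0, x = 0 & y = 0]).
Definition W2 : {vspace V} := subspace_of (fun u : V =>
  let: (p, q, (x, y, z)) := u in [/\ p = 0, last_coord q = 0 & [/\ x = 0, y = 0 & z = 0]]).

Lemma mem_W1 p q x y z : mkV p q x y z \in W1 <-> [/\ last_coord p = 0, x = 0 & y = 0].
Proof.
apply: (@subspace_ofP _ _ (fun u : V =>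
  let: (p, q, (x, y, z)) := u in [/\ last_coord p = 0, x = 0 & y = 0])).
  by split=> //; rewrite /last_coord mxE.
move=> c u v; have [p1 [q1 [x1 [y1 [z1 ->]]]]] := mkVP u.
have [p2 [q2 [x2 [y2 [z2 ->]]]]] := mkVP v; rewrite mkVL /=.
move=> [h1 h2 h3] [g1 g2 g3]; rewrite last_coordD last_coordZ h1 h2 h3 g1 g2 g3.
by rewrite !mulr0 !addr0.
Qed.

Lemma mem_W2 p q x y z : mkV p q x y z \in W2 <->
  [/\ p = 0, last_coord q = 0 & [/\ x = 0, y = 0 & z = 0]].
Proof.
apply: (@subspace_ofP _ _ (fun u : V =>
  let: (p, q, (x, y, z)) := u in [/\ p = 0, last_coord q = 0 & [/\ x = 0, y = 0 & z = 0]])).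
  by split=> //; rewrite /last_coord mxE.
move=> c u v; have [p1 [q1 [x1 [y1 [z1 ->]]]]] := mkVP u.
have [p2 [q2 [x2 [y2 [z2 ->]]]]] := mkVP v; rewrite mkVL /=.
move=> [h1 h2 [h3 h4 h5]] [g1 g2 [g3 g4 g5]]; rewrite last_coordD last_coordZ h1 h2 h3 h4 h5 g1 g2 g3 g4 g5.
by rewrite !mulr0 scaler0 !addr0.
Qed.

Lemma ex_X_W1 om a u : exX om a u \in W1.
Proof.
have [p [q [x [y [z ->]]]]] := mkVP u; rewrite mklinE.
case: a => [i|[[|[|[|a]]] ha]]; rewrite /afun /=; apply/mem_W1; split=> //; rewrite ?last_coordZ ?last_unit ?mulr0 //;
  by rewrite /last_coord mxE.
Qed.

Lemma ex_X_W2 om a u : u \in W1 -> exX om a u \in W2.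
Proof.
have [p [q [x [y [z ->]]]]] := mkVP u => /mem_W1[lp -> ->]; rewrite mklinE.
case: a => [i|[[|[|[|a]]] ha]]; rewrite /afun /=; apply/mem_W2; split=> //; rewrite ?scale0r ?lp //;
  by rewrite /last_coord mxE.
Qed.

Lemma ex_X_0 om a u : u \in W2 -> exX om a u = 0.
Proof.
have [p [q [x [y [z ->]]]]] := mkVP u => /mem_W2[-> lp [-> -> ->]]; rewrite mklinE.
by case: a => [i|[[|[|[|a]]] ha]]; rewrite /afun /= ?scale0r //= /last_coord mxE.
Qed.

Lemma W21 : (W2 <= W1)%VS.
Proof.
apply/subvP => u; have [p [q [x [y [z ->]]]]] := mkVP u => /mem_W2[-> _ [-> -> _]].
by apply/mem_W1; split=> //; rewrite /last_coord mxE.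
Qed.

Lemma ex_J1 om : Jmul (fullm (exM om)) = W1 :> {vspace V}.
Proof.
apply/eqP; rewrite eqEsubv; apply/andP; split.
  by apply: ex_Jmul => a w _; apply: ex_X_W1.
have JX a (w : exM om) : (exX om a w : exM om) \in (Jmul (fullm (exM om)) : {vspace exM om}).
  by apply: ex_mem_Jmul; apply: memvf.
apply/subvP => u; have [p [q [x [y [z ->]]]]] := mkVP u => /mem_W1[lp -> ->].
have -> : mkV p q 0 0 z = \sum_j p 0 j *: mkV (unit_vec j) 0 0 0 0 + mkV 0 q 0 0 0 + mkV 0 0 0 0 z.
  have e (F : 'I_n -> 'rV[K]_n) : mkV (\sum_j F j) 0 0 0 0 = \sum_j mkV (F j) 0 0 0 0.
    by apply: (big_morph (fun p => mkV p 0 0 0 0)) => // v w; rewrite mkVD !addr0.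
  rewrite (eq_bigr (fun j => mkV (p 0 j *: unit_vec j) 0 0 0 0)) => [|j _]; last first.
    by rewrite mkVZ !scaler0 !mulr0.
  by rewrite -e -row_sum_delta !mkVD !addr0 !add0r.
apply: memvD; first apply: memvD.
- apply: memv_suml => j _; have [i ->|->] := unliftP ord_max j; last first.
    by rewrite -[p 0 ord_max]/(last_coord p) lp scale0r mem0v.
  apply: memvZ; have := JX (inl i) (mkV 0 0 1 0 0).
  by rewrite mklinE /afun /= scale1r.
- by have := JX (inr (@Ordinal 4 0 isT)) (mkV q 0 0 0 0); rewrite mklinE.
by have := JX (inr (@Ordinal 4 2 isT)) (mkV 0 0 z 0 0); rewrite mklinE.
Qed.

Lemma ex_J2 om : Jmul (Jmul (fullm (exM om))) = W2 :> {vspace V}.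
Proof.
apply/eqP; rewrite eqEsubv; apply/andP; split.
  apply: ex_Jmul => a w; last by rewrite ex_J1; apply: ex_X_W2.
  by move=> /(subvP W21); apply: ex_X_W2.
apply/subvP => u; have [p [q [x [y [z ->]]]]] := mkVP u => /mem_W2[-> lq [-> -> ->]].
have q1 : (mkV q 0 0 0 0 : exM om) \in (Jmul (fullm (exM om)) : {vspace exM om}).
  by rewrite ex_J1; apply/mem_W1.
have := ex_mem_Jmul (inr (@Ordinal 4 0 isT)) q1.
by rewrite mklinE.
Qed.

Lemma ex_J3 om l : Jpow l.+3 (fullm (exM om)) = 0%VS :> {vspace V}.
Proof.
apply/eqP; rewrite -subv0; apply: ex_Jmul => a w; first by rewrite memv0 => /eqP->; rewrite linear0 mem0v.
move=> hw; rewrite memv0; apply/eqP/ex_X_0; rewrite -(ex_J2 om).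
by apply: (subvP (Jpow_le (fullm (exM om)) (isT : (2 <= l.+2)%N))).
Qed.

(** This is why all degenerations in the family are layer-stable. *)
Lemma ex_Jpow om om' l : Jpow l (fullm (exM om)) = Jpow l (fullm (exM om')) :> {vspace V}.
Proof.
case: l => [//|[|[|l]]]; last by rewrite !ex_J3.
  exact: etrans (ex_J1 om) (esym (ex_J1 om')).
exact: etrans (ex_J2 om) (esym (ex_J2 om')).
Qed.

Lemma ex_layers om om' l : miso (layer l (exM om)) (layer l (exM om')).
Proof.
apply: (layers_miso (pres := ex_pres)) => {}l v; rewrite /dimv_at.
have e om1 : act (exM om1) (eps ex_pres v) = exE v by apply/lfunP => u; apply: exM_eps.
by rewrite !e (ex_Jpow om om').
Qed.

Lemma ex_squarefree om : exists t, squarefree_top t (exM om).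
Proof.
exists 3%N.
pose z (i : 'I_3) : exM om := match nat_of_ord i with
  | 0 => mkV (unit_vec ord_max) 0 0 0 0 | 1 => mkV 0 0 1 0 0 | _ => mkV 0 0 0 1 0 end.
pose vx (i : 'I_3) : vertex Q := widen_ord (isT : (3 <= 5)%N) i.
have zs (c : 'I_3 -> K) : \sum_i c i *: z i =
  mkV (c ord0 *: unit_vec ord_max) 0 (c (@Ordinal 3 1 isT)) (c (@Ordinal 3 2 isT)) 0.
  rewrite !big_ord_recl big_ord0 /z /= !mkVZ !mkVD !scaler0 !mulr0 !mulr1 !addr0 !add0r.
  by congr (mkV _ _ (c _) (c _) _); apply: val_inj.
apply: (@frame_squarefree _ _ _ ex_pres 3 _ vx z); split.
- by move=> i j /(congr1 val) /= e; apply: val_inj.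
- move=> i; rewrite exM_eps mklinE.
  by case: i => -[|[|[|i]]] hi.
- move=> u; have [p [q [x [y [w ->]]]]] := mkVP u.
  exists (fun i => match nat_of_ord i with 0 => last_coord p | 1 => x | _ => y end).
  rewrite zs ex_J1 -scaleN1r mkVZ mkVD /=; apply/mem_W1; split.
  - by rewrite last_coordD !last_coordZ last_unit_max mulr1 mulN1r subrr.
  - by rewrite mulN1r subrr.
  by rewrite mulN1r subrr.
move=> c; rewrite zs ex_J1 => /mem_W1[]; rewrite last_coordZ last_unit_max mulr1 => h0 h1 h2 i.
case: i => -[|[|[|i]]] hi //; [rewrite -[RHS]h0 | rewrite -[RHS]h1 | rewrite -[RHS]h2];
  by congr c; apply: val_inj.
Qed.

End ExampleModules.

Section ExampleFamily.
Context (K : fieldType) (r : nat).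
Notation n := r.+2.
Local Notation Q := (ex_quiver r).
Local Notation V := (exV K r).
Local Notation mkV := (@mkV K r).
Local Notation unit_vec := (@unit_vec K r).
Local Notation exE := (@exE K r).
Local Notation exM := (@exM K r).
Local Notation exX := (@exX K r).
Local Notation exA := (exA K r).
Local Notation ex_hom := (@ex_hom K r).

Definition om_arrow : arrow Q := inr (@Ordinal 4 1 isT).

(** No arrow ends at the source of [om_arrow] and none starts at its target. *)
Lemma om_arrow_alone i s : chain i s -> om_arrow \in s -> s = [:: om_arrow].
Proof.
elim: s i => // e s IH i /= /andP[_ hs]; rewrite inE.
have [eo _|ne /= os] := eqVneq om_arrow e.
  by move: hs; rewrite -eo; case: s {IH} => [//|[j|[[|[|[|[|k]]]] hk]] s].
have es := IH _ hs os; rewrite {}es /= in hs *; move: hs.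
by case: e {ne} => [j|[[|[|[|[|k]]]] hk]].
Qed.

Lemma exX_om_linear c om om' u :
  exX (c *: om + om') om_arrow u = c *: exX om om_arrow u + exX om' om_arrow u.
Proof.
have [p [q [x [y [z ->]]]]] := mkVP u; rewrite !mklinE /afun /= mkVL.
by rewrite !mulr0 !scaler0 !addr0 scalerDr !scalerA [y * c]mulrC.
Qed.

Lemma exX_other om e u : e != om_arrow -> exX om e u = exX 0 e u.
Proof.
by have [p [q [x [y [z ->]]]]] := mkVP u; rewrite !mklinE; case: e => [i|[[|[|[|k]]] hk]].
Qed.

Definition om_coef (x : exA) : K :=
  \sum_(b : tpath Q 2) (x b : K) * (om_arrow \in tarrows b)%:R.

(** Only the path [om_arrow] itself acts in a way that depends on [om], and
    linearly. *)
Lemma act_affine om x u :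
  act (exM om) x u = act (exM 0) x u + om_coef x *: exX om om_arrow u.
Proof.
rewrite /= /rep_fun !sum_lfunE scaler_suml -big_split /=; apply: eq_bigr => b _.
rewrite !scale_lfunE -scalerA -scalerDr !path_actE; congr (_ *: _).
have [ob|ob] := boolP (om_arrow \in tarrows b).
  have eb := om_arrow_alone (tchain b) ob; rewrite eb /= scale1r.
  have sb : tstart b = src om_arrow.
    by have := tchain b; rewrite eb /= andbT => /eqP.
  rewrite sb !exXE.
  suff -> : exX 0 om_arrow u = 0 by rewrite add0r.
  by have := exX_om_linear (-1) 0 0 u; rewrite scaler0 addr0 scaleN1r addNr.
rewrite scale0r addr0; elim: (tarrows b) (exE _ u) ob => // e s IH w.
by rewrite inE negb_or eq_sym => /andP[eo os] /=; rewrite exX_other // IH.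
Qed.

Lemma ex_hom_miso om om' b s k : last_coord k = 0 -> b *: om + last_coord om *: k = s *: om' ->
  b != 0 -> s != 0 -> miso (exM om) (exM om').
Proof.
move=> k0 e b0 s0; exists (ex_hom b s k : 'Hom(exM om, exM om')).
have inj : injective (ex_hom b s k).
  suff ker u : ex_hom b s k u = 0 -> u = 0.
    by move=> u v h; apply/eqP; rewrite -subr_eq0; apply/eqP/ker; rewrite linearB /= h subrr.
  have [p [q [x [y [z ->]]]]] := mkVP u; rewrite ex_homE.
  have vz (v : 'rV[K]_n) : b *: v + last_coord v *: k = 0 -> v = 0.
    move=> h; have := congr1 (@last_coord K r) h; rewrite last_coordD !last_coordZ k0 mulr0 addr0.
    rewrite {2}/last_coord mxE => /eqP; rewrite mulf_eq0 (negbTE b0) => /eqP lv.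
    by move: h => /eqP; rewrite lv scale0r addr0 scaler_eq0 (negbTE b0) => /eqP.
  have sz c (v : K) : c != 0 -> c * v = 0 -> v = 0.
    by move=> c0 /eqP; rewrite mulf_eq0 (negbTE c0) => /eqP.
  by move=> [/vz-> /vz-> /(sz _ _ b0)-> /(sz _ _ s0)-> /(sz _ _ b0)->].
have ker0 : lker (ex_hom b s k) = 0%VS by apply/lker0_inj.
by split; [exact: ex_homP | exact: ker0 | exact: inj_surj].
Qed.

Lemma ex_miso_scale c om : c != 0 -> miso (exM om) (exM (c *: om)).
Proof.
move=> c0; apply: (@ex_hom_miso _ _ c 1 0); rewrite ?oner_neq0 //.
  by rewrite /last_coord mxE.
by rewrite scaler0 addr0 scale1r.
Qed.

(** Translating the last unit vector moves any parameter with a nonzero last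
    coordinate to a multiple of the last unit vector. *)
Lemma ex_miso_generic om : last_coord om != 0 -> miso (exM (unit_vec ord_max)) (exM om).
Proof.
move=> l0; apply: miso_sym; set t := last_coord om in l0 *.
pose k := unit_vec ord_max - t^-1 *: om.
apply: (@ex_hom_miso _ _ 1 t k) => //; rewrite ?oner_neq0 //.
  by rewrite /k -scaleN1r !last_coordD !last_coordZ last_unit_max -/t mulVf // mulr1 subrr.
by rewrite /k scale1r -/t scalerBr scalerA mulfV // scale1r addrC subrK.
Qed.

Lemma ex_miso_inv om om' : last_coord om = 0 -> miso (exM om) (exM om') ->
  exists b s, [/\ b != 0, s != 0 & b *: om = s *: om'].
Proof.
move=> l0 [f [hf /lker0_inj f0 _]].
have [b [s [k [k0 e fE]]]] := ex_hom_form hf.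
move: e; rewrite l0 scale0r addr0 => e.
exists b, s; split=> //; apply/eqP => z.
  have : f (mkV 0 0 1 0 0) = f 0.
    by rewrite linear0 fE ex_homE z !scaler0 /last_coord mxE !scale0r !addr0 !mulr0 mul0r.
  by move=> /f0[] /eqP; rewrite oner_eq0.
have : f (mkV 0 0 0 1 0) = f 0.
  by rewrite linear0 fE ex_homE z !scaler0 /last_coord mxE !scale0r !addr0 !mulr0 mul0r.
by move=> /f0[] /eqP; rewrite oner_eq0.
Qed.

(** The embedding of [K ^ r.+1] as the hyperplane on which the last coordinate
    vanishes. *)
Definition omv (v : 'rV[K]_r.+1) : 'rV[K]_n :=
  \sum_i v 0 i *: unit_vec (fintype.lift ord_max i).

Lemma omv_lift v i : omv v 0 (fintype.lift ord_max i) = v 0 i.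
Proof.
rewrite summxE (bigD1 i) //= !mxE !eqxx mulr1 big1 ?addr0 // => j ji.
by rewrite !mxE (inj_eq (@lift_inj _ _)) [i == j]eq_sym (negbTE ji) andbF mulr0.
Qed.

Lemma omv_last v : last_coord (omv v) = 0.
Proof.
by rewrite /last_coord summxE big1 // => i _; rewrite !mxE (negbTE (neq_lift _ _)) andbF mulr0.
Qed.

Lemma omvZ c v : omv (c *: v) = c *: omv v.
Proof. by rewrite /omv scaler_sumr; apply: eq_bigr => i _; rewrite mxE scalerA. Qed.

Lemma omv_inj : injective omv.
Proof. by move=> u v h; apply/rowP => i; rewrite -!omv_lift h. Qed.

Lemma omv0 : omv 0 = 0.
Proof. by have := omvZ 0 0; rewrite !scale0r. Qed.

Section Points.
Context (m : nat) (a : 'I_m -> exA).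
Notation d := (dim V).

(** All modules of the family live on the same space, so one coordinate system
    serves them all and the points depend on [om] in an affine way. *)
Definition ex_coord : 'Hom('cV[K]_d, V) := std_coord (exM 0).
Definition ex_point om : mpoint K m d := @point_of K exA m a d (exM om) ex_coord.
Lemma ex_coord_inj : lker ex_coord = 0%VS.
Proof. exact: (std_coord_inj (exM 0)). Qed.
Lemma ex_coord_full : limg ex_coord = fullv.
Proof. exact: (std_coord_full (exM 0)). Qed.

Lemma ex_point_represents om : represents a (ex_point om) (exM om).
Proof. exact: (@point_of_represents K exA m a d (exM om) ex_coord ex_coord_inj ex_coord_full). Qed.

Definition coord_mx (f : 'End(V)) : 'M[K]_d := colmx (ex_coord^-1 \o f \o ex_coord)%VF.

Lemma coord_mxL c f g : coord_mx (c *: f + g) = c *: coord_mx f + coord_mx g.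
Proof.
apply: colmx_inj => v; rewrite mulmxDl -scalemxAl !colmxE !comp_lfunE.
by rewrite add_lfunE scale_lfunE linearP.
Qed.

Lemma ex_pointE om i : ex_point om i = coord_mx (act (exM om) (a i)).
Proof. exact: ffunE. Qed.

Definition ex_slope om i : 'M[K]_d := om_coef (a i) *: coord_mx (exX om om_arrow).

Lemma act_affine_lfun om x :
  act (exM om) x = om_coef x *: exX om om_arrow + act (exM 0) x :> 'End(V).
Proof. by apply/lfunP => u; rewrite add_lfunE scale_lfunE addrC; apply: act_affine. Qed.

Lemma ex_point_affine om i : ex_point om i = ex_point 0 i + ex_slope om i.
Proof. 
have e : coord_mx (act (exM om) (a i)) = ex_slope om i + coord_mx (act (exM 0) (a i)).
  exact: etrans (congr1 coord_mx (act_affine_lfun om (a i))) (coord_mxL _ _ _).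
exact: etrans (ex_pointE om i) (etrans e (etrans (addrC _ _)
  (congr2 +%R (esym (ex_pointE 0 i)) (erefl (ex_slope om i))))). Qed.

Lemma ex_slope_linear c om om' i :
  ex_slope (c *: om + om') i = c *: ex_slope om i + ex_slope om' i.
Proof.
have e : exX (c *: om + om') om_arrow = c *: exX om om_arrow + exX om' om_arrow.
  by apply/lfunP => u; rewrite add_lfunE scale_lfunE; apply: exX_om_linear.
by rewrite /ex_slope e coord_mxL scalerDr !scalerA [c * _]mulrC.
Qed.

Lemma ex_slope_sum (I : Type) (s : seq I) (c : I -> K) (w : I -> 'rV[K]_n) i :
  ex_slope (\sum_(j <- s) c j *: w j) i = \sum_(j <- s) c j *: ex_slope (w j) i.
Proof.
elim: s => [|j s IH]; last by rewrite !big_cons ex_slope_linear IH.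
rewrite !big_nil; have := ex_slope_linear (-1) 0 0 i.
by rewrite scaler0 addr0 scaleN1r addNr.
Qed.

End Points.
End ExampleFamily.

Section Proj.
Context (K : closedFieldType) (r m : nat) (a : 'I_m -> exA K r).
Local Notation unit_vec := (@unit_vec K r).
Local Notation exM := (@exM K r).
Local Notation omv := (@omv K r).
Notation n := r.+2.

(** On the line of parameters [omv v + c *: unit_vec ord_max], all points with [c !=
    0] represent the module with parameter [unit_vec ord_max]. *)
Lemma ex_degeneration v : degeneration a (exM (unit_vec ord_max)) (exM (omv v)).
Proof.
have r1 : represents a (ex_point a (unit_vec ord_max)) (exM (unit_vec ord_max)).
  exact: ex_point_represents.
have r2 : represents a (ex_point a (omv v)) (exM (omv v)).
  exact: ex_point_represents.
exists (dim (exV K r)), (ex_point a (unit_vec ord_max)), (ex_point a (omv v)); split=> //.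
apply: (@line_closure K m _ _ _ [ffun i => ex_slope a (unit_vec ord_max) i]) => c c0.
pose om := c *: unit_vec ord_max + omv v.
have pE i : ex_point a om i = ex_point a (omv v) i + c *: ex_slope a (unit_vec ord_max) i.
  have addE (W : zmodType) (x y z s t : W) : x = z + (s + t) -> y = z + t -> x = y + s.
    by move=> -> ->; rewrite [s + t]addrC addrA.
  have := ex_point_affine a om i; rewrite ex_slope_linear => e.
  exact: addE e (ex_point_affine a (omv v) i).
have ro : represents a (ex_point a om) (exM om) by apply: ex_point_represents.
move: (ex_point a om) (ex_point a (omv v)) pE r1 ro {r2} => x x0 pE r1 ro.
have -> : [ffun i => x0 i + c *: [ffun i => ex_slope a (unit_vec ord_max) i] i] = x.
  by apply/ffunP => i; rewrite pE !ffunE.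
apply: (orbit_represents r1); apply: (@represents_miso _ _ _ _ _ _ (exM om)) => //.
apply: miso_sym; apply: ex_miso_generic.
by rewrite last_coordD last_coordZ omv_last last_unit_max mulr1 addr0.
Qed.

Lemma ex_layer_stable v : layer_stable_degeneration a (exM (unit_vec ord_max)) (exM (omv v)).
Proof. by split=> [|l]; [apply: ex_degeneration | apply: ex_layers]. Qed.

(** Proportional parameters give isomorphic modules, so the choice of a vector on
    the line does not matter. *)
Definition ex_family (L : proj_space K r) : fdmod (exA K r) := exM (omv (vpick (val L))).

Lemma vpick_line (L : proj_space K r) : val L = <[vpick (val L)]>%VS /\ vpick (val L) != 0.
Proof.
have L0 : vpick (val L) != 0.
  by rewrite vpick0 -dimv_eq0 (eqP (valP L)).
split=> //; apply/esym/eqP; rewrite eqEdim dim_vline L0 (eqP (valP L)) leqnn andbT.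
by rewrite -memvE memv_pick.
Qed.

(** Parameters with zero last coordinate cannot be translated, only scaled. *)
Lemma ex_family_inj L L' : miso (ex_family L) (ex_family L') -> L = L'.
Proof.
move=> /(ex_miso_inv (omv_last _))[b [s [b0 s0]]]; rewrite -!omvZ => /omv_inj e.
have [eL _] := vpick_line L; have [eL' _] := vpick_line L'.
apply: val_inj; rewrite eL eL'; apply/eqP; rewrite eqEsubv -!memvE; apply/andP; split.
  rewrite -[vpick (val L)](scalerK b0) e scalerA; exact: memvZ (memv_line _).
rewrite -[vpick (val L')](scalerK s0) -e scalerA; exact: memvZ (memv_line _).
Qed.

Lemma ex_family_indecomposable L : indecomposable (ex_family L).
Proof.
apply: ex_indecomposable; have [_ L0] := vpick_line L.
by apply: contra L0 => /eqP h; apply/eqP/omv_inj; rewrite omv0.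
Qed.

Lemma proj_open_chart (i : 'I_r.+1) : proj_open (fun L : proj_space K r => hcoord L i != 0).
Proof.
exists (fun f => f = 'X_i); split=> [f ->|L].
  by exists 1%N; rewrite dhomogX; apply/eqP/mdeg1.
by split=> [h|[f ->]]; [exists 'X_i; rewrite ?mevalXU | rewrite mevalXU].
Qed.

Lemma ex_point_entry v i p q : ex_point a (omv v) i p q =
  ex_point a 0 i p q + \sum_j v 0 j * ex_slope a (unit_vec (fintype.lift ord_max j)) i p q.
Proof.
apply: etrans (congr1 (fun x : 'M_(_) => x p q) (ex_point_affine a (omv v) i)) _.
rewrite mxE; congr (_ + _); rewrite /omv ex_slope_sum summxE.
by apply: eq_bigr => j _; rewrite mxE.
Qed.

(** On the chart where the coordinate [i0] does not vanish, parameters are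
    normalized to have [i0]-th coordinate one; the entries are then affine functions
    of the ratios of homogeneous coordinates. *)
Lemma ex_proj_family : proj_family a ex_family.
Proof.
exists (dim (exV K r)) => L.
have [i0 hi0] : exists i, hcoord L i != 0.
  apply/existsP; rewrite -negb_forall; have [_ /negP L0] := vpick_line L.
  apply/negP => /forallP h; apply: L0; apply/eqP/rowP => i; rewrite mxE; exact: eqP (h i).
exists (fun L' => hcoord L' i0 != 0),
  (fun L' => ex_point a (omv ((hcoord L' i0)^-1 *: vpick (val L')))).
have rep L' : hcoord L' i0 != 0 ->
    represents a (ex_point a (omv ((hcoord L' i0)^-1 *: vpick (val L')))) (ex_family L').
  move=> h; rewrite omvZ.
  apply: (@represents_miso _ _ _ _ _ _ (exM ((hcoord L' i0)^-1 *: omv (vpick (val L'))))).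
    exact: ex_point_represents.
  by apply: miso_sym; apply: ex_miso_scale; rewrite invr_neq0.
split=> //; first exact: proj_open_chart.
split=> [L' /rep[] //|i p q L1 L1U].
pose u j := ex_slope a (unit_vec (fintype.lift ord_max j)) i p q.
exists (fun L' => hcoord L' i0 != 0), 1%N,
  (ex_point a 0 i p q *: 'X_i0 + \sum_j u j *: 'X_j), 'X_i0; split=> //.
- exact: proj_open_chart.
- have hX j : ('X_j : {mpoly K[r.+1]}) \is 1%N.-homog.
    by rewrite dhomogX; apply/eqP/mdeg1.
  apply: rpredD; first exact/rpredZ/hX.
  by apply: rpred_sum => j _; apply/rpredZ/hX.
- by rewrite dhomogX; apply/eqP/mdeg1.
move=> L' L'U _; rewrite mevalXU; split=> //.
apply: etrans (ex_point_entry _ _ _ _) _.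
rewrite mevalD mevalZ mevalXU mulrDl mulfK //; congr (_ + _).
rewrite raddf_sum mulr_suml; apply: eq_bigr => j _ /=.
by rewrite mevalZ mevalXU mxE /u -/(hcoord L' j) mulrC mulrA [RHS]mulrAC mulrAC.
Qed.

End Proj.

Theorem theoremB (K : closedFieldType) :
  (forall (Q : quiver) (A : falgType K) (pres : presentation Q A)
          (n : nat) (a : 'I_n -> A) (ha : generates a)
          (M : fdmod A) (t : nat) (ht : squarefree_top t M)
          (P : fdmod A) (hP : projective_cover P (top M))
          (s : nat) (hs : indec_decomp s M),
     ((sum_of_locals M <-> t%:Z - s%:Z = 0) /\
      (sum_of_locals M ->
         ~ exists M', proper_layer_stable_degeneration a M M')) /\
     (frak_m P M = 0 ->
        forall M', minimal_layer_stable_degeneration a M M' ->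
          exists2 U : submodule M, layer_stably_embedded U &
            miso M' (dsum (subm U) (quotm U)))) /\
  (forall r : nat, (0 < r)%N ->
     exists (Q : quiver) (A : falgType K) (pres : presentation Q A),
       forall (n : nat) (a : 'I_n -> A), generates a ->
         exists M : fdmod A,
           indecomposable M /\ (exists t, squarefree_top t M) /\
           exists F : proj_space K r -> fdmod A,
             [/\ proj_family a F,
                 forall k k', k <> k' -> ~ miso (F k) (F k'),
                 forall k, indecomposable (F k) &
                 forall k, layer_stable_degeneration a M (F k)]).

Proof.
split=> [Q A pres n a ha M t ht P hP s hs|r _].
  split; last by move=> m0 M'; apply: (minimal_split pres ha ht hP m0).
  have ts : sum_of_locals M <-> t%:Z - s%:Z = 0.
    rewrite (locals_iff pres ht hs); split=> [->|/eqP]; first exact: subrr.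
    by rewrite subr_eq0 => /eqP[].
  by split=> // hl [M' [lM' nM']]; apply/nM'/(locals_rigid pres ha ht hl lM').
exists (ex_quiver r), (exA K r), (ex_pres K r) => n a _.
exists (exM (unit_vec K ord_max)); split.
  apply: ex_indecomposable; apply/eqP => /(congr1 (@last_coord K r)).
  by rewrite last_unit_max /last_coord mxE => /eqP; rewrite oner_eq0.
split; first exact: ex_squarefree.
exists (@ex_family K r); split.
- exact: ex_proj_family.
- by move=> k k' ne /ex_family_inj.
- exact: ex_family_indecomposable.
by move=> L; apply: ex_layer_stable.
Qed.
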